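(* Let $X$ be a four-dimensional manifold with a fixed flat torsionless affine connection $\nabla$ (the inertial connection), and consider Lorentzian metrics $g$ on $X$, with metric variations that are compactly supported, or subject to boundary conditions that remove the metric surface term. In this sector, stationary points $g$ of the bulk STEGR metric action $$S[g]=-\frac{2}{\kappa^2}\int d^4x\,\sqrt{-g}\;\mathbb Q(g,Q),\qquad Q_{\rho\mu\nu}=\nabla_\rho g_{\mu\nu},$$ are in one-to-one correspondence with stationary points $(g,\Pi)$ of the first-order action $$S_H[g,\Pi]=\int d^4x\left[\Pi^{\rho\mu\nu}\nabla_\rho g_{\mu\nu}-\sqrt{-g}\,\mathcal H_{\rm STEGR}(g,\Pi)\right],$$ where $g$ and the weight-one tensor density $\Pi^{\rho\mu\nu}=\Pi^{\rho\nu\mu}$ are varied independently and the connection is not varied. The correspondence is given by the invertible Legendre map $\Pi^{\rho\mu\nu}=\partial(\sqrt{-g}\,\mathcal L)/\partial Q_{\rho\mu\nu}$, with $Q_{\rho\mu\nu}=\nabla_\rho g_{\mu\nu}$ and $\sqrt{-g}\,\mathcal L=-\frac{2}{\kappa^2}\sqrt{-g}\,\mathbb Q$.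
   Context: Signature $(-,+,+,+)$; $\kappa^2>0$ is a constant; indices are moved with $g$. For a tensor $Y_{\rho\mu\nu}=Y_{\rho\nu\mu}$ the traces are $Y_\rho=Y_{\rho\lambda}{}^\lambda$ and $\widetilde Y_\rho=Y_{\lambda\rho}{}^\lambda$ (used for $Q$ and $\Pi$). The nonmetricity scalar is $$\mathbb Q=-\tfrac14Q_{\rho\mu\nu}Q^{\rho\mu\nu}+\tfrac12Q_{\rho\mu\nu}Q^{\mu\nu\rho}+\tfrac14Q_\mu Q^\mu-\tfrac12Q_\mu\widetilde Q^\mu .$$ The Hamiltonian density is the fiberwise Legendre transform $\sqrt{-g}\,\mathcal H_{\rm STEGR}=\Pi^{\rho\mu\nu}Q_{\rho\mu\nu}-\sqrt{-g}\,\mathcal L$ with $Q$ expressed through $\Pi$, explicitly $$\sqrt{-g}\,\mathcal H_{\rm STEGR}=-\frac{\kappa^2}{2\sqrt{-g}}\left(\Pi^{\rho\mu\nu}\Pi_{\mu\nu\rho}+\tfrac16\Pi^\mu\Pi_\mu-\tfrac23\Pi^\mu\widetilde\Pi_\mu-\tfrac13\widetilde\Pi^\mu\widetilde\Pi_\mu\right).$$ A stationary point is a configuration at which the first variation of the action vanishes for all allowed variations, i.e. a solution of the bulk Euler--Lagrange equations. *)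

(* Defs.v *)
(* MathComp-Analysis, over an arbitrary [R : realType]. *)
From HB Require Import structures.
From mathcomp Require Import all_boot all_order all_algebra.
From mathcomp Require Import all_classical all_reals all_analysis.

Set Implicit Arguments.
Unset Strict Implicit.
Unset Printing Implicit Defensive.

Import Order.TTheory GRing.Theory Num.Theory.
Import numFieldNormedType.Exports.

Local Open Scope classical_set_scope.
Local Open Scope ring_scope.

(** * Calculus on open subsets of R^4 *)

Definition pd (R : realType) (i : 'I_4) (f : 'rV[R]_4 -> R) : 'rV[R]_4 -> R :=
  fun x => 'D_(delta_mx 0 i) f x.

Fixpoint Ck_on (R : realType) (k : nat) (U : set 'rV[R]_4)
    (f : 'rV[R]_4 -> R) : Prop :=
  {in U, continuous f} /\
  match k with
  | 0 => True
  | k'.+1 => forall i : 'I_4,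
      (forall x, U x -> derivable f x (delta_mx 0 i)) /\ Ck_on k' U (pd i f)
  end.

Definition smooth_on (R : realType) (U : set 'rV[R]_4) (f : 'rV[R]_4 -> R) :
    Prop :=
  forall k, Ck_on k U f.

(* The product Lebesgue measure lives on nested pairs; [vec4] identifies these
   with row vectors, whose topology and derivatives are used elsewhere. *)
Definition vec4 (R : realType)
    (u : measurableTypeR R * measurableTypeR R * measurableTypeR R
         * measurableTypeR R) : 'rV[R]_4 :=
  \row_i nth 0 [:: u.1.1.1; u.1.1.2; u.1.2; u.2] i.

Definition lebesgue4 (R : realType) :=
  (((@lebesgue_measure R \x @lebesgue_measure R) \x @lebesgue_measure R)
     \x @lebesgue_measure R)%E.

Definition integral4 (R : realType) (B : set 'rV[R]_4) (f : 'rV[R]_4 -> R) : R :=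
  Rintegral (@lebesgue4 R) (@vec4 R @^-1` B) (f \o @vec4 R).

(** * Smooth four-manifolds *)

(* [chart_coord c] and [chart_param c] are meaningful only on [chart_dom c] and on its image. *)
Record manifold4 (R : realType) := Manifold4 {
  carrier :> topologicalType;
  chart : Type;
  chart_dom : chart -> set carrier;
  chart_coord : chart -> carrier -> 'rV[R]_4;
  chart_param : chart -> 'rV[R]_4 -> carrier;
  manifold_hausdorff : hausdorff_space carrier;
  manifold_second_countable : @second_countable carrier;
  chart_dom_open : forall c, open (chart_dom c);
  chart_cover : \bigcup_c chart_dom c = setT;
  chart_img_open : forall c, open (chart_coord c @` chart_dom c);
  chart_coordK : forall c, {in chart_dom c, cancel (chart_coord c) (chart_param c)};
  chart_coord_continuous : forall c, {in chart_dom c, continuous (chart_coord c)};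
  chart_param_continuous : forall c, {in chart_coord c @` chart_dom c, continuous (chart_param c)};
  transition_smooth : forall c d (i : 'I_4),
    smooth_on (chart_coord c @` (chart_dom c `&` chart_dom d))
              (fun x => chart_coord d (chart_param c x) 0 i)
}.

Definition cimg (R : realType) (X : manifold4 R) (c : chart X) :
    set 'rV[R]_4 :=
  chart_coord c @` chart_dom c.

Definition overlap (R : realType) (X : manifold4 R) (c d : chart X) :
    set 'rV[R]_4 :=
  chart_coord c @` (chart_dom c `&` chart_dom d).

Definition transition (R : realType) (X : manifold4 R) (c d : chart X) :
    'rV[R]_4 -> 'rV[R]_4 :=
  fun x => chart_coord d (chart_param c x).

(* jac c d x a m = d x_d^a / d x_c^m *)
Definition jac (R : realType) (X : manifold4 R) (c d : chart X)
    (x : 'rV[R]_4) : 'M[R]_4 :=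
  \matrix_(a, m) pd m (fun y => transition c d y 0 a) x.

(** * Tensor fields and connections, by their components in the charts *)

Definition tensor3 (R : realType) := 'I_4 -> 'I_4 -> 'I_4 -> R.

Definition sym3 (R : realType) : set (tensor3 R) :=
  [set Y | forall r m n, Y r m n = Y r n m].

(* Component functions are total; requiring them to vanish off the image of
   the chart makes equality of families coincide with equality of fields. *)
Definition sym2_field (R : realType) (X : manifold4 R)
    (h : chart X -> 'rV[R]_4 -> 'M[R]_4) : Prop :=
  [/\ forall c m n, smooth_on (cimg c) (fun x => h c x m n),
      forall c x, ~ cimg c x -> h c x = 0,
      forall c x, (h c x)^T = h c x &
      forall c d x, overlap c d x ->
        h c x = (jac c d x)^T *m h d (transition c d x) *m jac c d x].

Definition minkowski (R : realType) : 'M[R]_4 :=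
  diag_mx (\row_i (if i == 0 then -1 else 1)).

Definition lorentzian (R : realType) (g : 'M[R]_4) : Prop :=
  exists2 A : 'M[R]_4, A \in unitmx & A^T *m g *m A = minkowski R.

Definition lorentz_metric (R : realType) (X : manifold4 R)
    (g : chart X -> 'rV[R]_4 -> 'M[R]_4) : Prop :=
  sym2_field g /\ forall c x, cimg c x -> lorentzian (g c x).

(* Weight one means that the components scale like sqrt(-det g), i.e. with the
   absolute value of the Jacobian; no orientation is involved. *)
Definition density3_field (R : realType) (X : manifold4 R)
    (P : chart X -> 'rV[R]_4 -> tensor3 R) : Prop :=
  [/\ forall c r m n, smooth_on (cimg c) (fun x => P c x r m n),
      forall c x, ~ cimg c x -> forall r m n, P c x r m n = 0,
      forall c x, sym3 (P c x) &
      forall c d x, overlap c d x -> forall a b e,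
        P d (transition c d x) a b e =
        `|\det (jac c d x)|^-1 * \sum_r \sum_m \sum_n
          jac c d x a r * jac c d x b m * jac c d x e n * P c x r m n].

(* Gamma c x l m n is the Christoffel symbol with upper index l in
   nabla_m partial_n = Gamma^l_{mn} partial_l. *)
Definition affine_connection (R : realType) (X : manifold4 R)
    (Gamma : chart X -> 'rV[R]_4 -> tensor3 R) : Prop :=
  (forall c l m n, smooth_on (cimg c) (fun x => Gamma c x l m n)) /\
  forall c d x, overlap c d x -> forall a m n,
    \sum_l jac c d x a l * Gamma c x l m n =
    \sum_b \sum_e jac c d x b m * jac c d x e n * Gamma d (transition c d x) a b e
    + pd m (fun y => jac c d y a n) x.

Definition torsionless (R : realType) (X : manifold4 R)
    (Gamma : chart X -> 'rV[R]_4 -> tensor3 R) : Prop :=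
  forall c x, cimg c x -> forall l m n, Gamma c x l m n = Gamma c x l n m.

Definition riemann (R : realType) (X : manifold4 R)
    (Gamma : chart X -> 'rV[R]_4 -> tensor3 R) (c : chart X) (x : 'rV[R]_4)
    (l s m n : 'I_4) : R :=
  pd m (fun y => Gamma c y l n s) x - pd n (fun y => Gamma c y l m s) x
  + \sum_a (Gamma c x l m a * Gamma c x a n s - Gamma c x l n a * Gamma c x a m s).

Definition flat (R : realType) (X : manifold4 R)
    (Gamma : chart X -> 'rV[R]_4 -> tensor3 R) : Prop :=
  forall c x, cimg c x -> forall l s m n, riemann Gamma c x l s m n = 0.

(* Q_{rmn} = nabla_r g_{mn} *)
Definition nabla (R : realType) (X : manifold4 R)
    (Gamma : chart X -> 'rV[R]_4 -> tensor3 R)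
    (g : chart X -> 'rV[R]_4 -> 'M[R]_4) (c : chart X) (x : 'rV[R]_4) :
    tensor3 R :=
  fun r m n => pd r (fun y => g c y m n) x
    - \sum_l (Gamma c x l r m * g c x l n + Gamma c x l r n * g c x m l).

(** * Pointwise algebra *)

Definition contract3 (R : realType) (Y Z : tensor3 R) : R :=
  \sum_r \sum_m \sum_n Y r m n * Z r m n.

(* Raises all indices for G = invmx g, lowers them for G = g. *)
Definition move3 (R : realType) (G : 'M[R]_4) (Y : tensor3 R) : tensor3 R :=
  fun a b e => \sum_r \sum_m \sum_n G a r * G b m * G e n * Y r m n.

(* The traces Y_r = Y_{rl}^l and tilde Y_r = Y_{lr}^l of Y_{rmn}. *)
Definition trace3 (R : realType) (g : 'M[R]_4) (Y : tensor3 R) (r : 'I_4) : R :=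
  \sum_l \sum_s invmx g l s * Y r l s.

Definition trace3t (R : realType) (g : 'M[R]_4) (Y : tensor3 R) (r : 'I_4) : R :=
  \sum_l \sum_s invmx g l s * Y l r s.

Definition dot1 (R : realType) (g : 'M[R]_4) (u v : 'I_4 -> R) : R :=
  \sum_r \sum_s invmx g r s * u r * v s.

Definition cyc (R : realType) (Y : tensor3 R) : tensor3 R :=
  fun r m n => Y m n r.

Definition nonmetricity_scalar (R : realType) (g : 'M[R]_4) (Q : tensor3 R) : R :=
  let Qup := move3 (invmx g) Q in
  - 4^-1 * contract3 Q Qup + 2^-1 * contract3 Q (cyc Qup)
  + 4^-1 * dot1 g (trace3 g Q) (trace3 g Q)
  - 2^-1 * dot1 g (trace3 g Q) (trace3t g Q).

Definition sqrtmdet (R : realType) (g : 'M[R]_4) : R := Num.sqrt (- \det g).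

(* sqrt(-g) L, where kappa2 stands for kappa^2 *)
Definition lagrangian (R : realType) (kappa2 : R) (g : 'M[R]_4)
    (Q : tensor3 R) : R :=
  - (2 / kappa2) * sqrtmdet g * nonmetricity_scalar g Q.

(* sqrt(-g) H_STEGR; the argument P carries upper indices. *)
Definition hamiltonian (R : realType) (kappa2 : R) (g : 'M[R]_4)
    (P : tensor3 R) : R :=
  let Plow := move3 g P in
  - (kappa2 / (2 * sqrtmdet g)) *
  (contract3 P (cyc Plow)
   + 6^-1 * dot1 g (trace3 g Plow) (trace3 g Plow)
   - 2 / 3 * dot1 g (trace3 g Plow) (trace3t g Plow)
   - 3^-1 * dot1 g (trace3t g Plow) (trace3t g Plow)).

(* Derivatives with respect to Q are taken in the space of tensors symmetric
   in the last two indices: the momentum is normalised by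
   delta(sqrt(-g) L) = P^{rmn} delta Q_{rmn}, so that P^{rmn} is the derivative
   of sqrt(-g) L along the symmetrised unit tensor. *)
Definition sym_unit (R : realType) (r m n : 'I_4) : tensor3 R :=
  fun a b e => 2^-1 * ([&& a == r, b == m & e == n]%:R
                       + [&& a == r, b == n & e == m]%:R).

Definition legendre (R : realType) (kappa2 : R) (g : 'M[R]_4) (Q : tensor3 R) :
    tensor3 R :=
  fun r m n =>
    derive1 (fun t : R => lagrangian kappa2 g
      (fun a b e => Q a b e + t * sym_unit R r m n a b e)) 0.

Definition legendre_field (R : realType) (kappa2 : R) (X : manifold4 R)
    (Gamma : chart X -> 'rV[R]_4 -> tensor3 R)
    (g : chart X -> 'rV[R]_4 -> 'M[R]_4) :
    chart X -> 'rV[R]_4 -> tensor3 R :=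
  fun c x => if x \in cimg c then legendre kappa2 (g c x) (nabla Gamma g c x)
             else fun _ _ _ => 0.

(** * Integration and stationary points *)

(* A relatively compact region of X, cut into finitely many disjoint Borel
   pieces, each given in one chart.  Every compact subset of X can be so cut,
   and by the change of variables formula the integral of a density does not
   depend on how it is cut; the integral is therefore indexed by the cut. *)
Record region (R : realType) (X : manifold4 R) := Region {
  npieces : nat;
  piece_chart : 'I_npieces -> chart X;
  piece : 'I_npieces -> set 'rV[R]_4;
  piece_measurable : forall i, measurable (@vec4 R @^-1` piece i);
  piece_relcompact : forall i, exists2 C : set 'rV[R]_4,
    compact C & piece i `<=` C /\ C `<=` cimg (piece_chart i);
  piece_disjoint : trivIset setT (fun i => chart_param (piece_chart i) @` piece i)
}.

Definition region_set (R : realType) (X : manifold4 R) (D : region X) : set X :=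
  \bigcup_i (chart_param (piece_chart i) @` @piece R X D i).

Definition integral_on (R : realType) (X : manifold4 R) (D : region X)
    (w : chart X -> 'rV[R]_4 -> R) : R :=
  \sum_(i < npieces D) integral4 (@piece R X D i) (w (piece_chart i)).

(* The contributions of D to the two actions.  Over all of X the integrals may
   diverge, but a variation supported in D changes only this part. *)
Definition stegr_action (R : realType) (kappa2 : R) (X : manifold4 R)
    (Gamma : chart X -> 'rV[R]_4 -> tensor3 R) (D : region X)
    (g : chart X -> 'rV[R]_4 -> 'M[R]_4) : R :=
  integral_on D (fun c x => lagrangian kappa2 (g c x) (nabla Gamma g c x)).

Definition stegr_action_H (R : realType) (kappa2 : R) (X : manifold4 R)
    (Gamma : chart X -> 'rV[R]_4 -> tensor3 R) (D : region X)
    (g : chart X -> 'rV[R]_4 -> 'M[R]_4)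
    (P : chart X -> 'rV[R]_4 -> tensor3 R) : R :=
  integral_on D (fun c x => contract3 (P c x) (nabla Gamma g c x)
                            - hamiltonian kappa2 (g c x) (P c x)).

Definition compactly_supported (R : realType) (X : manifold4 R) (D : region X)
    (h : chart X -> 'rV[R]_4 -> 'M[R]_4) : Prop :=
  exists2 K : set X, compact K /\ K `<=` region_set D &
    forall c x, cimg c x -> ~ K (chart_param c x) -> h c x = 0.

(* The integral over D of the divergence d_r (P^{rmn} h_{mn}), i.e. the flux
   through the boundary of D that integration by parts produces. *)
Definition surface_term (R : realType) (X : manifold4 R) (D : region X)
    (P : chart X -> 'rV[R]_4 -> tensor3 R)
    (h : chart X -> 'rV[R]_4 -> 'M[R]_4) : R :=
  integral_on D (fun c x =>
    \sum_r pd r (fun y => \sum_m \sum_n P c y r m n * h c y m n) x).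

(* Metric variations are compactly supported, or satisfy the boundary
   conditions [bc] (an arbitrary predicate) and have vanishing surface term. *)
Definition allowed_variation (R : realType) (X : manifold4 R)
    (bc : region X -> (chart X -> 'rV[R]_4 -> 'M[R]_4) -> Prop) (D : region X)
    (P : chart X -> 'rV[R]_4 -> tensor3 R)
    (h : chart X -> 'rV[R]_4 -> 'M[R]_4) : Prop :=
  sym2_field h /\
  (compactly_supported D h \/ bc D h /\ surface_term D P h = 0).

Definition stationary (R : realType) (kappa2 : R) (X : manifold4 R)
    (Gamma : chart X -> 'rV[R]_4 -> tensor3 R)
    (bc : region X -> (chart X -> 'rV[R]_4 -> 'M[R]_4) -> Prop) :
    set (chart X -> 'rV[R]_4 -> 'M[R]_4) :=
  [set g | lorentz_metric g /\
    forall D h, allowed_variation bc D (legendre_field kappa2 Gamma g) h ->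
      is_derive (0 : R) (1 : R)
        (fun t : R => stegr_action kappa2 Gamma D (fun c x => g c x + t *: h c x)) 0].

Definition stationary_H (R : realType) (kappa2 : R) (X : manifold4 R)
    (Gamma : chart X -> 'rV[R]_4 -> tensor3 R)
    (bc : region X -> (chart X -> 'rV[R]_4 -> 'M[R]_4) -> Prop) :
    set ((chart X -> 'rV[R]_4 -> 'M[R]_4) * (chart X -> 'rV[R]_4 -> tensor3 R)) :=
  [set gP | [/\ lorentz_metric gP.1, density3_field gP.2 &
    forall D h p, allowed_variation bc D gP.2 h -> density3_field p ->
      is_derive (0 : R) (1 : R)
        (fun t : R => stegr_action_H kappa2 Gamma D
           (fun c x => gP.1 c x + t *: h c x)
           (fun c x r m n => gP.2 c x r m n + t * p c x r m n)) 0]].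

(* Main.v *)
(* With L the Lagrangian and H the Hamiltonian, both quadratic in the fibre,
   completing the square gives
     P.Q - H(g, P) = L(g, Q) - H(g, P - Leg(g, Q)).
   The Legendre map is inverted by the gradient of H: in dimension 4 the two
   gradients, written with the cyclic symmetrisation T (T^2 = (1 + T)/2) and the
   two kinds of traces, are inverse to each other.  Along a path of variations
   through a point with P = Leg(g, Q), the last term is of order t^2, so the two
   actions have the same first variation.  Conversely, varying P alone by a bump
   density shows that at a stationary point of the first-order action Q is the
   gradient of H at P, i.e. P = Leg(g, Q).  The Legendre field is a density
   because nabla g is tensorial. *)

Require Import Defs.
From mathcomp Require Import all_boot all_order all_algebra.
From mathcomp Require Import all_classical all_reals all_analysis.
From mathcomp Require Import ring lra.
From mathcomp Require Import measurable_realfun.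

Set Implicit Arguments.
Unset Strict Implicit.
Unset Printing Implicit Defensive.

Import Order.TTheory GRing.Theory Num.Theory.
Import numFieldNormedType.Exports.

Local Open Scope classical_set_scope.
Local Open Scope ring_scope.

(** * Pointwise algebra of the Legendre map *)

Section TensorAlgebra.
Variable R : realType.
Implicit Types (A B Y Z : tensor3 R) (u v w : 'I_4 -> R) (g G J : 'M[R]_4).

(** Stationarity includes the existence of the derivative, so comparing the actions must transfer
    differentiability as well as the value. A gap bounded by a multiple of t^2 does both without
    differentiating under the integral: on each relatively compact piece the gap is a sum of
    products of two families, each bounded by a multiple of |t|. No integration by parts occurs: the
    surface term is built from the momentum, so at P = Leg(g, Q) the two problems admit the same
    metric variations. The coefficients 1/6, 2/3 and 1/3 of the Hamiltonian come from inverting the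
    gradient of the Lagrangian on the pair of traces, a 2 x 2 matrix whose entries depend on the
    dimension. Since the metric is indefinite, a nonzero tensor may have zero norm; the bump
    argument therefore tests with the Euclidean sum of squares of components in one chart. *)

Lemma tensor3P Y Z : (forall r m n, Y r m n = Z r m n) -> Y = Z.
Proof.
by move=> h; apply/funext => r; apply/funext => m; apply/funext => n.
Qed.

Lemma sum_delta (F : 'I_4 -> R) i : \sum_j F j * (i == j)%:R = F i.
Proof.
rewrite (bigD1 i) //= eqxx mulr1 big1 ?addr0// => j ji.
by rewrite eq_sym (negbTE ji) mulr0.
Qed.

Lemma sum3_distr (F H K : 'I_4 -> R) :
  \sum_r \sum_m \sum_n F r * H m * K n =
  (\sum_r F r) * (\sum_m H m) * (\sum_n K n).
Proof.
under eq_bigr do under eq_bigr do rewrite -mulr_sumr.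
under eq_bigr do rewrite -mulr_suml -mulr_sumr.
by rewrite -!mulr_suml.
Qed.

(** A single affine shape serves two purposes: [lin3 t p P] is a point of the path [P + t p], and
    nested down to [zero3] it spells out linear combinations that the linearity lemmas unfold
    mechanically. *)
Definition lin3 (k : R) Y Z : tensor3 R := fun r m n => k * Y r m n + Z r m n.
Definition zero3 : tensor3 R := fun _ _ _ => 0.

Lemma lin3_sym3 k Y Z : sym3 Y -> sym3 Z -> sym3 (lin3 k Y Z).
Proof. by move=> hY hZ r m n; rewrite /lin3 hY hZ. Qed.

Lemma move3_lin3 G k Y Z :
  move3 G (lin3 k Y Z) = lin3 k (move3 G Y) (move3 G Z).
Proof.
apply: tensor3P => a b e; rewrite /move3 /lin3 mulr_sumr -big_split /=.
apply: eq_bigr => r _; rewrite mulr_sumr -big_split /=.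
apply: eq_bigr => m _; rewrite mulr_sumr -big_split /=.
by apply: eq_bigr => n _; ring.
Qed.

Lemma contract3_linr A k Y Z :
  contract3 A (lin3 k Y Z) = k * contract3 A Y + contract3 A Z.
Proof.
rewrite /contract3 /lin3 mulr_sumr -big_split /=.
apply: eq_bigr => r _; rewrite mulr_sumr -big_split /=.
apply: eq_bigr => m _; rewrite mulr_sumr -big_split /=.
by apply: eq_bigr => n _; ring.
Qed.

Lemma contract3C A B : contract3 A B = contract3 B A.
Proof.
by apply: eq_bigr => r _; apply: eq_bigr => m _; apply: eq_bigr => n _; rewrite mulrC.
Qed.

Lemma contract3_linl A k Y Z :
  contract3 (lin3 k Y Z) A = k * contract3 Y A + contract3 Z A.
Proof. by rewrite !(contract3C _ A) contract3_linr. Qed.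

Lemma move3_zero3 G : move3 G zero3 = zero3.
Proof.
apply: tensor3P => a b e; rewrite /move3 big1// => r _; rewrite big1// => m _.
by rewrite big1// => n _; rewrite mulr0.
Qed.

Lemma contract3_zero3 A : contract3 A zero3 = 0.
Proof.
rewrite /contract3 big1// => r _; rewrite big1// => m _.
by rewrite big1// => n _; rewrite mulr0.
Qed.

(** A sum of squares of components is definite whatever the signature. The form [pair3] of a
    Lorentzian metric is not, which is why the momentum equation is tested with [contract3]. *)
Lemma contract3_self_eq0 A : contract3 A A = 0 -> A = zero3.
Proof.
move=> A0; have sq_ge0 r m n : 0 <= A r m n * A r m n by rewrite -expr2 sqr_ge0.
apply: tensor3P => r m n; apply/eqP; rewrite -sqrf_eq0 expr2; apply/eqP.
move: A0 => /psumr_eq0P /= A0.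
have /psumr_eq0P /= A1 := A0 (fun i _ =>
  sumr_ge0 _ (fun j _ => sumr_ge0 _ (fun k _ => sq_ge0 i j k))) r isT.
have /psumr_eq0P /= A2 := A1 (fun j _ => sumr_ge0 _ (fun k _ => sq_ge0 r j k)) m isT.
exact: A2 (fun k _ => sq_ge0 r m k) n isT.
Qed.

Lemma move3_comp G H Y : move3 G (move3 H Y) = move3 (G *m H) Y.
Proof.
apply: tensor3P => a b e; rewrite /move3.
(* The sums over the indices of [Y] are moved outside one at a time; the inner triple sum then
   factors into three entries of [G *m H]. *)
transitivity (\sum_p \sum_q \sum_s Y p q s *
   (\sum_r \sum_m \sum_n (G a r * H r p) * (G b m * H m q) * (G e n * H n s))).
  under eq_bigr do under eq_bigr do under eq_bigr do rewrite mulr_sumr.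
  under eq_bigr do under eq_bigr do rewrite exchange_big /=.
  under eq_bigr do rewrite exchange_big /=.
  rewrite exchange_big /=; apply: eq_bigr => p _.
  under eq_bigr do under eq_bigr do under eq_bigr do rewrite mulr_sumr.
  under eq_bigr do under eq_bigr do rewrite exchange_big /=.
  under eq_bigr do rewrite exchange_big /=.
  rewrite exchange_big /=; apply: eq_bigr => q _.
  under eq_bigr do under eq_bigr do under eq_bigr do rewrite mulr_sumr.
  under eq_bigr do under eq_bigr do rewrite exchange_big /=.
  under eq_bigr do rewrite exchange_big /=.
  rewrite exchange_big /=; apply: eq_bigr => s _.
  rewrite mulr_sumr; apply: eq_bigr => r _; rewrite mulr_sumr.
  apply: eq_bigr => m _; rewrite mulr_sumr; apply: eq_bigr => n _; ring.
apply: eq_bigr => p _; apply: eq_bigr => q _; apply: eq_bigr => s _.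
by rewrite sum3_distr !mxE mulrC.
Qed.

Lemma move3_1 Y : move3 1%:M Y = Y.
Proof.
apply: tensor3P => a b e; rewrite /move3.
transitivity (\sum_r (\sum_m (\sum_n Y r m n * (e == n)%:R) * (b == m)%:R) * (a == r)%:R).
  apply: eq_bigr => r _; rewrite mulr_suml; apply: eq_bigr => m _.
  by rewrite !mulr_suml; apply: eq_bigr => n _; rewrite !mxE; ring.
by rewrite !sum_delta.
Qed.

Lemma move3_sym3 G Y : sym3 Y -> sym3 (move3 G Y).
Proof.
move=> hY a b e; rewrite /move3; apply: eq_bigr => r _; rewrite exchange_big /=.
by apply: eq_bigr => m _; apply: eq_bigr => n _; rewrite hY; ring.
Qed.

Lemma cyc_move3 G Y : cyc (move3 G Y) = move3 G (cyc Y).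
Proof.
apply: tensor3P => a b e; rewrite /cyc /move3.
under eq_bigr do rewrite exchange_big /=.
rewrite exchange_big /=; apply: eq_bigr => n _; apply: eq_bigr => r _.
by apply: eq_bigr => m _; ring.
Qed.

Lemma contract3_move3 G A Y :
  contract3 A (move3 G Y) = contract3 (move3 G^T A) Y.
Proof.
rewrite /contract3 /move3.
under eq_bigr do under eq_bigr do under eq_bigr do rewrite mulr_sumr.
under eq_bigr do under eq_bigr do rewrite exchange_big /=.
under eq_bigr do rewrite exchange_big /=.
rewrite exchange_big /=; apply: eq_bigr => p _.
under eq_bigr do under eq_bigr do under eq_bigr do rewrite mulr_sumr.
under eq_bigr do under eq_bigr do rewrite exchange_big /=.
under eq_bigr do rewrite exchange_big /=.
rewrite exchange_big /=; apply: eq_bigr => q _.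
under eq_bigr do under eq_bigr do under eq_bigr do rewrite mulr_sumr.
under eq_bigr do under eq_bigr do rewrite exchange_big /=.
under eq_bigr do rewrite exchange_big /=.
rewrite exchange_big /=; apply: eq_bigr => s _.
rewrite mulr_suml; apply: eq_bigr => r _; rewrite mulr_suml.
apply: eq_bigr => m _; rewrite mulr_suml; apply: eq_bigr => n _.
by rewrite !mxE; ring.
Qed.

(** The operator T. Plain [cyc] leaves the space of tensors symmetric in the last two indices;
    averaging over both orders returns to it, and by [pair3_cyc_sym] pairings with symmetric tensors
    are unchanged. Its eigenvalues there are 1 and -1/2. *)
Definition cyc_sym Y : tensor3 R := fun r m n => 2^-1 * (Y m n r + Y n m r).

(** For [pair3] and [dot1], [metric_first g] is the adjoint of [trace3 g], and [metric_last g] that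
    of [trace3t g] on symmetric tensors. *)
Definition metric_first g u : tensor3 R := fun r m n => g m n * u r.

Definition metric_last g u : tensor3 R :=
  fun r m n => 2^-1 * (g r m * u n + g r n * u m).

Definition pair3 g A B := contract3 A (move3 (invmx g) B).

Lemma trace3_lin3 g k Y Z r :
  trace3 g (lin3 k Y Z) r = k * trace3 g Y r + trace3 g Z r.
Proof.
rewrite /trace3 /lin3 mulr_sumr -big_split; apply: eq_bigr => l _ /=.
by rewrite mulr_sumr -big_split; apply: eq_bigr => s _ /=; ring.
Qed.

Lemma trace3t_lin3 g k Y Z r :
  trace3t g (lin3 k Y Z) r = k * trace3t g Y r + trace3t g Z r.
Proof.
rewrite /trace3t /lin3 mulr_sumr -big_split; apply: eq_bigr => l _ /=.
by rewrite mulr_sumr -big_split; apply: eq_bigr => s _ /=; ring.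
Qed.

Lemma trace3_zero3 g r : trace3 g zero3 r = 0.
Proof. by rewrite /trace3 big1// => l _; rewrite big1// => s _; rewrite mulr0. Qed.

Lemma trace3t_zero3 g r : trace3t g zero3 r = 0.
Proof. by rewrite /trace3t big1// => l _; rewrite big1// => s _; rewrite mulr0. Qed.

(** * Traces, cyclic symmetrisation and gradients for a fixed metric *)

Section FixedMetric.
Variable g : 'M[R]_4.
Hypothesis g_sym : g^T = g.
Hypothesis g_unit : g \in unitmx.
Let G := invmx g.

Lemma metricC i j : g i j = g j i.
Proof. by rewrite -[in LHS]g_sym mxE. Qed.

Lemma invmx_metric_sym : G^T = G.
Proof. by rewrite /G trmx_inv g_sym. Qed.

Lemma invmx_metricC i j : G i j = G j i.
Proof. by rewrite -[in LHS]invmx_metric_sym mxE. Qed.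

Lemma sum_inv_metric i j : \sum_k G i k * g k j = (i == j)%:R.
Proof. by have := mulVmx g_unit => /matrixP/(_ i j); rewrite !mxE. Qed.

(** With [trace3t_cyc_sym], T acts on the pair of traces by (a, b) -> (b, (a + b)/2), which
    satisfies the same quadratic relation as T. *)
Lemma trace3_cyc_sym Y r : sym3 Y -> trace3 g (cyc_sym Y) r = trace3t g Y r.
Proof.
move=> hY; rewrite /trace3 /trace3t /cyc_sym.
under eq_bigr do under eq_bigr do rewrite mulrCA mulrDr mulrDr.
under eq_bigr do rewrite big_split /=.
rewrite big_split /= [X in _ + X]exchange_big /= -!big_split /=.
apply: eq_bigr => l _; rewrite -big_split /=; apply: eq_bigr => s _.
by rewrite -/G (invmx_metricC s l) (hY l s r); field.
Qed.

Lemma trace3t_cyc_sym Y r : sym3 Y ->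
  trace3t g (cyc_sym Y) r = 2^-1 * (trace3 g Y r + trace3t g Y r).
Proof.
move=> hY; rewrite /trace3 /trace3t /cyc_sym mulrDr !mulr_sumr.
under eq_bigr do under eq_bigr do rewrite mulrCA mulrDr mulrDr.
under eq_bigr do rewrite big_split /=.
rewrite big_split /= [X in _ + X = _]exchange_big /= -!big_split /=.
apply: eq_bigr => l _; rewrite !mulr_sumr -!big_split /=.
by apply: eq_bigr => s _; rewrite -/G (invmx_metricC s l) (hY r s l); ring.
Qed.

Lemma sum_inv_metricr i j : \sum_k g i k * G k j = (i == j)%:R.
Proof. by have := mulmxV g_unit => /matrixP/(_ i j); rewrite !mxE. Qed.

Lemma sum_delta4 : \sum_(i < 4) (i == i)%:R = 4 :> R.
Proof.
by rewrite (eq_bigr (fun=> 1)) ?sumr_const ?card_ord// => i _; rewrite eqxx.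
Qed.

(** The dimension enters the pointwise algebra through this trace of the identity; it fixes the
    factors 4 and 5/2 below, and with them the coefficients of [ham_op]. *)
Lemma sum_inv_metric_self : \sum_l \sum_s G l s * g l s = 4.
Proof.
rewrite -sum_delta4; apply: eq_bigr => l _; rewrite -sum_inv_metric.
by apply: eq_bigr => s _; rewrite (metricC l).
Qed.

Lemma sum_raise_lower (F : 'I_4 -> R) r : \sum_l \sum_s G l s * g r l * F s = F r.
Proof.
rewrite exchange_big /= -[RHS]sum_delta; apply: eq_bigr => s _.
by rewrite -sum_inv_metricr mulr_sumr; apply: eq_bigr => l _; ring.
Qed.

Lemma trace3_metric_first u r : trace3 g (metric_first g u) r = 4 * u r.
Proof.
rewrite -sum_inv_metric_self mulr_suml; apply: eq_bigr => l _.
by rewrite mulr_suml; apply: eq_bigr => s _; rewrite /metric_first mulrA.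
Qed.

Lemma trace3t_metric_first u r : trace3t g (metric_first g u) r = u r.
Proof.
rewrite /trace3t exchange_big /= -[RHS]sum_raise_lower.
apply: eq_bigr => l _; apply: eq_bigr => s _.
by rewrite /metric_first -/G (invmx_metricC s l) mulrA.
Qed.

Lemma trace3_metric_last u r : trace3 g (metric_last g u) r = u r.
Proof.
rewrite /trace3 /metric_last.
transitivity (2^-1 * (\sum_l \sum_s G l s * g r l * u s)
   + 2^-1 * (\sum_s \sum_l G s l * g r s * u l)).
  rewrite [X in _ = _ + _ * X]exchange_big /= !mulr_sumr -big_split /=.
  apply: eq_bigr => l _; rewrite !mulr_sumr -big_split /=.
  by apply: eq_bigr => s _; rewrite -/G (invmx_metricC s l); ring.
by rewrite !sum_raise_lower; field.
Qed.

(** The factor is (1 + 4)/2: one term of [metric_last] contracts to [u], the other to the dimension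
    times [u]. *)
Lemma trace3t_metric_last u r : trace3t g (metric_last g u) r = 5 / 2 * u r.
Proof.
rewrite /trace3t /metric_last.
transitivity (2^-1 * (\sum_l \sum_s G l s * g r l * u s)
   + 2^-1 * u r * (\sum_l \sum_s G l s * g l s)).
  rewrite !mulr_sumr -big_split /=.
  apply: eq_bigr => l _; rewrite !mulr_sumr -big_split /=.
  by apply: eq_bigr => s _; rewrite -/G (metricC l r); ring.
by rewrite sum_raise_lower sum_inv_metric_self; field.
Qed.

Lemma cyc_sym_metric_first u : cyc_sym (metric_first g u) = metric_last g u.
Proof.
apply: tensor3P => r m n; rewrite /cyc_sym /metric_first /metric_last.
by rewrite (metricC n r) (metricC m r); ring.
Qed.

Lemma cyc_sym_metric_last u r m n : cyc_sym (metric_last g u) r m n =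
  2^-1 * (metric_first g u r m n + metric_last g u r m n).
Proof.
rewrite /cyc_sym /metric_first /metric_last.
by rewrite (metricC n r) (metricC m r) (metricC n m); field.
Qed.

(** On symmetric tensors T = (c + c^2)/2 with c the cyclic permutation, and c^3 = 1 gives the
    quadratic relation. *)
Lemma cyc_sym_cyc_sym Y r m n : sym3 Y ->
  cyc_sym (cyc_sym Y) r m n = 2^-1 * (Y r m n + cyc_sym Y r m n).
Proof.
move=> hY; rewrite /cyc_sym (hY n r m) (hY m r n) (hY r n m).
by rewrite (hY n m r) (hY m n r); field.
Qed.

Lemma cyc_sym_lin3 k Y Z r m n :
  cyc_sym (lin3 k Y Z) r m n = k * cyc_sym Y r m n + cyc_sym Z r m n.
Proof. by rewrite /cyc_sym /lin3; ring. Qed.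

(* Gradients, with all indices down, of the nonmetricity scalar and of the
   bracket of the Hamiltonian; they are inverse to each other in dimension 4. *)
Definition nonmet_op Y : tensor3 R :=
  lin3 (- 2^-1) Y (lin3 1 (cyc_sym Y)
    (lin3 2^-1 (metric_first g (trace3 g Y))
    (lin3 (- 2^-1) (metric_first g (trace3t g Y))
    (lin3 (- 2^-1) (metric_last g (trace3 g Y)) zero3)))).

Definition ham_op Y : tensor3 R :=
  lin3 2 (cyc_sym Y)
    (lin3 3^-1 (metric_first g (trace3 g Y))
    (lin3 (- (2 / 3)) (metric_first g (trace3t g Y))
    (lin3 (- (2 / 3)) (metric_last g (trace3 g Y))
    (lin3 (- (2 / 3)) (metric_last g (trace3t g Y)) zero3)))).

Lemma cyc_sym_sym3 Y : sym3 Y -> sym3 (cyc_sym Y).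
Proof. by move=> hY r m n; rewrite /cyc_sym addrC. Qed.

Lemma metric_first_sym3 u : sym3 (metric_first g u).
Proof. by move=> r m n; rewrite /metric_first metricC. Qed.

Lemma metric_last_sym3 u : sym3 (metric_last g u).
Proof. by move=> r m n; rewrite /metric_last addrC. Qed.

Lemma zero3_sym3 : sym3 zero3.
Proof. by []. Qed.

Lemma nonmet_op_sym3 Y : sym3 Y -> sym3 (nonmet_op Y).
Proof.
move=> hY; apply: lin3_sym3 => //; apply: lin3_sym3; first exact: cyc_sym_sym3.
by do 3 ?[apply: lin3_sym3]; first
  [exact: metric_first_sym3 | exact: metric_last_sym3 | exact: zero3_sym3].
Qed.

Lemma ham_op_sym3 Y : sym3 Y -> sym3 (ham_op Y).
Proof.
move=> hY; apply: lin3_sym3; first exact: cyc_sym_sym3.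
by do 4 ?[apply: lin3_sym3]; first
  [exact: metric_first_sym3 | exact: metric_last_sym3 | exact: zero3_sym3].
Qed.

Lemma nonmet_opE Y r m n : nonmet_op Y r m n =
  - 2^-1 * Y r m n + cyc_sym Y r m n
  + 2^-1 * metric_first g (trace3 g Y) r m n
  - 2^-1 * metric_first g (trace3t g Y) r m n
  - 2^-1 * metric_last g (trace3 g Y) r m n.
Proof. by rewrite /nonmet_op /lin3 /zero3; ring. Qed.

Lemma ham_opE Y r m n : ham_op Y r m n =
  2 * cyc_sym Y r m n + 3^-1 * metric_first g (trace3 g Y) r m n
  - 2 / 3 * metric_first g (trace3t g Y) r m n
  - 2 / 3 * metric_last g (trace3 g Y) r m n
  - 2 / 3 * metric_last g (trace3t g Y) r m n.
Proof. by rewrite /ham_op /lin3 /zero3; field. Qed.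

Lemma cyc_sym_nonmet_op Y r m n : sym3 Y -> cyc_sym (nonmet_op Y) r m n =
  2^-1 * Y r m n - 4^-1 * metric_first g (trace3 g Y) r m n
  + 4^-1 * metric_last g (trace3 g Y) r m n
  - 2^-1 * metric_last g (trace3t g Y) r m n.
Proof.
move=> hY; rewrite /nonmet_op !cyc_sym_lin3 cyc_sym_cyc_sym//.
by rewrite !cyc_sym_metric_first cyc_sym_metric_last /cyc_sym /zero3; field.
Qed.

Lemma cyc_sym_ham_op Y r m n : sym3 Y -> cyc_sym (ham_op Y) r m n =
  Y r m n + cyc_sym Y r m n
  - 3^-1 * metric_first g (trace3 g Y) r m n
  - 3^-1 * metric_first g (trace3t g Y) r m n
  - metric_last g (trace3t g Y) r m n.
Proof.
move=> hY; rewrite /ham_op !cyc_sym_lin3 cyc_sym_cyc_sym//.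
by rewrite !cyc_sym_metric_first !cyc_sym_metric_last /cyc_sym /zero3; field.
Qed.

(** On tensors with both traces zero the two operators are 2T and T - 1/2, whose product 2T^2 - T is
    1. The remaining terms involve only the traces, on which the operators act by mutually inverse 2
    x 2 matrices. *)
Lemma ham_opK Y : sym3 Y -> ham_op (nonmet_op Y) = Y.
Proof.
move=> hY.
(* The coefficients are -1/2 + 4/2 - 1/2 = 1 and 1 - 4/2 = -1. *)
have tr r : trace3 g (nonmet_op Y) r = trace3 g Y r - trace3t g Y r.
  rewrite /nonmet_op !trace3_lin3 trace3_zero3 trace3_cyc_sym//.
  by rewrite !trace3_metric_first trace3_metric_last; field.
have trt r : trace3t g (nonmet_op Y) r =
    - 4^-1 * trace3 g Y r - 2^-1 * trace3t g Y r.
  rewrite /nonmet_op !trace3t_lin3 trace3t_zero3 trace3t_cyc_sym//.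
  by rewrite !trace3t_metric_first trace3t_metric_last; field.
apply: tensor3P => r m n; rewrite ham_opE cyc_sym_nonmet_op//.
rewrite /metric_first /metric_last !tr !trt.
by field.
Qed.

Lemma nonmet_opK Y : sym3 Y -> nonmet_op (ham_op Y) = Y.
Proof.
move=> hY.
have tr r : trace3 g (ham_op Y) r =
    2 / 3 * trace3 g Y r - 4 / 3 * trace3t g Y r.
  rewrite /ham_op !trace3_lin3 trace3_zero3 trace3_cyc_sym//.
  by rewrite !trace3_metric_first !trace3_metric_last; field.
have trt r : trace3t g (ham_op Y) r =
    - 3^-1 * trace3 g Y r - 4 / 3 * trace3t g Y r.
  rewrite /ham_op !trace3t_lin3 trace3t_zero3 trace3t_cyc_sym//.
  by rewrite !trace3t_metric_first !trace3t_metric_last; field.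
apply: tensor3P => r m n; rewrite nonmet_opE cyc_sym_ham_op// ham_opE.
rewrite /metric_first /metric_last !tr !trt.
by field.
Qed.

Lemma move3_metricK : cancel (move3 g) (move3 (invmx g)).
Proof. by move=> Y; rewrite move3_comp mulVmx// move3_1. Qed.

Lemma move3_invmxK : cancel (move3 (invmx g)) (move3 g).
Proof. by move=> Y; rewrite move3_comp mulmxV// move3_1. Qed.

Lemma pair3C A B : pair3 g A B = pair3 g B A.
Proof. by rewrite /pair3 contract3_move3 invmx_metric_sym contract3C. Qed.

Lemma pair3_linr A k Y Z :
  pair3 g A (lin3 k Y Z) = k * pair3 g A Y + pair3 g A Z.
Proof. by rewrite /pair3 move3_lin3 contract3_linr. Qed.

Lemma pair3_linl A k Y Z :
  pair3 g (lin3 k Y Z) A = k * pair3 g Y A + pair3 g Z A.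
Proof. by rewrite !(pair3C _ A) pair3_linr. Qed.

Lemma pair3_zero3 A : pair3 g A zero3 = 0.
Proof. by rewrite /pair3 move3_zero3 contract3_zero3. Qed.

Lemma contract3_cyc A B : sym3 A -> sym3 B ->
  contract3 A (cyc B) = contract3 (cyc A) B.
Proof.
move=> hA hB; rewrite /contract3 /cyc [LHS]exchange_big /=.
apply: eq_bigr => m _; apply: eq_bigr => r _; apply: eq_bigr => n _.
by rewrite hA hB.
Qed.

Lemma pair3_cyc_sym A B : sym3 A -> sym3 B ->
  pair3 g A (cyc_sym B) = pair3 g A (cyc B).
Proof.
move=> hA hB; rewrite /pair3 !(contract3_move3 _ A); set A' := move3 _ A.
have hA' : sym3 A' by exact: move3_sym3.
rewrite /contract3 /cyc_sym /cyc; apply: eq_bigr => r _.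
transitivity (2^-1 * (\sum_m \sum_n A' r m n * B m n r)
   + 2^-1 * (\sum_n \sum_m A' r n m * B n m r)).
  rewrite [X in _ = _ + _ * X]exchange_big /= !mulr_sumr -big_split /=.
  apply: eq_bigr => m _; rewrite !mulr_sumr -big_split /=.
  by apply: eq_bigr => n _; rewrite (hA' r n m); ring.
by field.
Qed.

(** T is self-adjoint: the adjoint of c is c^2, and T averages the two. *)
Lemma pair3_cyc_symC A B : sym3 A -> sym3 B ->
  pair3 g A (cyc_sym B) = pair3 g (cyc_sym A) B.
Proof.
move=> hA hB; rewrite pair3_cyc_sym// [RHS]pair3C pair3_cyc_sym//.
rewrite [RHS]pair3C /pair3 -cyc_move3 contract3_cyc//.
exact: move3_sym3.
Qed.

Lemma dot1C u v : dot1 g u v = dot1 g v u.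
Proof.
rewrite /dot1 exchange_big /=; apply: eq_bigr => r _; apply: eq_bigr => s _.
by rewrite -/G invmx_metricC; ring.
Qed.

Lemma pair3_metric_first A u : pair3 g A (metric_first g u) = dot1 g (trace3 g A) u.
Proof.
have raised a b e : move3 G (metric_first g u) a b e = G b e * \sum_r G a r * u r.
  rewrite /move3 mulr_sumr; apply: eq_bigr => r _.
  transitivity (\sum_m \sum_n (G a r * u r) * (G b m * (G e n * g n m))).
    apply: eq_bigr => m _; apply: eq_bigr => n _.
    by rewrite /metric_first (metricC m n); ring.
  under eq_bigr do rewrite -mulr_sumr -mulr_sumr sum_inv_metric.
  by rewrite -mulr_sumr sum_delta; ring.
rewrite /pair3 /contract3 /dot1 /trace3; apply: eq_bigr => a _.
under eq_bigr do under eq_bigr do rewrite raised mulrA mulr_sumr.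
transitivity (\sum_b \sum_e \sum_s (G a s * u s) * (G b e * A a b e)).
  apply: eq_bigr => b _; apply: eq_bigr => e _; apply: eq_bigr => s _; ring.
under eq_bigr do rewrite exchange_big /=.
rewrite exchange_big /=; apply: eq_bigr => s _.
under eq_bigr do rewrite -mulr_sumr.
by rewrite -mulr_sumr -/G; ring.
Qed.

(** Transported from [metric_first] by self-adjointness of T, since T maps [metric_first] to
    [metric_last] and exchanges one trace for the other. *)
Lemma pair3_metric_last A u : sym3 A ->
  pair3 g A (metric_last g u) = dot1 g (trace3t g A) u.
Proof.
move=> hA; rewrite -cyc_sym_metric_first pair3_cyc_symC//; last first.
  exact: metric_first_sym3.
rewrite pair3_metric_first; congr dot1.
by apply/funext => r; rewrite trace3_cyc_sym.
Qed.

Lemma pair3_nonmet_op A B : sym3 A -> sym3 B ->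
  pair3 g A (nonmet_op B) = pair3 g (nonmet_op A) B.
Proof.
move=> hA hB; rewrite [RHS]pair3C /nonmet_op !pair3_linr !pair3_zero3.
rewrite pair3_cyc_symC// (pair3C B A) (pair3C B (cyc_sym A)).
rewrite !pair3_metric_first !pair3_metric_last//.
by rewrite (dot1C (trace3 g B)) (dot1C (trace3 g B)) (dot1C (trace3t g B)); ring.
Qed.

(** The inverse of a self-adjoint operator is self-adjoint, so this side needs no index computation
    of its own. *)
Lemma pair3_ham_op A B : sym3 A -> sym3 B ->
  pair3 g A (ham_op B) = pair3 g (ham_op A) B.
Proof.
move=> hA hB; rewrite -{1}(nonmet_opK hA) -pair3_nonmet_op ?nonmet_opK//.
  exact: ham_op_sym3.
exact: ham_op_sym3.
Qed.

(** Euler's identity for a quadratic form: half the pairing with its gradient. *)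
Lemma nonmetricity_scalarE Y : sym3 Y ->
  nonmetricity_scalar g Y = 2^-1 * pair3 g Y (nonmet_op Y).
Proof.
move=> hY; rewrite /nonmet_op !pair3_linr !pair3_zero3 pair3_cyc_sym//.
rewrite !pair3_metric_first !pair3_metric_last// (dot1C (trace3t g Y)).
by rewrite /nonmetricity_scalar cyc_move3 /pair3; field.
Qed.

Lemma contract3_lower A B : contract3 A B = pair3 g (move3 g A) B.
Proof. by rewrite pair3C /pair3 move3_metricK contract3C. Qed.

Lemma hamiltonianE kappa2 Y : sym3 Y ->
  hamiltonian kappa2 g Y =
  - (kappa2 / (2 * sqrtmdet g)) *
    (2^-1 * pair3 g (move3 g Y) (ham_op (move3 g Y))).
Proof.
move=> hY; have hY' : sym3 (move3 g Y) by exact: move3_sym3.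
rewrite /ham_op !pair3_linr !pair3_zero3 pair3_cyc_sym//.
rewrite !pair3_metric_first !pair3_metric_last// (dot1C (trace3t g _) (trace3 _ _)).
rewrite /hamiltonian contract3_lower; congr (_ * _).
by field.
Qed.

Lemma sym_unit_sym3 r m n : sym3 (sym_unit R r m n).
Proof. by move=> a b e; rewrite /sym_unit addrC (andbC (e == m)) (andbC (e == n)). Qed.

Lemma contract3_sym_unit Y r m n : sym3 Y -> contract3 Y (sym_unit R r m n) = Y r m n.
Proof.
move=> hY.
have E i j k : \sum_a \sum_b \sum_e Y a b e * [&& a == i, b == j & e == k]%:R = Y i j k.
  transitivity (\sum_a (\sum_b (\sum_e Y a b e * (k == e)%:R) * (j == b)%:R) * (i == a)%:R).
    apply: eq_bigr => a _; rewrite mulr_suml; apply: eq_bigr => b _.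
    rewrite !mulr_suml; apply: eq_bigr => e _.
    rewrite (eq_sym k) (eq_sym j) (eq_sym i).
    by case: (a == i); case: (b == j); case: (e == k); rewrite /= ?mulr1 ?mulr0 ?mul0r.
  by rewrite !sum_delta.
transitivity (2^-1 * (Y r m n + Y r n m)); last by rewrite (hY r n m); field.
rewrite -!E mulrDr !mulr_sumr -big_split; apply: eq_bigr => a _ /=.
rewrite !mulr_sumr -big_split; apply: eq_bigr => b _ /=.
rewrite !mulr_sumr -big_split; apply: eq_bigr => e _ /=.
by rewrite /sym_unit; ring.
Qed.

Lemma legendreE kappa2 Y : sym3 Y -> legendre kappa2 g Y =
  (fun r m n => - (2 / kappa2) * sqrtmdet g * move3 (invmx g) (nonmet_op Y) r m n).
Proof.
move=> hY; apply: tensor3P => r m n; rewrite /legendre.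
set U := sym_unit R r m n; set c := _ * sqrtmdet g.
have hU : sym3 U by exact: sym_unit_sym3.
(* The Lagrangian is a quadratic polynomial in [t], so its derivative at 0 is the linear
   coefficient; contraction with the symmetrised unit tensor then reads off one component. *)
have -> : (fun t => lagrangian kappa2 g (fun a b e => Y a b e + t * U a b e)) =
    (fun t => lagrangian kappa2 g Y
      + (c * pair3 g U (nonmet_op Y)) * t + lagrangian kappa2 g U * t ^+ 2).
  apply/funext => t.
  have -> : (fun a b e => Y a b e + t * U a b e) = lin3 t U Y.
    by apply: tensor3P => a b e; rewrite /lin3 addrC.
  rewrite /lagrangian -/c !nonmetricity_scalarE//; last exact: lin3_sym3.
  have -> : nonmet_op (lin3 t U Y) = lin3 t (nonmet_op U) (nonmet_op Y).
    apply: tensor3P => a b e; rewrite [RHS]/lin3 !nonmet_opE.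
    rewrite cyc_sym_lin3 /metric_first /metric_last !trace3_lin3 !trace3t_lin3.
    by rewrite /lin3; ring.
  have := pair3_nonmet_op hY hU.
  move: (nonmet_op U) (nonmet_op Y) => NU NY YU.
  by rewrite !pair3_linl !pair3_linr YU (pair3C _ U); field.
rewrite derive1E; set l := lagrangian _ _ Y; set k := c * _; set q := lagrangian _ _ U.
have D : is_derive (0 : R) 1 (fun t : R => l + k * t + q * t ^+ 2) k.
  by apply: is_derive_eq; rewrite /GRing.scale /= ?expr0n /=; ring.
rewrite (@derive_val _ _ _ _ _ _ _ D) /k /pair3 contract3C contract3_sym_unit//.
exact/move3_sym3/nonmet_op_sym3.
Qed.

Hypothesis g_vol : 0 < sqrtmdet g.

Section Coupling.
Variable kappa2 : R.
Hypothesis kappa2_gt0 : 0 < kappa2.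

Lemma legendre_lin3 Y : sym3 Y -> legendre kappa2 g Y =
  lin3 (- (2 / kappa2) * sqrtmdet g) (move3 (invmx g) (nonmet_op Y)) zero3.
Proof.
by move=> hY; rewrite legendreE//; apply: tensor3P => r m n; rewrite /lin3 addr0.
Qed.

Lemma legendre_sym3 Y : sym3 Y -> sym3 (legendre kappa2 g Y).
Proof.
move=> hY; rewrite legendre_lin3//; apply: lin3_sym3 => //.
exact/move3_sym3/nonmet_op_sym3.
Qed.

(* Completing the square in the fibre. *)
Lemma hamiltonian_shift P Y : sym3 P -> sym3 Y ->
  contract3 P Y - hamiltonian kappa2 g P =
  lagrangian kappa2 g Y
  - hamiltonian kappa2 g (lin3 (-1) (legendre kappa2 g Y) P).
Proof.
move=> hP hY; have hL := legendre_sym3 hY.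
rewrite !hamiltonianE//; last exact: lin3_sym3.
rewrite move3_lin3 legendre_lin3// move3_lin3 move3_zero3 move3_invmxK.
rewrite contract3_lower /lagrangian nonmetricity_scalarE//.
set s := sqrtmdet g; set p := move3 g P; set e := - (2 / kappa2) * s.
have hp : sym3 p by exact: move3_sym3.
have hN := nonmet_op_sym3 hY.
have -> : lin3 (-1) (lin3 e (nonmet_op Y) zero3) p = lin3 (- e) (nonmet_op Y) p.
  by apply: tensor3P => r m n; rewrite /lin3 /zero3; ring.
(* By linearity and [ham_opK], the shift by the Legendre momentum becomes a multiple of [Y] itself,
   which produces the cross term with [P]. *)
have -> : ham_op (lin3 (- e) (nonmet_op Y) p) = lin3 (- e) Y (ham_op p).
  rewrite -{2}(ham_opK hY); apply: tensor3P => r m n; rewrite [RHS]/lin3 !ham_opE.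
  rewrite cyc_sym_lin3 /metric_first /metric_last !trace3_lin3 !trace3t_lin3.
  by rewrite /lin3; ring.
have := pair3_ham_op hN hp; rewrite ham_opK//.
rewrite (pair3C Y p) (pair3C Y (nonmet_op Y)).
move: (nonmet_op Y) (ham_op p) => N Mp NMp.
rewrite !pair3_linl !pair3_linr NMp.
rewrite /e; field; rewrite gt_eqF//= gt_eqF//.
Qed.

Lemma legendre_inj : {in @sym3 R &, injective (legendre kappa2 g)}.
Proof.
move=> Y Z; rewrite !inE => hY hZ.
rewrite !legendreE// => /(congr1 (fun W : tensor3 R => fun r m n =>
  (- (2 / kappa2) * sqrtmdet g)^-1 * W r m n)) E.
have c0 : - (2 / kappa2) * sqrtmdet g != 0.
  by rewrite mulf_neq0 ?oppr_eq0 ?mulf_neq0 ?invr_eq0 ?pnatr_eq0 ?gt_eqF.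
rewrite -(ham_opK hY) -(ham_opK hZ); congr ham_op; apply: (can_inj move3_invmxK).
apply: tensor3P => r m n.
by have := congr1 (fun W : tensor3 R => W r m n) E; rewrite /= !mulKf.
Qed.

(** The velocity attached to a momentum: by [hamiltonian_lin3] it is the fibre derivative of the
    Hamiltonian at [P]. Its prefactor is the inverse of the one in [legendreE]. *)
Definition ham_grad P : tensor3 R :=
  lin3 (- (kappa2 / (2 * sqrtmdet g))) (ham_op (move3 g P)) zero3.

Lemma ham_grad_sym3 P : sym3 P -> sym3 (ham_grad P).
Proof. by move=> hP; apply: lin3_sym3 => //; exact/ham_op_sym3/move3_sym3. Qed.

Lemma legendre_ham_grad P : sym3 P -> legendre kappa2 g (ham_grad P) = P.
Proof.
move=> hP; have hp : sym3 (move3 g P) by exact: move3_sym3.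
have hG := ham_grad_sym3 hP; rewrite legendreE//.
set d := - (kappa2 / (2 * sqrtmdet g)).
have -> : nonmet_op (ham_grad P) = lin3 d (move3 g P) zero3.
  rewrite -[in RHS](nonmet_opK hp) /ham_grad -/d.
  apply: tensor3P => r m n; rewrite [RHS]/lin3 !nonmet_opE.
  rewrite cyc_sym_lin3 /metric_first /metric_last !trace3_lin3 !trace3t_lin3.
  by rewrite !trace3_zero3 !trace3t_zero3 /lin3 /cyc_sym /zero3; ring.
rewrite move3_lin3 move3_metricK move3_zero3; apply: tensor3P => r m n.
by rewrite /lin3 /zero3 /d; field; rewrite gt_eqF//= gt_eqF.
Qed.

Lemma legendre_set_bij : set_bij (@sym3 R) (@sym3 R) (legendre kappa2 g).
Proof.
split; [exact: legendre_sym3|exact: legendre_inj|].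
by move=> P hP; exists (ham_grad P); [exact: ham_grad_sym3|exact: legendre_ham_grad].
Qed.

(** At the Legendre momentum the completed square vanishes, so [hamiltonian_shift] reduces to the
    Legendre transform. *)
Lemma hamiltonian_legendre Y : sym3 Y ->
  hamiltonian kappa2 g (legendre kappa2 g Y) =
  contract3 (legendre kappa2 g Y) Y - lagrangian kappa2 g Y.
Proof.
move=> hY; have hL := legendre_sym3 hY.
have := hamiltonian_shift hL hY.
have -> : lin3 (-1) (legendre kappa2 g Y) (legendre kappa2 g Y) = zero3.
  by apply: tensor3P => r m n; rewrite /lin3 /zero3; ring.
rewrite [hamiltonian kappa2 g zero3]hamiltonianE// move3_zero3 pair3C pair3_zero3.
by lra.
Qed.

Lemma hamiltonian_lin3 t P Z : sym3 P -> sym3 Z ->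
  hamiltonian kappa2 g (lin3 t Z P) =
  hamiltonian kappa2 g P + t * contract3 Z (ham_grad P)
  + t ^+ 2 * hamiltonian kappa2 g Z.
Proof.
move=> hP hZ; rewrite !hamiltonianE//; last exact: lin3_sym3.
rewrite move3_lin3 contract3_lower /ham_grad pair3_linr pair3_zero3.
have hp : sym3 (move3 g P) by exact: move3_sym3.
have hz : sym3 (move3 g Z) by exact: move3_sym3.
move: (move3 g P) (move3 g Z) hp hz => p z hp hz.
have -> : ham_op (lin3 t z p) = lin3 t (ham_op z) (ham_op p).
  apply: tensor3P => r m n; rewrite [RHS]/lin3 !ham_opE.
  rewrite cyc_sym_lin3 /metric_first /metric_last !trace3_lin3 !trace3t_lin3.
  by rewrite /lin3; ring.
have := pair3_ham_op hp hz; rewrite (pair3C (ham_op p)).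
move: (ham_op z) (ham_op p) => Mz Mp pMz.
by rewrite !pair3_linl !pair3_linr pMz; field; rewrite gt_eqF.
Qed.

Lemma hamiltonian_ham_grad P : sym3 P ->
  hamiltonian kappa2 g P = 2^-1 * contract3 P (ham_grad P).
Proof.
move=> hP; rewrite hamiltonianE// contract3_lower /ham_grad pair3_linr pair3_zero3.
by rewrite addr0 mulrCA.
Qed.

End Coupling.
End FixedMetric.

Lemma lorentzian_unitmx g : lorentzian g -> g \in unitmx.
Proof.
case=> A Au E; rewrite unitmxE unitfE.
have : \det (A^T *m g *m A) != 0.
  by rewrite E det_diag !big_ord_recl big_ord0 !mxE /=; rewrite !mulr1 oppr_eq0 oner_eq0.
by rewrite !det_mulmx !mulf_eq0 !negb_or => /andP[/andP[_ ]].
Qed.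

Lemma lorentzian_sqrtmdet g : lorentzian g -> 0 < sqrtmdet g.
Proof.
case=> A Au E; rewrite sqrtr_gt0.
have : \det (A^T *m g *m A) = -1.
  by rewrite E det_diag !big_ord_recl big_ord0 !mxE /= !mulr1.
rewrite !det_mulmx det_tr => E1.
rewrite oppr_gt0 ltNge; apply/negP => g0.
have : 0 <= \det A * \det g * \det A by rewrite mulrAC mulr_ge0// -expr2 sqr_ge0.
by rewrite E1 oppr_ge0 ler10.
Qed.

End TensorAlgebra.

(** * Change of frame *)

Section Covariance.
Variable R : realType.
Variables g g' J : 'M[R]_4.
Hypothesis g'_sym : g'^T = g'.
Hypothesis g'_unit : g' \in unitmx.
Hypothesis J_unit : J \in unitmx.
Hypothesis gE : g = J^T *m g' *m J.

Lemma congr_sym : g^T = g.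
Proof. by rewrite gE !trmx_mul trmxK g'_sym mulmxA. Qed.

Lemma congr_unitmx : g \in unitmx.
Proof. by rewrite gE !unitmx_mul unitmx_tr J_unit g'_unit. Qed.

Lemma congr_invmx : J *m invmx g *m J^T = invmx g'.
Proof.
suff E : J *m invmx g *m J^T *m g' = 1%:M.
  by rewrite -[LHS](mulmxK g'_unit) E mul1mx.
apply: (can_inj (mulmxK J_unit)); rewrite mul1mx -!mulmxA.
by rewrite (mulmxA J^T) -gE mulVmx ?mulmx1// congr_unitmx.
Qed.

Lemma congr_sqrtmdet : sqrtmdet g = `|\det J| * sqrtmdet g'.
Proof.
rewrite /sqrtmdet gE !det_mulmx det_tr.
have -> : - (\det J * \det g' * \det J) = \det J ^+ 2 * - \det g' by ring.
by rewrite sqrtrM ?sqr_ge0// sqrtr_sqr.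
Qed.

(** The metric embeddings and the tensors representing the traces are outer products of a vector and
    a matrix; their change of frame thus reduces to matrix congruence. *)
Lemma move3_outer (H : 'M[R]_4) (u : 'I_4 -> R) (K : 'M[R]_4) a b e :
  move3 H (fun r m n => u r * K m n) a b e =
  (\sum_r H a r * u r) * (H *m K *m H^T) b e.
Proof.
rewrite /move3 mulr_suml; apply: eq_bigr => r _.
rewrite mxE mulr_sumr exchange_big /=; apply: eq_bigr => n _.
rewrite !mxE mulr_suml mulr_sumr; apply: eq_bigr => m _; ring.
Qed.

Lemma trace3_congr Y r :
  trace3 g (move3 J^T Y) r = \sum_a J a r * trace3 g' Y a.
Proof.
(* A trace is the contraction with a unit vector times the inverse metric, so the change of frame
   can be moved onto that factor. *)
have E (K : 'M[R]_4) Z s : trace3 K Z s =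
    contract3 (fun a b e => (s == a)%:R * invmx K b e) Z.
  rewrite /contract3 (bigD1 s) //= [X in _ + X]big1 ?addr0.
    by apply: eq_bigr => b _; apply: eq_bigr => e _; rewrite eqxx mul1r.
  move=> a /negbTE as_; rewrite big1// => b _; rewrite big1// => e _.
  by rewrite eq_sym as_ !mul0r.
rewrite E contract3_move3 trmxK /contract3; apply: eq_bigr => a _.
rewrite /trace3 mulr_sumr; apply: eq_bigr => b _.
rewrite mulr_sumr; apply: eq_bigr => e _.
by rewrite move3_outer sum_delta congr_invmx mulrA.
Qed.

Lemma cyc_sym_move3 (H : 'M[R]_4) Y : sym3 Y ->
  cyc_sym (move3 H Y) = move3 H (cyc_sym Y).
Proof.
have E Z : sym3 Z -> cyc_sym Z = lin3 2^-1 (cyc Z) (lin3 2^-1 (cyc (cyc Z)) (zero3 R)).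
  move=> hZ; apply: tensor3P => r m n; rewrite /cyc_sym /lin3 /cyc /zero3.
  by rewrite (hZ n m r); ring.
move=> hY; rewrite !E//; last exact: move3_sym3.
by rewrite !cyc_move3 !move3_lin3 move3_zero3.
Qed.

Lemma trace3t_congr Y r : sym3 Y ->
  trace3t g (move3 J^T Y) r = \sum_a J a r * trace3t g' Y a.
Proof.
move=> hY; rewrite -trace3_cyc_sym; [|exact: congr_sym|exact: move3_sym3].
rewrite cyc_sym_move3// trace3_congr; apply: eq_bigr => a _.
by rewrite trace3_cyc_sym.
Qed.

Lemma metric_first_congr u : metric_first g (fun r => \sum_a J a r * u a) =
  move3 J^T (metric_first g' u).
Proof.
apply: tensor3P => r m n; rewrite /metric_first.
have -> : (fun r m n => g' m n * u r) = (fun r m n => u r * g' m n) :> tensor3 R.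
  by apply: tensor3P => a b e; rewrite mulrC.
rewrite move3_outer trmxK -gE mulrC; congr (_ * _).
by apply: eq_bigr => a _; rewrite mxE.
Qed.

Lemma nonmet_op_congr Y : sym3 Y ->
  nonmet_op g (move3 J^T Y) = move3 J^T (nonmet_op g' Y).
Proof.
move=> hY; rewrite /nonmet_op cyc_sym_move3// !move3_lin3 move3_zero3.
have -> : trace3 g (move3 J^T Y) = fun r => \sum_a J a r * trace3 g' Y a.
  by apply/funext => r; exact: trace3_congr.
have -> : trace3t g (move3 J^T Y) = fun r => \sum_a J a r * trace3t g' Y a.
  by apply/funext => r; exact: trace3t_congr.
(* Writing [metric_last] as T of [metric_first] leaves a single embedding to transform. *)
rewrite -(cyc_sym_metric_first congr_sym) -(cyc_sym_metric_first g'_sym).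
by rewrite !metric_first_congr cyc_sym_move3//; exact: metric_first_sym3.
Qed.

(** The weight comes from [sqrtmdet], which gains the absolute Jacobian determinant; the index
    structure comes from [congr_invmx]. *)
Lemma legendre_congr kappa2 Y a b e : sym3 Y ->
  legendre kappa2 g' Y a b e =
  `|\det J|^-1 * move3 J (legendre kappa2 g (move3 J^T Y)) a b e.
Proof.
move=> hY.
rewrite (legendreE g'_sym)// legendreE; [|exact: congr_sym|exact: congr_unitmx|exact: move3_sym3].
rewrite nonmet_op_congr//; set N := nonmet_op g' Y; set c := - (2 / kappa2).
have -> : (fun r m n => c * sqrtmdet g * move3 (invmx g) (move3 J^T N) r m n) =
    lin3 (c * sqrtmdet g) (move3 (invmx g) (move3 J^T N)) (zero3 R).
  by apply: tensor3P => r m n; rewrite /lin3 addr0.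
rewrite move3_lin3 move3_zero3 !move3_comp congr_invmx congr_sqrtmdet.
rewrite /lin3 addr0; have J0 : `|\det J| != 0 by rewrite normr_eq0 -unitfE -unitmxE.
by rewrite !mulrA (mulrC _ c) -!mulrA mulKf.
Qed.

End Covariance.

(** * Classes of functions closed under sums and products *)

Lemma closed_sum (R : realType) (T : Type) (S : (T -> R) -> Prop) :
  S (fun=> 0) -> (forall f h, S f -> S h -> S (fun t => f t + h t)) ->
  forall (I : Type) (l : seq I) (P : pred I) (F : I -> T -> R),
  (forall i, S (F i)) -> S (fun t => \sum_(i <- l | P i) F i t).
Proof.
move=> S0 S_add I l P F SF.
elim: l => [|i l IH]; first by under eq_fun do rewrite big_nil.
under eq_fun do rewrite big_cons; case: (P i) => //.
exact: S_add.
Qed.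

Section FunctionAlgebra.
Variables (R : realType) (T : Type) (S : (T -> R) -> Prop).
Hypothesis S_cst : forall a, S (fun=> a).
Hypothesis S_add : forall f h, S f -> S h -> S (fun t => f t + h t).
Hypothesis S_mul : forall f h, S f -> S h -> S (fun t => f t * h t).

Let sum_closed := closed_sum (S_cst 0) S_add.

Lemma closed_prod (I : Type) (l : seq I) (P : pred I) (F : I -> T -> R) :
  (forall i, S (F i)) -> S (fun t => \prod_(i <- l | P i) F i t).
Proof.
move=> SF; elim: l => [|i l IH]; first by under eq_fun do rewrite big_nil.
under eq_fun do rewrite big_cons; case: (P i) => //.
exact: S_mul.
Qed.

Lemma closed_det n (A : T -> 'M[R]_n) :
  (forall i j, S (fun t => A t i j)) -> S (fun t => \det (A t)).
Proof.
move=> SA; apply: sum_closed => s; apply: S_mul => //.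
by apply: closed_prod => i; exact: SA.
Qed.

(** Cofactors are polynomial in the entries, but the inverse matrix also needs division by the
    determinant, which each class justifies in its own way; hence the separate hypothesis on [invmx]
    below. *)
Lemma closed_adj n (A : T -> 'M[R]_n) i j :
  (forall i j, S (fun t => A t i j)) -> S (fun t => (\adj (A t)) i j).
Proof.
move=> SA; under eq_fun do rewrite mxE /cofactor.
apply: S_mul => //; apply: closed_det => a b.
by under eq_fun do rewrite !mxE; exact: SA.
Qed.

Lemma closed_move3 (G : T -> 'M[R]_4) (Y : T -> tensor3 R) a b e :
  (forall i j, S (fun t => G t i j)) -> (forall r m n, S (fun t => Y t r m n)) ->
  S (fun t => move3 (G t) (Y t) a b e).
Proof. by move=> SG SY; do 3![apply: sum_closed => ?]; do 3![apply: S_mul => //]. Qed.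

Lemma closed_contract3 (Y Z : T -> tensor3 R) :
  (forall r m n, S (fun t => Y t r m n)) -> (forall r m n, S (fun t => Z t r m n)) ->
  S (fun t => contract3 (Y t) (Z t)).
Proof. by move=> SY SZ; do 3![apply: sum_closed => ?]; exact: S_mul. Qed.

Section Metric.
Variables (g : T -> 'M[R]_4).
Hypothesis S_g : forall i j, S (fun t => g t i j).
Hypothesis S_G : forall i j, S (fun t => invmx (g t) i j).

Lemma closed_trace3 (Y : T -> tensor3 R) r :
  (forall r m n, S (fun t => Y t r m n)) -> S (fun t => trace3 (g t) (Y t) r).
Proof. by move=> SY; do 2![apply: sum_closed => ?]; exact: S_mul. Qed.

Lemma closed_trace3t (Y : T -> tensor3 R) r :
  (forall r m n, S (fun t => Y t r m n)) -> S (fun t => trace3t (g t) (Y t) r).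
Proof. by move=> SY; do 2![apply: sum_closed => ?]; exact: S_mul. Qed.

Lemma closed_dot1 (u v : T -> 'I_4 -> R) :
  (forall r, S (fun t => u t r)) -> (forall r, S (fun t => v t r)) ->
  S (fun t => dot1 (g t) (u t) (v t)).
Proof. by move=> Su Sv; do 2![apply: sum_closed => ?]; do 2!apply: S_mul => //. Qed.

Lemma closed_nonmetricity_scalar (Y : T -> tensor3 R) :
  (forall r m n, S (fun t => Y t r m n)) ->
  S (fun t => nonmetricity_scalar (g t) (Y t)).
Proof.
move=> SY; rewrite /nonmetricity_scalar.
have SYu r m n : S (fun t => move3 (invmx (g t)) (Y t) r m n) by exact: closed_move3.
have St r : S (fun t => trace3 (g t) (Y t) r) by exact: closed_trace3.
have Stt r : S (fun t => trace3t (g t) (Y t) r) by exact: closed_trace3t.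
have S_opp f : S f -> S (fun t => - f t).
  by move=> Sf; under eq_fun do rewrite -mulN1r; exact: S_mul.
do !apply: S_add; try apply: S_opp; apply: S_mul => //;
  try apply: closed_dot1 => //; apply: closed_contract3 => // r m n; exact: SYu.
Qed.

(** Used for two classes: smooth functions on an open set, and families tame in a parameter. The
    volume factor is not polynomial in the metric and enters as an abstract member [c]. *)
Lemma closed_legendre_formula (c : T -> R) (Y : T -> tensor3 R) a b e : S c ->
  (forall r m n, S (fun t => Y t r m n)) ->
  S (fun t => c t * move3 (invmx (g t)) (nonmet_op (g t) (Y t)) a b e).
Proof.
move=> Sc SY; apply: S_mul => //; apply: closed_move3 => // r m n.
rewrite /nonmet_op /lin3 /metric_first /metric_last /cyc_sym /zero3.
have St i : S (fun t => trace3 (g t) (Y t) i) by exact: closed_trace3.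
have Stt i : S (fun t => trace3t (g t) (Y t) i) by exact: closed_trace3t.
by do !first [exact: S_cst|exact: SY|exact: S_g|exact: St|exact: Stt|apply: S_add|apply: S_mul].
Qed.

Lemma closed_ham_grad (kappa2 : R) (P : T -> tensor3 R) a b e :
  S (fun t => (sqrtmdet (g t))^-1) -> (forall r m n, S (fun t => P t r m n)) ->
  S (fun t => ham_grad (g t) kappa2 (P t) a b e).
Proof.
move=> Ss SP; rewrite /ham_grad /ham_op /lin3 /metric_first /metric_last /cyc_sym /zero3.
have SPl r m n : S (fun t => move3 (g t) (P t) r m n) by exact: closed_move3.
have St i : S (fun t => trace3 (g t) (move3 (g t) (P t)) i) by exact: closed_trace3.
have Stt i : S (fun t => trace3t (g t) (move3 (g t) (P t)) i) by exact: closed_trace3t.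
have Sc : S (fun t => - (kappa2 / (2 * sqrtmdet (g t)))).
  under eq_fun do rewrite -mulN1r invfM !mulrA; exact: S_mul.
by do !first [exact: S_cst|exact: Sc|exact: SPl|exact: S_g|exact: St|exact: Stt|apply: S_add|apply: S_mul].
Qed.

End Metric.
End FunctionAlgebra.

(** * Smooth functions on open subsets of R^4 *)

Section Calculus.
Variable R : realType.
Implicit Types (U V : set 'rV[R]_4) (f h : 'rV[R]_4 -> R).

Lemma open_near U x : open U -> U x -> \forall y \near x, U y.
Proof. by move=> oU Ux; exact: open_nbhs_nbhs. Qed.

(** Only a directional derivative of [f] is available, so [f] is restricted to the line through [x]
    and the one-variable chain rule is applied there. *)
Lemma is_derive_comp1 (phi : R -> R) f (x v : 'rV[R]_4) (a b : R) :
  is_derive (f x) 1 phi a -> is_derive x v f b ->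
  is_derive x v (fun y => phi (f y)) (a * b).
Proof.
move=> [dphi phia] [df fb].
pose s := fun t : R => f (t *: v + x).
have s0 : s 0 = f x by rewrite /s scale0r add0r.
have ds : derivable s 0 1 by exact: (derivable1P f x v).1 df.
have dphi' : derivable phi (s 0) 1 by rewrite s0.
have line (F : 'rV[R]_4 -> R) : 'D_v F x = derive1 (fun t : R => F (t *: v + x)) 0.
  rewrite derive1E /derive; congr (lim _).
  have -> // : (fun h : R => h^-1 *: (F (h *: v + x) - F x)) =
     (fun h : R => h^-1 *: (F ((h *: 1 + 0) *: v + x) - F (0 *: v + x))).
  by apply/funext => t; rewrite addr0 scale0r add0r [t *: 1]mulr1.
apply: DeriveDef.
  apply/(derivable1P (fun y => phi (f y)))/derivable1_diffP.
  by apply: (@differentiable_comp _ _ _ _ s phi); exact/derivable1_diffP.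
rewrite line (derive1_comp ds dphi') derive1E s0 phia.
by rewrite -[derive1 s 0]line fb.
Qed.

Lemma derivable_line f x v : derivable f x v ->
  is_derive x v f ('D_v f x).
Proof. by move=> df; exact: DeriveDef. Qed.

Lemma Ck_on_continuous k U f x : Ck_on k U f -> U x -> f @ x --> f x.
Proof. by case: k => [|k] [cf _] /mem_set Ux; exact: cf. Qed.

Lemma Ck_onS k U f : open U -> Ck_on k.+1 U f -> Ck_on k U f.
Proof.
move=> oU; elim: k f => [|k IH] f [cf df]; first by split.
by split=> // i; have [? /IH] := df i.
Qed.

Lemma Ck_on_subset k U V f : V `<=` U -> Ck_on k U f -> Ck_on k V f.
Proof.
move=> VU; elim: k f => [|k IH] f [cf df]; (split; first
    by move=> x /set_mem/VU/mem_set; exact: cf) => // i.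
by have [df1 /IH ?] := df i; split=> // x /VU; exact: df1.
Qed.

Lemma open_near_eq U f h x : open U -> (forall x, U x -> f x = h x) -> U x ->
  {near x, f =1 h}.
Proof. by move=> oU fh Ux; near=> y; apply: fh; near: y; exact: open_near.
Unshelve. all: by end_near. Qed.

Lemma open_eq_continuous U f h : open U -> (forall x, U x -> f x = h x) ->
  {in U, continuous f} -> {in U, continuous h}.
Proof.
move=> oU fh cf x /[dup] Ux /set_mem Ux'; rewrite /prop_for /continuous_at -(fh _ Ux').
have e := near_eq_cvg (open_near_eq oU fh Ux').
exact: cvg_trans (e _) (cf x Ux).
Qed.

(** Partial derivatives depend on germs, so on an open set equality of the functions passes to every
    order. *)
Lemma Ck_on_eq k U f h : open U -> (forall x, U x -> f x = h x) ->
  Ck_on k U f -> Ck_on k U h.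
Proof.
move=> oU; elim: k f h => [|k IH] f h fh [cf df].
  by split=> //; exact: open_eq_continuous cf.
split=> [|i]; first exact: open_eq_continuous cf.
have [df1 df2] := df i; split=> [x Ux|].
  exact: near_eq_derivable (open_near_eq oU fh Ux) (df1 x Ux).
by apply: IH df2 => x Ux; apply: near_eq_derive; exact: (open_near_eq oU fh Ux).
Qed.

Lemma Ck_on_local k U f :
  (forall x, U x -> exists V, [/\ open V, V x & Ck_on k V f]) -> Ck_on k U f.
Proof.
elim: k f => [|k IH] f loc; split => //.
- by move=> x /set_mem/loc[V [oV Vx cf]]; exact: Ck_on_continuous cf Vx.
- by move=> x /set_mem/loc[V [oV Vx cf]]; exact: Ck_on_continuous cf Vx.
- move=> i; split=> [x /loc[V [oV Vx [_ /(_ i)[+ _]]]]|]; first exact.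
  by apply: IH => x /loc[V [oV Vx [_ /(_ i)[_ cf]]]]; exists V.
Qed.

Lemma smooth_on_eq U f h : open U -> (forall x, U x -> f x = h x) ->
  smooth_on U f -> smooth_on U h.
Proof. by move=> oU fh sf k; apply: Ck_on_eq (sf k). Qed.

Lemma smooth_on_subset U V f : V `<=` U -> smooth_on U f -> smooth_on V f.
Proof. by move=> VU sf k; apply: Ck_on_subset (sf k). Qed.

Lemma smooth_on_local U f :
  (forall x, U x -> exists V, [/\ open V, V x & smooth_on V f]) -> smooth_on U f.
Proof.
by move=> loc k; apply: Ck_on_local => x /loc[V [oV Vx sf]]; exists V.
Qed.

Lemma smooth_on_pd U f i : smooth_on U f -> smooth_on U (pd i f).
Proof. by move=> sf k; have [_ /(_ i)[]] := sf k.+1. Qed.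

Lemma smooth_on_continuous U f x : smooth_on U f -> U x -> f @ x --> f x.
Proof. by move=> /(_ 0) /Ck_on_continuous; exact. Qed.

Lemma smooth_on_derive U f x i : smooth_on U f -> U x ->
  is_derive x (delta_mx 0 i) f (pd i f x).
Proof.
by move=> /(_ 1%N)[_ /(_ i)[df _]] Ux; apply: DeriveDef => //; exact: df.
Qed.

Lemma Ck_on_cst k U (a : R) : open U -> Ck_on k U (fun=> a).
Proof.
move=> oU; elim: k a => [|k IH] a; (split; first by move=> x _; exact: (@cst_continuous _ _ a x)) => // i.
split=> [x _|]; first exact: derivable_cst.
by apply: Ck_on_eq (IH 0) => // x _; rewrite /pd derive_cst.
Qed.

Lemma Ck_on_add k U f h : open U -> Ck_on k U f -> Ck_on k U h ->
  Ck_on k U (fun x => f x + h x).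
Proof.
move=> oU; elim: k f h => [|k IH] f h [cf df] [ch dh];
  (split; first by move=> x Ux; exact: (cvgD (cf x Ux) (ch x Ux))) => // i.
have [df1 df2] := df i; have [dh1 dh2] := dh i.
split=> [x Ux|]; first by apply: derivableD; [exact: df1|exact: dh1].
apply: Ck_on_eq (IH _ _ df2 dh2) => // x Ux.
by rewrite /pd deriveD//; [exact: df1|exact: dh1].
Qed.

Lemma Ck_on_mul k U f h : open U -> Ck_on k U f -> Ck_on k U h ->
  Ck_on k U (fun x => f x * h x).
Proof.
move=> oU; elim: k f h => [|k IH] f h cf0 ch0;
  have [cf df] := cf0; have [ch dh] := ch0;
  (split; first by move=> x Ux; exact: (cvgM (cf x Ux) (ch x Ux))) => // i.
have [df1 df2] := df i; have [dh1 dh2] := dh i.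
split=> [x Ux|]; first by apply: derivableM; [exact: df1|exact: dh1].
apply: (Ck_on_eq oU _ (Ck_on_add oU (IH _ _ (Ck_onS oU cf0) dh2)
                                    (IH _ _ (Ck_onS oU ch0) df2))).
by move=> x Ux; rewrite /pd deriveM//; [exact: df1|exact: dh1].
Qed.

(* [phi k] is the [k]-th derivative of [phi 0] on [D]. *)
Lemma Ck_on_comp1 k U f (D : set R) (phi : nat -> R -> R) : open U ->
  (forall n y, D y -> is_derive y 1 (phi n) (phi n.+1 y)) ->
  (forall x, U x -> D (f x)) ->
  Ck_on k U f -> Ck_on k U (fun x => phi 0 (f x)).
Proof.
move=> oU; elim: k phi => [|k IH] phi dphi Df cf0; have [cf df] := cf0.
all: have cphi x : x \in U -> {for x, continuous (fun y => phi 0 (f y))}.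
1,3: move=> Ux; apply: (@continuous_comp _ _ _ f (phi 0)); [exact: cf|].
1,2: have [dp _] := dphi 0%N _ (Df _ (set_mem Ux)).
1,2: exact/differentiable_continuous/derivable1_diffP.
  by split=> // x; exact: cphi.
split=> [x|i]; first exact: cphi.
have [df1 df2] := df i.
have dcomp x : U x -> is_derive x (delta_mx 0 i) (fun y => phi 0 (f y))
    (phi 1 (f x) * pd i f x).
  move=> Ux; apply: is_derive_comp1; first exact/dphi/Df.
  exact/derivable_line/df1.
split=> [x /dcomp[]//|].
apply: (Ck_on_eq oU _ (Ck_on_mul oU (IH (fun n => phi n.+1) (fun n => dphi n.+1) Df (Ck_onS oU cf0)) df2)).
by move=> x /dcomp[_]; rewrite /pd => ->.
Qed.

Lemma smooth_on_cst U (a : R) : open U -> smooth_on U (fun=> a).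
Proof. by move=> oU k; exact: Ck_on_cst. Qed.

Lemma smooth_on_add U f h : open U -> smooth_on U f -> smooth_on U h ->
  smooth_on U (fun x => f x + h x).
Proof. by move=> oU sf sh k; exact: Ck_on_add. Qed.

Lemma smooth_on_mul U f h : open U -> smooth_on U f -> smooth_on U h ->
  smooth_on U (fun x => f x * h x).
Proof. by move=> oU sf sh k; exact: Ck_on_mul. Qed.

Lemma smooth_on_comp1 U f (D : set R) (phi : nat -> R -> R) : open U ->
  (forall n y, D y -> is_derive y 1 (phi n) (phi n.+1 y)) ->
  (forall x, U x -> D (f x)) ->
  smooth_on U f -> smooth_on U (fun x => phi 0 (f x)).
Proof. by move=> oU dphi Df sf k; exact: Ck_on_comp1 dphi Df (sf k). Qed.

Lemma Ck_on_derive k U f (df : 'I_4 -> 'rV[R]_4 -> R) : open U ->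
  {in U, continuous f} ->
  (forall i x, U x -> is_derive x (delta_mx 0 i) f (df i x)) ->
  (forall i, Ck_on k U (df i)) -> Ck_on k.+1 U f.
Proof.
move=> oU cf dfE cdf; split=> // i; split=> [x /(dfE i)[]//|].
by apply: Ck_on_eq (cdf i) => // x /(dfE i)[_ <-].
Qed.

(** Bootstrap: the derivative of 1/f is a polynomial in 1/f and the partial derivatives of f, so
    each order of regularity of 1/f yields the next. *)
Lemma smooth_on_inv U f : open U -> (forall x, U x -> f x != 0) ->
  smooth_on U f -> smooth_on U (fun x => (f x)^-1).
Proof.
move=> oU f0 sf k.
have ci : {in U, continuous (fun x => (f x)^-1)}.
  move=> x /set_mem Ux.
  exact: (cvgV (f0 x Ux) (smooth_on_continuous sf Ux)).
elim: k => [|k IH]; first by split.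
apply: (@Ck_on_derive _ _ _ (fun i x => -1 * ((f x)^-1 * (f x)^-1) * pd i f x)) => //.
  move=> i x Ux.
  have dinv := is_deriveV (f0 x Ux) (is_derive_id (f x) (1 : R)).
  apply: is_derive_eq (is_derive_comp1 dinv (smooth_on_derive i sf Ux)) _.
  by rewrite expr2 invfM /GRing.scale /=; ring.
by move=> i; do !apply: Ck_on_mul => //; [exact: Ck_on_cst|exact: smooth_on_pd].
Qed.

Lemma smooth_on_sqrt U f : open U -> (forall x, U x -> 0 < f x) ->
  smooth_on U f -> smooth_on U (fun x => Num.sqrt (f x)).
Proof.
move=> oU f0 sf; have cs : {in U, continuous (fun x => Num.sqrt (f x))}.
  move=> x /set_mem Ux; apply: (@continuous_comp _ _ _ f Num.sqrt).
    exact: smooth_on_continuous sf Ux.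
  exact: sqrt_continuous.
move=> k; elim: k => [|k IH]; first by split.
have h0 x : U x -> 2 * f x != 0 by move=> /f0 ?; rewrite mulf_neq0 ?pnatr_eq0 ?gt_eqF.
(* Writing the derivative with sqrt(f) / (2 f) instead of 1 / (2 sqrt(f)) leaves the square root
   itself, covered by the induction hypothesis, and the inverse of a smooth function. *)
apply: (@Ck_on_derive _ _ _ (fun i x => Num.sqrt (f x) * (2 * f x)^-1 * pd i f x)) => //.
  move=> i x Ux; have dsqrt := is_derive1_sqrt (f0 x Ux).
  apply: is_derive_eq (is_derive_comp1 dsqrt (smooth_on_derive i sf Ux)) _.
  congr (_ * _); rewrite -{3}(sqr_sqrtr (ltW (f0 x Ux))) expr2.
  by field; rewrite sqrtr_eq0 -ltNge f0.
move=> i; do 2?apply: Ck_on_mul => //; last exact: smooth_on_pd.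
by apply: smooth_on_inv => //; apply: smooth_on_mul => //; exact: smooth_on_cst.
Qed.

(** Going through the square root of f^2 avoids splitting the open set by the sign of f. *)
Lemma smooth_on_norm U f : open U -> (forall x, U x -> f x != 0) ->
  smooth_on U f -> smooth_on U (fun x => `|f x|).
Proof.
move=> oU f0 sf.
have -> : (fun x => `|f x|) = (fun x => Num.sqrt (f x * f x)).
  by apply/funext => x; rewrite -expr2 sqrtr_sqr.
apply: smooth_on_sqrt => //; last exact: smooth_on_mul.
by move=> x /f0; rewrite -expr2 exprn_even_gt0.
Qed.

Lemma is_derive_coord (i j : 'I_4) (x : 'rV[R]_4) :
  is_derive x (delta_mx 0 j) (fun y : 'rV[R]_4 => y 0 i) ((i == j)%:R : R).
Proof.
have df := @differentiable_coord R 1 4 x 0 i.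
apply: DeriveDef; first exact: diff_derivable.
have /derive_mx := @derivable_id R 'rV[R]_4 x (delta_mx 0 j); rewrite derive_id.
move=> /(congr1 (fun v : 'rV[R]_4 => v 0 i)); rewrite [LHS]mxE eqxx /= => ->.
by rewrite mxE.
Qed.

Lemma smooth_on_coord (i : 'I_4) : smooth_on setT (fun x : 'rV[R]_4 => x 0 i).
Proof.
have cc : continuous (fun x : 'rV[R]_4 => x 0 i).
  by move=> x; exact: coord_continuous.
move=> [|k]; first by split=> // x _; exact: cc.
apply: (@Ck_on_derive _ _ _ (fun j _ => (i == j)%:R)).
- exact: openT.
- by move=> x _; exact: cc.
- by move=> j x _; exact: is_derive_coord.
- by move=> j; apply: Ck_on_cst; exact: openT.
Qed.

End Calculus.

(** * Taylor expansion and the chain rule *)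

Section ChainRule.
Variable R : realType.
Implicit Types (U V : set 'rV[R]_4) (f h : 'rV[R]_4 -> R).

Lemma mx_norm_coord (v : 'rV[R]_4) i : `|v 0 i| <= `|v|.
Proof.
rewrite [leRHS]/Num.Def.normr/= mx_normrE.
exact: (le_bigmax _ (fun ij : 'I_1 * 'I_4 => `|v ij.1 ij.2|) (0, i)).
Qed.

Lemma mx_norm_le (v : 'rV[R]_4) e : 0 <= e -> (forall i, `|v 0 i| <= e) -> `|v| <= e.
Proof.
move=> e0 ve; rewrite [leLHS]/Num.Def.normr/= mx_normrE bigmax_le// => -[j i] _ /=.
by rewrite (ord1 j).
Qed.

(** The increment may be negative, as coordinates of a displacement are; the intermediate point is
    located by its absolute value only. *)
Lemma MVT_signed (phi dphi : R -> R) (c : R) :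
  (forall t : R, `|t| <= `|c| -> is_derive t 1 phi (dphi t)) ->
  exists2 t, `|t| <= `|c| & phi c - phi 0 = dphi t * c.
Proof.
move=> D; have cphi t : `|t| <= `|c| -> {for t, continuous phi}.
  by move=> /D[dp _]; exact/differentiable_continuous/derivable1_diffP.
have within_cphi a b : (forall t, t \in `[a, b] -> `|t| <= `|c|) ->
    {within `[a, b], continuous phi}.
  move=> ab; apply: continuous_in_subspaceT => t tab.
  by apply: cphi; apply: ab; rewrite inE in tab.
have [c0|c0] := leP 0 c.
  have ab t : t \in `[0, c] -> `|t| <= `|c|.
    by rewrite in_itv /= => /andP[t0 tc]; rewrite !ger0_norm.
  have D0 t : t \in `]0, c[ -> is_derive t 1 phi (dphi t).
    by move=> /subset_itv_oo_cc tc; exact/D/ab.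
  have [t tc E] := MVT_segment c0 D0 (within_cphi _ _ ab).
  by exists t; [exact: ab|rewrite E subr0].
have ab t : t \in `[c, 0] -> `|t| <= `|c|.
  by rewrite in_itv /= => /andP[tc t0]; rewrite (ltr0_norm c0) ler0_norm// lerN2.
have D0 t : t \in `]c, 0[ -> is_derive t 1 phi (dphi t).
  by move=> /subset_itv_oo_cc tc; exact/D/ab.
have [t tc E] := MVT_segment (ltW c0) D0 (within_cphi _ _ ab).
by exists t; [exact: ab|rewrite -opprB E sub0r mulrN opprK].
Qed.

Lemma is_derive_line f (y v : 'rV[R]_4) (t df : R) :
  is_derive (y + t *: v) v f df -> is_derive t 1 (fun s : R => f (y + s *: v)) df.
Proof.
move=> [dy <-].
have E : (fun h : R => h^-1 *: (f (y + (h *: 1 + t) *: v) - f (y + t *: v))) =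
    (fun h : R => h^-1 *: (f (h *: v + (y + t *: v)) - f (y + t *: v))).
  apply/funext => h; rewrite [h *: 1]mulr1 scalerDl.
  by rewrite [in RHS]addrCA.
by apply: DeriveDef; rewrite /derivable /derive /= E.
Qed.

(* First-order Taylor expansion from continuity of the partial derivatives,
   changing one coordinate at a time. *)
Lemma C1_expansion U f (x : 'rV[R]_4) (e : R) : open U -> U x -> Ck_on 1 U f ->
  0 < e -> \forall k \near (0 : 'rV[R]_4),
    `|f (x + k) - f x - \sum_i k 0 i * pd i f x| <= e * `|k|.
Proof.
move=> oU Ux [cf df] e0.
have cpd i : pd i f @ x --> pd i f x.
  by have [_ c0] := df i; exact: (@Ck_on_continuous _ 0 U _ x c0 Ux).
(* A quarter of [e] is spent on each of the four coordinate steps. *)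
have nU : \forall y \near x, U y /\ forall i, `|pd i f x - pd i f y| <= e / 4.
  have pd_near i : \forall y \near x, `|pd i f x - pd i f y| <= e / 4.
    by move/cvgrPdist_le : (cpd i); apply; rewrite divr_gt0.
  near=> y; split; first by near: y; exact: open_near.
  move=> i; move: i; near: y; exact: filter_forall.
have [d /= d0 dU] := (nbhs_ballP x _).1 nU.
have {}dU (v : 'rV[R]_4) : `|v| < d ->
    U (x + v) /\ forall i, `|pd i f x - pd i f (x + v)| <= e / 4.
  by move=> vd; apply: dU; rewrite -ball_normE /ball_ /= opprD addNKr normrN.
have small : \forall k \near (0 : 'rV[R]_4), `|k| < d.
  by apply/nbhs_ballP; exists d => // y; rewrite -ball_normE /ball_ /= sub0r normrN.
near=> k.
have kd : `|k| < d by near: k.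
(* [part j] keeps the first [j] coordinates of [k], so the increment telescopes from [part 0 = 0] to
   [part 4 = k]. *)
pose part (j : nat) : 'rV[R]_4 := \row_i (if (i < j)%N then k 0 i else 0).
have step (j : 'I_4) : `|f (x + part j.+1) - f (x + part j) - k 0 j * pd j f x|
    <= e / 4 * `|k|.
  pose phi t := f (x + part j + t *: delta_mx 0 j).
  have near_part (t : R) : `|t| <= `|k 0 j| -> `|part j + t *: delta_mx 0 j| < d.
    move=> tk; apply: le_lt_trans kd; apply: mx_norm_le => // i.
    rewrite !mxE eqxx /=; case: ltngtP => [ij|ji|/val_inj ->].
    - by rewrite (_ : (i == j) = false) ?mulr0 ?addr0 ?mx_norm_coord// -val_eqE /= ltn_eqF.
    - by rewrite (_ : (i == j) = false) ?mulr0 ?addr0 ?normr0// -val_eqE /= gtn_eqF.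
    - by rewrite eqxx mulr1 add0r (le_trans tk)// mx_norm_coord.
  have D (t : R) : `|t| <= `|k 0 j| ->
      is_derive t 1 phi (pd j f (x + part j + t *: delta_mx 0 j)).
    move=> /near_part/dU[]; rewrite addrA => Uy _.
    by have [dfj _] := df j; apply: (@is_derive_line f (x + part j)); apply: DeriveDef => //; exact: dfj.
  have [t tk E] := MVT_signed D.
  have -> : f (x + part j.+1) = phi (k 0 j).
    congr f; rewrite -addrA; congr (x + _); apply/rowP => i; rewrite !mxE eqxx /= ltnS.
    case: ltngtP => [ij|ji|/val_inj ->].
    - by rewrite (_ : (i == j) = false) ?mulr0 ?addr0// -val_eqE /= ltn_eqF.
    - by rewrite (_ : (i == j) = false) ?mulr0 ?addr0// -val_eqE /= gtn_eqF.
    - by rewrite eqxx mulr1 add0r.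
  have -> : f (x + part j) = phi 0 by rewrite /phi scale0r addr0.
  rewrite E mulrC -mulrBr normrM mulrC; apply: ler_pM => //; last exact: mx_norm_coord.
  by rewrite distrC -addrA; have [_] := dU _ (near_part _ tk); exact.
have -> : f (x + k) - f x - \sum_i k 0 i * pd i f x =
    \sum_(j < 4) (f (x + part j.+1) - f (x + part j) - k 0 j * pd j f x).
  rewrite big_split sumrN /=; congr (_ - _).
  rewrite -(big_mkord xpredT (fun j => f (x + part j.+1) - f (x + part j))).
  rewrite telescope_sumr//; congr (f (x + _) - f _).
    by apply/rowP => i; rewrite mxE ltn_ord.
  rewrite -[LHS]addr0; congr (x + _).
  by apply/rowP => i; rewrite !mxE.
apply: le_trans (ler_norm_sum _ _ _) _.
apply: le_trans (ler_sum _ (fun j _ => step j)) _.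
rewrite sumr_const card_ord -[X in X <= _]mulr_natl mulrA.
by rewrite (_ : 4%:R * (e / 4) = e)//; field.
Unshelve. all: by end_near.
Qed.

(** Smoothness as defined provides partial derivatives only; total differentiability of the outer
    function is supplied by [C1_expansion], while the inner map is followed along one direction. *)
Lemma chain_rule U V f (T : 'rV[R]_4 -> 'rV[R]_4) x i :
  open U -> open V -> U x -> V (T x) -> smooth_on V f ->
  (forall a, smooth_on U (fun y => T y 0 a)) ->
  is_derive x (delta_mx 0 i) (fun y => f (T y))
    (\sum_a pd a f (T x) * pd i (fun y => T y 0 a) x).
Proof.
move=> oU oV Ux VTx sf sT; set v := delta_mx 0 i.
pose k (h : R) : 'rV[R]_4 := T (h *: v + x) - T x.
pose w : 'rV[R]_4 := \row_a pd i (fun y => T y 0 a) x.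
have kcvg : h^-1 *: k h @[h --> 0^'] --> w.
  have dT : derivable T x v.
    by apply/derivable_mxP => b a; rewrite (ord1 b); have [] := smooth_on_derive i (sT a) Ux.
  have -> : w = 'D_v T x.
    by rewrite derive_mx//; apply/rowP => a; rewrite !mxE.
  exact: dT.
have k0 : k h @[h --> 0^'] --> (0 : 'rV[R]_4).
  have -> : (0 : 'rV[R]_4) = (0 : R) *: w by rewrite scale0r.
  have : h *: (h^-1 *: k h) @[h --> 0^'] --> (0 : R) *: w.
    by apply: cvgZ => //; exact/cvg_within.
  apply: cvg_trans; apply: near_eq_cvg; near=> h.
  by rewrite scalerA divff ?scale1r//; near: h; exact: nbhs_dnbhs_neq.
suff cv : h^-1 *: (f (T (h *: v + x)) - f (T x)) @[h --> 0^'] -->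
    \sum_a pd a f (T x) * pd i (fun y => T y 0 a) x.
  by apply: DeriveDef; [apply/cvg_ex; eexists; exact: cv | exact/cvg_lim].
pose lin (u : 'rV[R]_4) := \sum_a u 0 a * pd a f (T x).
have lincvg : lin (h^-1 *: k h) @[h --> 0^'] --> lin w.
  apply: cvg_big => [|a _]; first exact: add_continuous.
  apply: cvgMr_tmp.
  exact: (cvg_comp _ _ kcvg (@coord_continuous _ _ _ _ _ _)).
have -> : \sum_a pd a f (T x) * pd i (fun y => T y 0 a) x = lin w.
  by apply: eq_bigr => a _; rewrite !mxE mulrC.
apply: cvg_sub0 lincvg; apply/cvgr0Pnorm_le => e e0.
(* The difference quotient of [T] tends to [w], so near 0 its norm is at most |w| + 1; dividing [e]
   by this bound keeps the Taylor error below [e] after division by [h]. *)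
have w1 : 0 < `|w| + 1 by rewrite ltr_wpDl.
have ew : 0 < e / (`|w| + 1) by rewrite divr_gt0.
have exp_f := k0 _ (C1_expansion oV VTx (sf 1%N) ew).
have bnd : \forall h \near 0^', `|h^-1 *: k h| <= `|w| + 1.
  by move/cvg_norm : kcvg => /cvgr_le; apply; rewrite ltrDl.
near=> h.
have h0 : h != 0 by near: h; exact: nbhs_dnbhs_neq.
have Ekh : T x + k h = T (h *: v + x) by rewrite addrC subrK.
have : `|f (T x + k h) - f (T x) - \sum_a (k h) 0 a * pd a f (T x)| <=
    e / (`|w| + 1) * `|k h| by near: h.
rewrite Ekh => Eh.
rewrite [X in `|X| <= _](_ : _ =
    h^-1 * (f (T (h *: v + x)) - f (T x) - \sum_a (k h) 0 a * pd a f (T x))); last first.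
  rewrite mulrBr; congr (_ - _); rewrite /lin mulr_sumr; apply: eq_bigr => a _.
  by rewrite mxE mulrA.
rewrite normrM normfV ler_pdivrMl ?normr_gt0//.
apply: le_trans Eh _.
have -> : `|k h| = `|h| * `|h^-1 *: k h|.
  by rewrite normrZ normfV mulVKf// normr_eq0.
rewrite mulrCA ler_wpM2l// -mulrA -[leRHS]mulr1 ler_wpM2l// ?(ltW e0)//.
by rewrite ler_pdivrMl// mulr1; near: h.
Unshelve. all: by end_near. Qed.

End ChainRule.

(** * Bump functions *)

Section Bump.
Variable R : realType.

Lemma smooth_on_sum (U : set 'rV[R]_4) (I : finType) (F : I -> 'rV[R]_4 -> R) :
  open U -> (forall i, smooth_on U (F i)) -> smooth_on U (fun x => \sum_i F i x).
Proof.
move=> oU sF; elim: (index_enum I) => [|i l IH].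
  by under eq_fun do rewrite big_nil; exact: smooth_on_cst.
by under eq_fun do rewrite big_cons; exact: smooth_on_add.
Qed.

(** The functions p(1/x) exp(-1/x), extended by zero, form a family stable under differentiation, so
    one derivative computation gives all orders. The next definition is the induced map on p, its
    factor 'X^2 coming from d/dx (1/x) = -1/x^2. *)
Definition flat_exp (p : {poly R}) (x : R) : R :=
  if 0 < x then p.[x^-1] * expR (- x^-1) else 0.

Definition flat_exp_deriv (p : {poly R}) : {poly R} := 'X^2 * (p - p^`()%R).

(** Of the two extra powers of u = 1/h, one absorbs the division by h in the difference quotient at
    0 and the other leaves a factor h. *)
Lemma horner_exp_decay (p : {poly R}) :
  exists C, forall u : R, 1 <= u -> `|p.[u]| * expR (- u) * u ^+ 2 <= C.
Proof.
pose S := \sum_(i < size p) `|p`_i|.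
(* For u >= 1 the polynomial is at most S u^(size p), and exp(u) >= u^n / n! with n = size p + 2
   controls the rest. *)
exists (S * ((size p).+2)`!%:R) => u u1.
have u0 : 0 < u by exact: lt_le_trans u1.
have pS : `|p.[u]| <= S * u ^+ size p.
  rewrite horner_coef mulr_suml; apply: le_trans (ler_norm_sum _ _ _) _.
  apply: ler_sum => i _; rewrite normrM (ger0_norm (exprn_ge0 _ (ltW u0))).
  by rewrite ler_wpM2l// ler_weXn2l// ltnW.
have S0 : 0 <= S by exact: sumr_ge0.
have fact0 : 0 < ((size p).+2)`!%:R :> R by rewrite ltr0n fact_gt0.
have : u ^+ (size p).+2 * expR (- u) <= ((size p).+2)`!%:R.
  rewrite expRN ler_pdivrMr ?expR_gt0// mulrC -ler_pdivrMr//.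
  by apply: le_trans (expR_ge1Dxn (size p).+1 (ltW u0)); rewrite lerDr.
move=> bnd; apply: (@le_trans _ _ (S * u ^+ size p * expR (- u) * u ^+ 2)).
  by rewrite !ler_wpM2r ?expR_ge0// exprn_ge0// ltW.
rewrite -!mulrA ler_wpM2l//; apply: le_trans bnd.
by rewrite mulrCA -exprD addn2 mulrC.
Qed.

Lemma is_derive_flat_exp (p : {poly R}) (x : R) :
  is_derive x 1 (flat_exp p) (flat_exp (flat_exp_deriv p) x).
Proof.
have [x0|x0|->] := ltgtP x 0.
- rewrite {2}/flat_exp ltNge (ltW x0) /=.
  have E : \near x, cst (0 : R) x = flat_exp p x.
    near=> y; rewrite /flat_exp ltNge ltW//.
    by near: y; exact: lt_nbhsl.
  exact: near_eq_is_derive E (is_derive_cst (0 : R) x 1).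
- rewrite {2}/flat_exp x0.
  have E : \near x, (fun y : R => p.[y^-1] * expR (- y^-1)) x = flat_exp p x.
    near=> y; rewrite /flat_exp (_ : 0 < y)//.
    by near: y; exact: lt_nbhsr.
  have xn0 : x != 0 by rewrite gt_eqF.
  have dinv : is_derive x 1 (fun y : R => y^-1) (- x ^- 2 *: 1).
    exact: (is_deriveV xn0 (is_derive_id x (1 : R))).
  have dexp : is_derive x 1 (fun y : R => expR (- y^-1)) (expR (- x^-1) * (x ^- 2 *: 1)).
    have dneg : is_derive x 1 (fun y : R => - y^-1) (- (- x ^- 2 *: 1)).
      exact: is_deriveN.
    have := @is_derive1_comp R expR (fun y : R => - y^-1) x _ _ (is_derive_expR (- x^-1)) dneg.
    by rewrite scaleNr opprK.
  have dp : is_derive x 1 (fun y : R => p.[y^-1]) (p^`()%R.[x^-1] * (- x ^- 2 *: 1)).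
    exact: (@is_derive1_comp R (horner p) (fun y : R => y^-1) x _ _ (is_derive_poly p x^-1) dinv).
  apply: near_eq_is_derive E _.
  apply: is_derive_eq (is_deriveM dp dexp) _.
  rewrite /flat_exp_deriv !hornerE /GRing.scale /= !mulr1 exprVn; ring.
- rewrite {2}/flat_exp ltxx.
  have [C Cp] := horner_exp_decay p.
  have q0 : h^-1 *: (flat_exp p (h *: 1 + 0) - flat_exp p 0) @[h --> 0^'] --> (0 : R).
    apply/cvgr0Pnorm_le => e e0.
    have C1 : 0 < `|C| + 1 by rewrite ltr_wpDl.
    near=> h.
    have h0 : h != 0 by near: h; exact: nbhs_dnbhs_neq.
    rewrite addr0 [h *: 1]mulr1 /flat_exp ltxx subr0.
    case: ifPn => [hp|_]; last by rewrite scaler0 normr0 ltW.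
    have h1 : `|h| <= 1 by near: h; exact: dnbhs0_le.
    have he : `|h| <= e / (`|C| + 1) by near: h; apply: dnbhs0_le; rewrite divr_gt0.
    rewrite (gtr0_norm hp) in h1 he.
    have := Cp h^-1; rewrite invf_ge1// => /(_ h1) bnd.
    rewrite !normrM (gtr0_norm (expR_gt0 _)) gtr0_norm ?invr_gt0//.
    apply: (@le_trans _ _ ((`|C| + 1) * h)); last by rewrite mulrC -ler_pdivlMr.
    rewrite -ler_pdivrMr// mulrC mulrC.
    apply: le_trans (_ : C <= _); last by rewrite (le_trans (ler_norm C))// lerDl.
    apply: le_trans bnd; rewrite expr2 le_eqVlt; apply/orP; left; apply/eqP; ring.
  by apply: DeriveDef; [apply/cvg_ex; eexists; exact: q0|exact/cvg_lim].
Unshelve. all: by end_near. Qed.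

(** Smoothness is stated for composites with any map having smooth coordinates, because the bump is
    later read through chart transitions. *)
Lemma bump_function (a : 'rV[R]_4) (r : R) : 0 < r ->
  exists chi : 'rV[R]_4 -> R,
    [/\ forall (U : set 'rV[R]_4) (T : 'rV[R]_4 -> 'rV[R]_4), open U ->
          (forall i, smooth_on U (fun x => T x 0 i)) -> smooth_on U (fun x => chi (T x)),
        0 < chi a &
        forall x, chi x != 0 -> forall i, `|x 0 i - a 0 i| <= r].
Proof.
(* [s] is r^2 minus the squared Euclidean distance to [a]; it is positive only inside the ball,
   which lies in the cube of half-width [r]. *)
move=> r0; pose s (x : 'rV[R]_4) := r ^+ 2 + -1 * \sum_i (x 0 i + - a 0 i) * (x 0 i + - a 0 i).
exists (fun x => flat_exp 1 (s x)); split.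
- move=> U T oU sT; pose phi n := flat_exp (iter n flat_exp_deriv 1).
  apply: (@smooth_on_comp1 _ _ (fun x => s (T x)) setT phi) => //.
    by move=> n y _; exact: is_derive_flat_exp.
  apply: smooth_on_add => //; first exact: smooth_on_cst.
  apply: smooth_on_mul => //; first exact: smooth_on_cst.
  apply: smooth_on_sum => // i.
  have sTa : smooth_on U (fun x => T x 0 i + - a 0 i).
    by apply: smooth_on_add => //; exact: smooth_on_cst.
  exact: smooth_on_mul.
- rewrite /s big1 => [|i _]; last by rewrite subrr mul0r.
  by rewrite mulr0 addr0 /flat_exp exprn_gt0// hornerC mul1r expR_gt0.
move=> x; rewrite /flat_exp; case: ifP => [sx _ i|]; last by rewrite eqxx.
rewrite -ler_sqr ?nnegrE// ?(ltW r0)// real_normK ?num_real//.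
apply: ltW; apply: le_lt_trans (_ : \sum_i (x 0 i + - a 0 i) * (x 0 i + - a 0 i) < _).
  rewrite (bigD1 i)//= -expr2 lerDl sumr_ge0// => j _.
  by rewrite -expr2 sqr_ge0.
by move: sx; rewrite /s mulN1r subr_gt0.
Qed.

End Bump.

(** * Integration over pieces *)

Section Measure.
Variable R : realType.
Notation space4 := (measurableTypeR R * measurableTypeR R * measurableTypeR R
         * measurableTypeR R)%type.

(** The same function as [lebesgue4], with the measure structure kept in its type so that
    integration lemmas apply. *)
Definition lebesgue4_measure : {measure set space4 -> \bar R} :=
  (((@lebesgue_measure R \x @lebesgue_measure R) \x @lebesgue_measure R)
     \x @lebesgue_measure R)%E.

Lemma integral4E (B : set 'rV[R]_4) f :
  integral4 B f = \int[lebesgue4_measure]_(u in (@vec4 R) @^-1` B) f (vec4 u).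
Proof. by []. Qed.

Lemma measurable_vec4_coord (i : 'I_4) :
  measurable_fun [set: space4] (fun u => vec4 u 0 i : R).
Proof.
case: i => -[|[|[|[|//]]]] lti; under eq_fun do rewrite mxE /=.
- apply: (@measurableT_comp _ _ _ _ _ _ fst); first exact: measurable_fst.
  by apply: (@measurableT_comp _ _ _ _ _ _ fst); exact: measurable_fst.
- apply: (@measurableT_comp _ _ _ _ _ _ snd); first exact: measurable_snd.
  by apply: (@measurableT_comp _ _ _ _ _ _ fst); exact: measurable_fst.
- apply: (@measurableT_comp _ _ _ _ _ _ snd); first exact: measurable_snd.
  exact: measurable_fst.
- exact: measurable_snd.
Qed.

Definition open_box (q : 'rV[rat]_4 * nat) : set 'rV[R]_4 :=
  [set x | forall i, `|x 0 i - ratr (q.1 0 i)| < q.2.+1%:R^-1].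

Lemma measurable_open_box q : measurable ((@vec4 R) @^-1` open_box q).
Proof.
have -> : (@vec4 R) @^-1` open_box q = \bigcap_(i in [set: 'I_4])
    ((fun u : space4 => vec4 u 0 i : R) @^-1` ball (ratr (q.1 0 i) : R) (q.2.+1%:R^-1)).
  apply/seteqP; split=> u h i; first by move=> _; rewrite /= -ball_normE /= distrC; exact: h.
  by have := h i I; rewrite /= -ball_normE /= distrC.
apply: fin_bigcap_measurable => [|i _]; first exact: finite_finset.
rewrite -[X in measurable X]setTI; apply: measurable_vec4_coord => //.
by apply: open_measurable; exact: ball_open.
Qed.

(** Measurability comes from the product structure, openness from the norm on row vectors. They meet
    because an open set is a countable union of rational boxes. *)
Lemma measurable_vec4_open (O : set 'rV[R]_4) : open O ->
  measurable ((@vec4 R) @^-1` O).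
Proof.
move=> oO.
have -> : (@vec4 R) @^-1` O = \bigcup_(q : 'rV[rat]_4 * nat)
    (if `[< open_box q `<=` O >] then (@vec4 R) @^-1` open_box q else set0).
  apply/seteqP; split=> [u Ou|u [q _]]; last by case: asboolP => // + h; exact.
  have /nbhs_ballP[e /= e0 eO] := open_near oO Ou.
  (* Half of [e] for the distance from the point to the rational centre, half for the distance from
     the centre to another point of the box. *)
  have [n ne] : exists n : nat, n.+1%:R^-1 < e / 2.
    have [N _ /(_ N (leqnn N))] := near_infty_natSinv_lt (PosNum (divr_gt0 e0 (ltr0Sn R 1))).
    by move=> /= h; exists N.
  have rat_near (i : 'I_4) : exists q : rat, `|vec4 u 0 i - ratr q| < n.+1%:R^-1.
    have : vec4 u 0 i - n.+1%:R^-1 < vec4 u 0 i by rewrite ltrBlDr ltrDl.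
    move=> /rat_in_itvoo[q]; rewrite in_itv /= => /andP[q1 q2]; exists q.
    by rewrite gtr0_norm ?subr_gt0// ltrBlDr addrC -ltrBlDr.
  have [q hq] := choice rat_near.
  exists (\row_i q i, n) => //; rewrite asboolT.
    by move=> i /=; rewrite mxE; exact: hq.
  move=> y yb; apply: eO; rewrite -ball_normE /ball_ /=.
  apply: le_lt_trans (_ : n.+1%:R^-1 + n.+1%:R^-1 < e); last first.
    by rewrite (splitr e) ltrD.
  apply: mx_norm_le => // i; rewrite !mxE.
  have := yb i; rewrite /= mxE => /ltW hy; have /ltW hu := hq i; rewrite mxE in hu.
  rewrite -(subrKA (ratr (q i))); apply: le_trans (ler_normD _ _) _.
  by rewrite lerD// distrC.
apply: countable_bigcupT_measurable; first exact: countableP.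
by move=> q; case: ifP => // _; exact: measurable_open_box.
Qed.

Lemma measurable_vec4_closed (A : set 'rV[R]_4) : closed A ->
  measurable ((@vec4 R) @^-1` A).
Proof.
move=> cA; rewrite -[X in measurable X]setCK; apply: measurableC.
exact: (measurable_vec4_open (closed_openC cA)).
Qed.

Lemma measurable_continuous_vec4 (B U : set 'rV[R]_4) (f : 'rV[R]_4 -> R) :
  measurable ((@vec4 R) @^-1` B) -> open U -> B `<=` U ->
  (forall x, U x -> f @ x --> f x) ->
  measurable_fun ((@vec4 R) @^-1` B) (fun u => f (vec4 u)).
Proof.
move=> mB oU BU cf; apply: (measurability _ (RGenOInfty.measurableE R)).
move=> _ [_ [a ->] <-].
have -> : (@vec4 R) @^-1` B `&` (fun u => f (vec4 u)) @^-1` `]a, +oo[%classic =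
   (@vec4 R) @^-1` B `&` (@vec4 R) @^-1` (U `&` f @^-1` `]a, +oo[%classic).
  apply/seteqP; split=> u [Bu fu]; split=> //; last by case: fu.
  by split=> //; exact: BU.
apply: measurableI => //; apply: measurable_vec4_open.
rewrite openE => x [Ux fx]; apply: filterI; first exact: open_near.
apply: (cf x Ux); apply: open_nbhs_nbhs; split=> //; exact: interval_open.
Qed.

(** Serves twice: for the finite measure of relatively compact pieces, and for the positive measure
    of a cube. *)
Lemma lebesgue4_box (a : 'rV[R]_4) (r : R) : 0 <= r ->
  lebesgue4 ((@vec4 R) @^-1` [set x | forall i, `|x 0 i - a 0 i| <= r]) =
  ((r *+ 2) ^+ 4)%:E.
Proof.
move=> r0.
pose I (k : nat) : set (measurableTypeR R) :=
  `[a 0 (inord k) - r, a 0 (inord k) + r]%classic.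
have memI (k : nat) y : (I k y) = (`|y - a 0 (inord k)| <= r) :> Prop.
  by rewrite /I /= in_itv /= ler_distl.
have -> : (@vec4 R) @^-1` [set x | forall i, `|x 0 i - a 0 i| <= r] =
    ((I 0%N `*` I 1%N) `*` I 2%N) `*` I 3%N.
  apply/seteqP; split=> [u h|u [[[/= u0 u1] u2] u3] i].
    have H k : (k < 4)%N -> `|nth 0 [:: u.1.1.1; u.1.1.2; u.1.2; u.2] k - a 0 (inord k)| <= r.
      by move=> k4; have := h (inord k); rewrite mxE inordK.
    by split=> /=; [split=> /=; [split=> /=|]|]; rewrite memI;
      [exact: (H 0%N)|exact: (H 1%N)|exact: (H 2%N)|exact: (H 3%N)].
  rewrite memI in u0; rewrite memI in u1; rewrite memI in u2; rewrite memI in u3.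
  rewrite mxE -[X in a 0 X](inord_val i).
  by case: i => -[|[|[|[|//]]]].
have mI k : measurable (I k) by exact: measurable_itv.
have lI k : lebesgue_measure (I k) = (r *+ 2)%:E.
  rewrite lebesgue_measure_itv /= lte_fin; case: ltP => [_|].
    by rewrite -EFinB; congr EFin; rewrite mulr2n; ring.
  move=> h; have -> : r = 0 by lra.
  by rewrite mul0rn.
have m2 : measurable (I 0%N `*` I 1%N) by exact: measurableX.
have m3 : measurable ((I 0%N `*` I 1%N) `*` I 2%N) by exact: measurableX.
pose l := @lebesgue_measure R.
have l2 : (l \x l)%E (I 0%N `*` I 1%N) = ((r *+ 2) * (r *+ 2))%:E.
  transitivity (l (I 0%N) * l (I 1%N))%E; first exact: product_measure1E.
  by rewrite /l !lI -EFinM.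
have l3 : ((l \x l) \x l)%E ((I 0%N `*` I 1%N) `*` I 2%N) =
    ((r *+ 2) * (r *+ 2) * (r *+ 2))%:E.
  transitivity ((l \x l)%E (I 0%N `*` I 1%N) * l (I 2%N))%E.
    exact: product_measure1E.
  by rewrite l2 /l lI -EFinM.
transitivity (((l \x l) \x l)%E ((I 0%N `*` I 1%N) `*` I 2%N) * l (I 3%N))%E.
  exact: product_measure1E.
by rewrite l3 /l lI -EFinM; congr EFin; ring.
Qed.

Lemma lebesgue4_compact_lty (B C : set 'rV[R]_4) :
  measurable ((@vec4 R) @^-1` B) -> compact C -> B `<=` C ->
  (lebesgue4 ((@vec4 R) @^-1` B) < +oo)%E.
Proof.
move=> mB cC BC; have [M [_ CM]] := compact_bounded cC.
have r0 : 0 <= `|M| + 1 by rewrite addr_ge0.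
have E0 (x : 'rV[R]_4) i : x 0 i - (0 : 'rV[R]_4) 0 i = x 0 i.
  by rewrite [X in _ - X]mxE subr0.
have box_coord (i : 'I_4) : measurable ((@vec4 R) @^-1` [set x | `|x 0 i - (0 : 'rV[R]_4) 0 i| <= `|M| + 1]).
  have -> : (@vec4 R) @^-1` [set x | `|x 0 i - (0 : 'rV[R]_4) 0 i| <= `|M| + 1] =
     (fun u : space4 => vec4 u 0 i : R) @^-1` `[- (`|M| + 1), `|M| + 1]%classic.
    by apply/seteqP; split=> u; rewrite /= E0 in_itv /= ler_norml.
  by rewrite -[X in measurable X]setTI; apply: measurable_vec4_coord => //; exact: measurable_itv.
have mbox : measurable ((@vec4 R) @^-1` [set x | forall i, `|x 0 i - (0 : 'rV[R]_4) 0 i| <= `|M| + 1]).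
  have -> : (@vec4 R) @^-1` [set x | forall i, `|x 0 i - (0 : 'rV[R]_4) 0 i| <= `|M| + 1] =
     \bigcap_(i in [set: 'I_4]) (@vec4 R) @^-1` [set x | `|x 0 i - (0 : 'rV[R]_4) 0 i| <= `|M| + 1].
    by apply/seteqP; split=> u h i; [move=> _; exact: h|exact: (h i I)].
  by apply: fin_bigcap_measurable => //; exact: finite_finset.
have BC' : (@vec4 R) @^-1` B `<=`
    (@vec4 R) @^-1` [set x | forall i, `|x 0 i - (0 : 'rV[R]_4) 0 i| <= `|M| + 1].
  move=> u /BC Cu i; rewrite E0; apply: le_trans (mx_norm_coord _ _) _.
  by apply: CM => //; rewrite ltr_pwDr// ler_norm.
have boxoo := ltry (((`|M| + 1) *+ 2) ^+ 4).
rewrite -(lebesgue4_box 0 r0) in boxoo.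
apply: le_lt_trans boxoo.
exact: (@le_measure _ _ _ lebesgue4_measure _ _ (mem_set mB) (mem_set mbox) BC').
Qed.

End Measure.
Lemma measurable_fun_inv d (T : measurableType d) (R : realType) (D : set T) (f : T -> R) :
  measurable_fun D (f : T -> measurableTypeR R) -> (forall x, D x -> f x != 0) ->
  measurable_fun D ((fun x => (f x)^-1) : T -> measurableTypeR R).
Proof.
move=> mf f0.
have mU : measurable ([set y : R | y != 0] : set (measurableTypeR R)).
  exact: (open_measurable (@open_neq R (0 : R))).
apply: (measurable_comp mU) mf.
  by move=> _ /= [u Du <-]; exact: f0.
apply: open_continuous_measurable_fun.
  exact: (@open_neq R (0 : R)).
by move=> y; rewrite inE /= => y0; exact: inv_continuous.
Qed.

(** * Perturbation estimates *)

Section Perturbation.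
Variable R : realType.
Variable B : set 'rV[R]_4.
Implicit Types f h : R * 'rV[R]_4 -> R.

(* Tame families form an algebra, and the product of two of them vanishing at
   [t = 0] is [quadratic]; this replaces differentiation under the integral. *)
Definition tame f : Prop := exists e K : R, [/\ 0 < e, 0 < K &
  forall t, `|t| < e ->
    (forall x, B x -> `|f (t, x)| <= K /\ `|f (t, x) - f (0, x)| <= K * `|t|) /\
    measurable_fun ((@vec4 R) @^-1` B) (fun u => f (t, vec4 u))].

Definition quadratic f : Prop := exists e K : R, [/\ 0 < e, 0 < K &
  forall t, `|t| < e -> forall x, B x -> `|f (t, x)| <= K * t ^+ 2].

Lemma tame_cst a : tame (fun=> a).
Proof.
exists 1, (`|a| + 1); split=> //.
move=> t _; split=> [x _|]; last exact: measurable_cst.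
by rewrite lerDl ler01 subrr normr0 mulr_ge0// addr_ge0.
Qed.

Lemma tame_add f h : tame f -> tame h -> tame (fun p => f p + h p).
Proof.
move=> [e1 [K1 [e10 K10 f1]]] [e2 [K2 [e20 K20 h2]]].
exists (Num.min e1 e2), (K1 + K2); split; rewrite ?lt_min ?e10 ?e20 ?addr_gt0//.
move=> t; rewrite lt_min => /andP[/f1[fb mf] /h2[hb mh]]; split=> [x Bx|].
  have [f3 f4] := fb x Bx; have [h3 h4] := hb x Bx; split.
    by apply: le_trans (ler_normD _ _) _; exact: lerD.
  by rewrite opprD addrACA mulrDl; apply: le_trans (ler_normD _ _) _; exact: lerD.
exact: measurable_funD.
Qed.

Lemma tame_mul f h : tame f -> tame h -> tame (fun p => f p * h p).
Proof.
move=> [e1 [K1 [e10 K10 f1]]] [e2 [K2 [e20 K20 h2]]].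
exists (Num.min e1 e2), (K1 * K2 + K1 * K2); split; rewrite ?lt_min ?e10 ?e20//.
  by rewrite addr_gt0// mulr_gt0.
have [f0b _] : (forall x, B x -> `|f (0, x)| <= K1 /\ `|f (0, x) - f (0, x)| <= K1 * `|0 : R|) /\ True.
  by split=> //; have [] := f1 0; rewrite ?normr0.
move=> t; rewrite lt_min => /andP[/f1[fb mf] /h2[hb mh]]; split=> [x Bx|].
  have [f3 f4] := fb x Bx; have [h3 h4] := hb x Bx; split.
    rewrite normrM; apply: le_trans (ler_pM _ _ f3 h3) _ => //.
    by rewrite lerDl mulr_ge0// ltW.
  have -> : f (t, x) * h (t, x) - f (0, x) * h (0, x) =
    (f (t, x) - f (0, x)) * h (t, x) + f (0, x) * (h (t, x) - h (0, x)) by ring.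
  apply: le_trans (ler_normD _ _) _; rewrite !normrM mulrDl; apply: lerD.
    by rewrite mulrAC; apply: ler_pM.
  by rewrite -mulrA; apply: ler_pM => //; have [] := f0b x Bx.
exact: measurable_funM.
Qed.

Lemma tame_eq f h :
  (exists2 e : R, 0 < e & forall t x, `|t| < e -> B x -> f (t, x) = h (t, x)) ->
  tame f -> tame h.
Proof.
move=> [e1 e10 fh] [e2 [K [e20 K0 f2]]].
exists (Num.min e1 e2), K; split; rewrite ?lt_min ?e10 ?e20//.
move=> t; rewrite lt_min => /andP[te1 /f2[fb mf]]; split=> [x Bx|].
  by rewrite -!fh ?normr0//; exact: fb.
apply: eq_measurable_fun mf => u; rewrite inE => Bu; exact: fh.
Qed.

Lemma tame_time : tame (fun p => p.1).
Proof.
exists 1, 1; split=> // t t1; split=> [x _|]; last exact: measurable_cst.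
by rewrite subr0 mul1r; split=> //; exact: ltW.
Qed.

(** A function of the point alone does not vary with [t]; its bound comes from the compact set
    [C]. *)
Lemma tame_space (C U : set 'rV[R]_4) (f : 'rV[R]_4 -> R) :
  measurable ((@vec4 R) @^-1` B) -> compact C -> B `<=` C -> C `<=` U -> open U ->
  (forall x, U x -> f @ x --> f x) -> tame (fun p => f p.2).
Proof.
move=> mB cC BC CU oU cf.
have cfC : compact (f @` C).
  apply: continuous_compact => //; apply: continuous_in_subspaceT => x.
  by rewrite inE => /CU; exact: cf.
have [M [_ CM]] := compact_bounded cfC.
exists 1, (`|M| + 1); split=> //.
move=> t _; split=> [x Bx|] /=; last first.
  by apply: measurable_continuous_vec4 oU _ cf => //; exact: subset_trans CU.
split; last by rewrite subrr normr0 mulr_ge0// addr_ge0.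
apply: (CM (`|M| + 1)); first by rewrite ltr_pwDr// ler_norm.
by exists x => //; exact: BC.
Qed.

(** Tameness of the inverse at t = 0 encodes a uniform lower bound on |f(0, x)|; the Lipschitz bound
    in [t] preserves half of it for small [t]. *)
Lemma tame_inv f : tame f -> tame (fun p => (f (0, p.2))^-1) ->
  (forall x, B x -> f (0, x) != 0) -> tame (fun p => (f p)^-1).
Proof.
move=> [e1 [K1 [e10 K10 f1]]] [e2 [K2 [e20 K20 h2]]] f0.
(* Below this threshold the change K1 |t| is at most 1/(2 K2), half of the lower bound 1/K2. *)
pose e := Num.min e1 (2 * K1 * K2)^-1.
have e0 : 0 < e by rewrite lt_min e10 invr_gt0 !mulr_gt0.
have f0b x : B x -> K2^-1 <= `|f (0, x)|.
  move=> Bx; have [/(_ x Bx)[/= + _] _] := h2 0 (eq_ind_r (fun z => z < e2) e20 (normr0 _)).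
  by rewrite normfV -[X in _ <= X -> _]invrK lef_pV2 ?posrE ?invr_gt0// normr_gt0 f0.
have ftb t x : `|t| < e -> B x -> (2 * K2)^-1 <= `|f (t, x)|.
  rewrite lt_min => /andP[te1 te] Bx; have [/(_ x Bx)[_ fl] _] := f1 t te1.
  have lip : K1 * `|t| <= (2 * K2)^-1.
    rewrite -ler_pdivlMl//; apply: le_trans (ltW te) _.
    by rewrite le_eqVlt; apply/orP; left; apply/eqP; field; rewrite !gt_eqF.
  have := f0b x Bx.
  have : `|f (0, x)| <= `|f (t, x)| + `|f (t, x) - f (0, x)|.
    by rewrite -{1}(subKr (f (t, x)) (f (0, x))); apply: le_trans (ler_normB _ _) _.
  have -> : K2^-1 = (2 * K2)^-1 + (2 * K2)^-1 by field; rewrite gt_eqF.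
  lra.
have inv0 : 0 < (2 * K2)^-1 by rewrite invr_gt0 mulr_gt0.
have ftV t x : `|t| < e -> B x -> `|f (t, x)|^-1 <= 2 * K2.
  move=> te Bx; rewrite -[leRHS]invrK lef_pV2 ?posrE//; first exact: ftb.
  exact: lt_le_trans (ftb _ _ te Bx).
exists e, (2 * K2 + K1 * (2 * K2) * (2 * K2)); split=> //.
  by rewrite addr_gt0 ?mulr_gt0.
move=> t te; have te1 : `|t| < e1 by move: te; rewrite lt_min => /andP[].
have [fb mf] := f1 t te1; split=> [x Bx|].
  have [_ fl] := fb x Bx.
  have K3 : 0 <= K1 * (2 * K2) * (2 * K2) by rewrite !mulr_ge0// ltW.
  have K4 : 0 <= 2 * K2 by rewrite mulr_ge0// ltW.
  split; first by rewrite normfV; apply: le_trans (ftV t x te Bx) _; rewrite lerDl.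
  have ft0 : f (t, x) != 0 by rewrite -normr_gt0; exact: lt_le_trans (ftb _ _ te Bx).
  have -> : (f (t, x))^-1 - (f (0, x))^-1 =
     - ((f (t, x) - f (0, x)) * (f (t, x))^-1 * (f (0, x))^-1).
    by field; rewrite ft0 f0.
  rewrite normrN !normrM !normfV.
  apply: (@le_trans _ _ (K1 * (2 * K2) * (2 * K2) * `|t|)); last first.
    by rewrite ler_wpM2r// lerDr.
  have -> : K1 * (2 * K2) * (2 * K2) * `|t| = (K1 * `|t|) * (2 * K2) * (2 * K2) by ring.
  have e00 : `|0 : R| < e by rewrite normr0.
  apply: ler_pM => //; [|exact: ftV].
  apply: ler_pM => //; exact: ftV.
apply: measurable_fun_inv => // u Bu.
by rewrite -normr_gt0; exact: lt_le_trans (ftb _ _ te Bu).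
Qed.

(** Rests on |sqrt a - sqrt b| sqrt b <= |a - b| with b = f(0, x), which is bounded away from 0. *)
Lemma tame_sqrt f : tame f -> tame (fun p => (f (0, p.2))^-1) ->
  (forall x, B x -> 0 < f (0, x)) -> tame (fun p => Num.sqrt (f p)).
Proof.
move=> [e1 [K1 [e10 K10 f1]]] [e2 [K2 [e20 K20 h2]]] f0.
exists e1, (1 + K1 + K1 * Num.sqrt K2); split=> //.
  by rewrite ltr_wpDr// ?mulr_ge0 ?sqrtr_ge0 ?ltW// addr_gt0.
have f0b x : B x -> (Num.sqrt (f (0, x)))^-1 <= Num.sqrt K2.
  move=> Bx; have [/(_ x Bx)[/= + _] _] := h2 0 (eq_ind_r (fun z => z < e2) e20 (normr0 _)).
  by rewrite -sqrtrV ?(ltW (f0 x Bx))// gtr0_norm ?invr_gt0 ?f0// => /ler_wsqrtr.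
move=> t te; have [fb mf] := f1 t te; split=> [x Bx|]; last first.
  apply: (@measurableT_comp _ _ _ _ (measurableTypeR R) (measurableTypeR R) (@Num.sqrt R)) => //.
  by apply: continuous_measurable_fun; exact: sqrt_continuous.
have [fK fl] := fb x Bx; have K3 : 0 <= K1 * Num.sqrt K2 by rewrite mulr_ge0 ?sqrtr_ge0 ?ltW.
split.
  rewrite ger0_norm ?sqrtr_ge0//.
  have : Num.sqrt (f (t, x)) <= 1 + `|f (t, x)|.
    rewrite -[leRHS]ger0_norm ?addr_ge0// -sqrtr_sqr; apply: ler_wsqrtr.
    have := ler_norm (f (t, x)); have := sqr_ge0 `|f (t, x)|; have := normr_ge0 (f (t,x)).
    rewrite sqrrD; lra.
  lra.
apply: (@le_trans _ _ (K1 * Num.sqrt K2 * `|t|)); last first.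
  by rewrite ler_wpM2r// lerDr addr_ge0// ltW.
have s0 : 0 < Num.sqrt (f (0, x)) by rewrite sqrtr_gt0 f0.
have key : `|Num.sqrt (f (t, x)) - Num.sqrt (f (0, x))| * Num.sqrt (f (0, x)) <=
    `|f (t, x) - f (0, x)|.
  (* [Num.sqrt] is 0 at a negative a, where the estimate reads b <= |a - b|. *)
  have [ft|ft] := leP 0 (f (t, x)); last first.
    rewrite (ltr0_sqrtr ft) sub0r normrN gtr0_norm// -expr2 sqr_sqrtr ?(ltW (f0 _ Bx))//.
    by rewrite distrC; apply: le_trans (ler_norm _); rewrite lerBrDl; have := f0 x Bx; lra.
  rewrite -{2}(sqr_sqrtr ft) -{3}(sqr_sqrtr (ltW (f0 x Bx))) subr_sqr normrM.
  rewrite ler_wpM2l// ger0_norm ?addr_ge0 ?sqrtr_ge0//.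
  by rewrite lerDr sqrtr_ge0.
rewrite -ler_pdivlMr// in key; apply: le_trans key _.
by rewrite mulrAC; apply: ler_pM => //; exact: f0b.
Qed.

Lemma tame_gt0 f : tame f -> tame (fun p => (f (0, p.2))^-1) ->
  (forall x, B x -> 0 < f (0, x)) ->
  exists2 e : R, 0 < e & forall t x, `|t| < e -> B x -> 0 < f (t, x).
Proof.
move=> [e1 [K1 [e10 K10 f1]]] [e2 [K2 [e20 K20 h2]]] f0.
have KK : 0 < K1 * K2 by rewrite mulr_gt0.
exists (Num.min e1 (K1 * K2)^-1); first by rewrite lt_min e10 invr_gt0.
move=> t x; rewrite lt_min => /andP[te1 te] Bx.
have [/(_ x Bx)[_ fl] _] := f1 t te1.
have [/(_ x Bx)[/= f0K _] _] := h2 0 (eq_ind_r (fun z => z < e2) e20 (normr0 _)).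
rewrite gtr0_norm ?invr_gt0 ?f0// in f0K.
have f0b : K2^-1 <= f (0, x) by rewrite -[leRHS]invrK lef_pV2 ?posrE ?invr_gt0 ?f0.
have lip : K1 * `|t| < K2^-1.
  by rewrite -ltr_pdivlMl// -invfM.
have := ler_norm (f (0, x) - f (t, x)); rewrite distrC; lra.
Qed.

Lemma quadratic_eq f h :
  (exists2 e : R, 0 < e & forall t x, `|t| < e -> B x -> f (t, x) = h (t, x)) ->
  quadratic f -> quadratic h.
Proof.
move=> [e1 e10 fh] [e2 [K [e20 K0 f2]]].
exists (Num.min e1 e2), K; split; rewrite ?lt_min ?e10 ?e20//.
by move=> t; rewrite lt_min => /andP[te1 te2] x Bx; rewrite -fh//; exact: f2.
Qed.

Lemma quadratic_cst0 : quadratic (fun=> 0).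
Proof. by exists 1, 1; split=> // t _ x _; rewrite normr0 mul1r sqr_ge0. Qed.

Lemma quadratic_add f h : quadratic f -> quadratic h -> quadratic (fun p => f p + h p).
Proof.
move=> [e1 [K1 [e10 K10 f1]]] [e2 [K2 [e20 K20 h2]]].
exists (Num.min e1 e2), (K1 + K2); split; rewrite ?lt_min ?e10 ?e20 ?addr_gt0//.
move=> t; rewrite lt_min => /andP[/f1 fb /h2 hb] x Bx.
by rewrite mulrDl; apply: le_trans (ler_normD _ _) _; apply: lerD; [exact: fb|exact: hb].
Qed.

Lemma quadratic_mul f h : tame f -> tame h ->
  (forall x, B x -> f (0, x) = 0) -> (forall x, B x -> h (0, x) = 0) ->
  quadratic (fun p => f p * h p).
Proof.
move=> [e1 [K1 [e10 K10 f1]]] [e2 [K2 [e20 K20 h2]]] f0 h0.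
exists (Num.min e1 e2), (K1 * K2); split; rewrite ?lt_min ?e10 ?e20 ?mulr_gt0//.
move=> t; rewrite lt_min => /andP[/f1[fb _] /h2[hb _]] x Bx.
have [_ ] := fb x Bx; have [_ ] := hb x Bx; rewrite f0// h0// !subr0 => hb2 fb2.
rewrite normrM (_ : K1 * K2 * t ^+ 2 = (K1 * `|t|) * (K2 * `|t|)); last first.
  by rewrite -(real_normK (num_real t)); ring.
exact: ler_pM.
Qed.

End Perturbation.

(** * Transfer of derivatives between the actions *)

Section Transfer.
Variable R : realType.

(** The existence of the derivative is transferred along with its value. The space variable of
    [quadratic] is a dummy here. *)
Lemma is_derive_quadratic (F1 F2 : R -> R) (l : R) :
  quadratic [set: 'rV[R]_4] (fun p => F2 p.1 - F1 p.1) ->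
  is_derive (0 : R) (1 : R) F1 l -> is_derive (0 : R) (1 : R) F2 l.
Proof.
move=> [e [K [e0 K0 F12]]] [dF1 dF1l].
(* At t = 0 the quadratic bound is 0. *)
have E0 : F2 0 = F1 0.
  have := F12 0; rewrite normr0 => /(_ e0 0 I); rewrite /= expr0n mulr0 normr_le0.
  by rewrite subr_eq0 => /eqP.
have c1 : h^-1 *: (F1 (h *: 1 + 0) - F1 0) @[h --> 0^'] --> l.
  by rewrite -dF1l; exact: dF1.
suff c2 : h^-1 *: (F2 (h *: 1 + 0) - F2 0) @[h --> 0^'] --> l.
  by apply: DeriveDef; [apply/cvg_ex; exists l|exact/cvg_lim].
apply: cvg_sub0 c1; apply/cvgr0Pnorm_le => d d0; near=> h.
have h0 : h != 0 by near: h; exact: nbhs_dnbhs_neq.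
have he : `|h| < e by near: h; exact: dnbhs0_lt.
have hd : `|h| <= d / K by near: h; apply: dnbhs0_le; rewrite divr_gt0.
rewrite [X in `|X| <= _](_ : _ = h^-1 * (F2 h - F1 h)); last first.
  rewrite -[LHS]/(h^-1 *: (F2 (h *: 1 + 0) - F2 0) - h^-1 *: (F1 (h *: 1 + 0) - F1 0)).
  by rewrite addr0 [h *: 1]mulr1 E0 -scalerBr opprB addrA subrK.
rewrite normrM normfV ler_pdivrMl ?normr_gt0//.
apply: le_trans (F12 h he 0 I) _.
rewrite -(real_normK (num_real h)) expr2 mulrCA ler_wpM2l//.
by rewrite mulrC -ler_pdivlMr.
Unshelve. all: by end_near. Qed.

Section Piece.
Variable B : set 'rV[R]_4.
Hypothesis mB : measurable ((@vec4 R) @^-1` B).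
Hypothesis finB : (lebesgue4 ((@vec4 R) @^-1` B) < +oo)%E.

Lemma bounded_integrable (f : 'rV[R]_4 -> R) (K : R) :
  measurable_fun ((@vec4 R) @^-1` B) (fun u => f (vec4 u)) ->
  (forall x, B x -> `|f x| <= K) ->
  (@lebesgue4_measure R).-integrable ((@vec4 R) @^-1` B) (EFin \o (fun u => f (vec4 u))).
Proof.
move=> mf fK; apply: measurable_bounded_integrable => //.
exists K; split; first exact: num_real.
by move=> M KM u Bu; exact: le_trans (fK _ Bu) (ltW KM).
Qed.

(** Each integrand must be integrable on its own for the integrals to be subtracted; tameness makes
    it bounded and measurable on a set of finite measure. *)
Lemma integral4_quadratic (f h : R * 'rV[R]_4 -> R) :
  tame B f -> tame B h -> quadratic B (fun p => f p - h p) ->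
  quadratic [set: 'rV[R]_4] (fun p =>
    integral4 B (fun x => f (p.1, x)) - integral4 B (fun x => h (p.1, x))).
Proof.
move=> [e1 [K1 [e10 K10 f1]]] [e2 [K2 [e20 K20 h2]]] [e3 [K3 [e30 K30 fh]]].
set mu := fine (@lebesgue4_measure R ((@vec4 R) @^-1` B)).
have mu0 : 0 <= mu by rewrite fine_ge0.
(* The summand 1 keeps the constant positive when the piece has measure zero. *)
exists (Num.min e1 (Num.min e2 e3)), (K3 * mu + 1); split.
- by rewrite !lt_min e10 e20 e30.
- by rewrite ltr_wpDl// mulr_ge0// ltW.
move=> t; rewrite !lt_min => /and3P[/f1[fb mf] /h2[hb mh] te3] _ _ /=.
have If := bounded_integrable mf (fun x Bx => (fb x Bx).1).
have Ih := bounded_integrable mh (fun x Bx => (hb x Bx).1).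
have Id : (@lebesgue4_measure R).-integrable ((@vec4 R) @^-1` B)
    (EFin \o (fun u => f (t, vec4 u) - h (t, vec4 u))).
  apply: (bounded_integrable (f := fun x => f (t, x) - h (t, x)) (K := K3 * t ^+ 2)).
    exact: measurable_funB.
  by move=> x Bx; exact: fh.
rewrite !integral4E -RintegralB//.
apply: le_trans (le_normr_Rintegral mB Id) _.
apply: (@le_trans _ _ (\int[@lebesgue4_measure R]_(u in (@vec4 R) @^-1` B) (K3 * t ^+ 2))).
  apply: le_Rintegral => //.
  - apply: (bounded_integrable (f := fun x => `|f (t, x) - h (t, x)|) (K := K3 * t ^+ 2)).
      by apply: measurableT_comp => //; exact: measurable_funB.
    by move=> x Bx; rewrite normr_id; exact: fh.
  - apply: (bounded_integrable (f := fun x => K3 * t ^+ 2) (K := K3 * t ^+ 2)).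
      exact: measurable_cst.
    by move=> x Bx; rewrite ger0_norm// mulr_ge0 ?sqr_ge0// ltW.
  - by move=> u Bu; exact: fh.
rewrite Rintegral_cst// -/mu mulrDl mul1r mulrAC lerDl; exact: sqr_ge0.
Qed.

End Piece.

Lemma integral_on_derive (X : manifold4 R) (D : region X)
    (w1 w2 : R -> chart X -> 'rV[R]_4 -> R) (l : R) :
  (forall i, quadratic [set: 'rV[R]_4] (fun p =>
    integral4 (@piece R X D i) (w2 p.1 (piece_chart i)) -
    integral4 (@piece R X D i) (w1 p.1 (piece_chart i)))) ->
  is_derive (0 : R) (1 : R) (fun t : R => integral_on D (w1 t)) l ->
  is_derive (0 : R) (1 : R) (fun t : R => integral_on D (w2 t)) l.
Proof.
move=> w12; apply: is_derive_quadratic.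
rewrite /integral_on; under eq_fun do rewrite -sumrB.
by apply: closed_sum w12; [exact: quadratic_cst0|exact: quadratic_add].
Qed.

Lemma piece_finite (X : manifold4 R) (D : region X) i :
  (lebesgue4 ((@vec4 R) @^-1` @piece R X D i) < +oo)%E.
Proof.
have [C cC [BC _]] := piece_relcompact i.
exact: lebesgue4_compact_lty (piece_measurable i) cC BC.
Qed.

End Transfer.

(** * Charts and the nonmetricity tensor *)

Section Charts.
Variables (R : realType) (X : manifold4 R).
Implicit Types (c d e : chart X) (x y : 'rV[R]_4).

Lemma cimg_param c x : cimg c x ->
  chart_dom c (chart_param c x) /\ chart_coord c (chart_param c x) = x.
Proof. by move=> [m mc <-]; rewrite chart_coordK ?inE. Qed.

Lemma overlapP c d x : overlap c d x <-> cimg c x /\ chart_dom d (chart_param c x).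
Proof.
split=> [[m [mc md] <-]|[/cimg_param[mc mx] md]].
  by rewrite chart_coordK ?inE//; split=> //; exists m.
by exists (chart_param c x).
Qed.

Lemma cimg_open c : open (cimg c).
Proof. exact: chart_img_open. Qed.

Lemma preimage_param_open c (O : set X) : open O ->
  open (cimg c `&` chart_param c @^-1` O).
Proof.
move=> oO; rewrite openE => x [cx Ox]; apply: filterI.
  by apply: open_near => //; exact: cimg_open.
apply: (@chart_param_continuous R X c x); first by rewrite inE.
exact: open_nbhs_nbhs.
Qed.

Lemma overlap_open c d : open (overlap c d).
Proof.
rewrite (_ : overlap c d = cimg c `&` chart_param c @^-1` chart_dom d).
  by apply: preimage_param_open; exact: chart_dom_open.
by apply/seteqP; split=> x /overlapP.
Qed.

Lemma overlap_cimg c d x : overlap c d x -> cimg c x.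
Proof. by case/overlapP. Qed.

Lemma overlapxx c x : cimg c x -> overlap c c x.
Proof. by move=> cx; apply/overlapP; have [] := cimg_param cx. Qed.

Lemma param_transition c d x : overlap c d x ->
  chart_param d (transition c d x) = chart_param c x.
Proof. by move=> /overlapP[_ dx]; rewrite /transition chart_coordK ?inE. Qed.

Lemma transition_cimg c d x : overlap c d x -> cimg d (transition c d x).
Proof. by move=> /overlapP[_ dx]; exists (chart_param c x). Qed.

Lemma transition_overlap c d e x : overlap c d x -> overlap c e x ->
  overlap d e (transition c d x).
Proof.
move=> cdx cex; apply/overlapP; split; first exact: transition_cimg.
by rewrite param_transition//; case/overlapP: cex.
Qed.

Lemma transition_comp c d e x : overlap c d x ->
  transition d e (transition c d x) = transition c e x.
Proof. by move=> cdx; rewrite {1}/transition param_transition. Qed.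

Lemma transitionxx c x : cimg c x -> transition c c x = x.
Proof. by case/cimg_param. Qed.

Lemma transition_coord_smooth c d a :
  smooth_on (overlap c d) (fun x => transition c d x 0 a).
Proof. exact: transition_smooth. Qed.

Lemma jac_smooth c d a m : smooth_on (overlap c d) (fun x => jac c d x a m).
Proof.
by under eq_fun do rewrite mxE; apply: smooth_on_pd; exact: transition_coord_smooth.
Qed.

Lemma transition_chain_rule c d (V : set 'rV[R]_4) (f : 'rV[R]_4 -> R) x i :
  open V -> V (transition c d x) -> overlap c d x -> smooth_on V f ->
  is_derive x (delta_mx 0 i) (fun y => f (transition c d y))
    (\sum_a pd a f (transition c d x) * jac c d x a i).
Proof.
move=> oV Vx cdx sf; have [D DE] :=
  chain_rule i (@overlap_open c d) oV cdx Vx sf (@transition_coord_smooth c d).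
apply: DeriveDef D _; rewrite DE.
by apply: eq_bigr => a _; rewrite mxE.
Qed.

Lemma jac_comp c d e x : overlap c d x -> overlap c e x ->
  jac c e x = jac d e (transition c d x) *m jac c d x.
Proof.
move=> cdx cex; apply/matrixP => a m; rewrite !mxE.
have dex := transition_overlap cdx cex.
have [_ D] := transition_chain_rule m (@overlap_open d e) dex cdx
  (@transition_coord_smooth d e a).
transitivity (pd m (fun y => transition d e (transition c d y) 0 a) x).
  apply: near_eq_derive; near=> y; rewrite transition_comp//.
  by near: y; exact: (open_near (@overlap_open c d) cdx).
by rewrite [LHS]/pd D; apply: eq_bigr => b _; rewrite !mxE.
Unshelve. all: by end_near. Qed.

Lemma jacxx c x : cimg c x -> jac c c x = 1%:M.
Proof.
move=> cx; apply/matrixP => a m; rewrite !mxE.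
have [_ <-] := is_derive_coord a m x.
apply: near_eq_derive; near=> y; rewrite transitionxx//.
by near: y; exact: (open_near (@cimg_open c) cx).
Unshelve. all: by end_near. Qed.

Lemma jacK c d x : overlap c d x ->
  jac d c (transition c d x) *m jac c d x = 1%:M.
Proof.
move=> cdx; have cx := overlap_cimg cdx.
by rewrite -jac_comp ?jacxx//; exact: overlapxx.
Qed.

Lemma jac_unitmx c d x : overlap c d x -> jac c d x \in unitmx.
Proof. by move=> /jacK/mulmx1_unit[]. Qed.

End Charts.

(** * Tensoriality of the covariant derivative of the metric *)

Section Tensoriality.
Variables (R : realType) (X : manifold4 R).
Variable Gamma : chart X -> 'rV[R]_4 -> tensor3 R.
Hypothesis Gamma_conn : affine_connection Gamma.
Variable g : chart X -> 'rV[R]_4 -> 'M[R]_4.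
Hypothesis g_sym2 : sym2_field g.

Let g_smooth : forall c m n, smooth_on (cimg c) (fun x => g c x m n).
Proof. by case: g_sym2. Qed.

Lemma sym2_congr c d x m n : overlap c d x ->
  g c x m n = \sum_a \sum_b
    jac c d x a m * g d (transition c d x) a b * jac c d x b n.
Proof.
move=> cdx; have [_ _ _ /(_ c d x cdx) ->] := g_sym2; rewrite mxE exchange_big /=.
apply: eq_bigr => b _; rewrite mxE mulr_suml; apply: eq_bigr => a _.
by rewrite mxE.
Qed.

Lemma pd_sym2_congr c d x r m n : overlap c d x ->
  pd r (fun y => g c y m n) x = \sum_a \sum_b
    (pd r (fun y => jac c d y a m) x * g d (transition c d x) a b * jac c d x b n
     + jac c d x a m * (\sum_s pd s (fun y => g d y a b) (transition c d x)
                           * jac c d x s r) * jac c d x b n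
     + jac c d x a m * g d (transition c d x) a b * pd r (fun y => jac c d y b n) x).
Proof.
move=> cdx.
pose F a b y := jac c d y a m * g d (transition c d y) a b * jac c d y b n.
have DF a b : is_derive x (delta_mx 0 r) (F a b)
    (pd r (fun y => jac c d y a m) x * g d (transition c d x) a b * jac c d x b n
     + jac c d x a m * (\sum_s pd s (fun y => g d y a b) (transition c d x)
                           * jac c d x s r) * jac c d x b n
     + jac c d x a m * g d (transition c d x) a b * pd r (fun y => jac c d y b n) x).
  have D1 := smooth_on_derive r (@jac_smooth R X c d a m) cdx.
  have D2 := smooth_on_derive r (@jac_smooth R X c d b n) cdx.
  have D3 := transition_chain_rule r (@cimg_open R X d) (transition_cimg cdx) cdx
    (@g_smooth d a b).
  have D13 := is_deriveM D1 D3.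
  have [D132 DE] := is_deriveM D13 D2.
  apply: DeriveDef; first exact: D132.
  rewrite [LHS]DE /GRing.scale /= ?fctE; ring.
have DS : is_derive x (delta_mx 0 r) (\sum_(a < 4) \sum_(b < 4) F a b) (\sum_a \sum_b
    (pd r (fun y => jac c d y a m) x * g d (transition c d x) a b * jac c d x b n
     + jac c d x a m * (\sum_s pd s (fun y => g d y a b) (transition c d x)
                           * jac c d x s r) * jac c d x b n
     + jac c d x a m * g d (transition c d x) a b * pd r (fun y => jac c d y b n) x)).
  by apply: is_derive_sum => a; exact: is_derive_sum.
case: DS => _ <-; apply: near_eq_derive; near=> y.
rewrite (@sym2_congr c d) ?fct_sumE.
  by apply: eq_bigr => a _; rewrite fct_sumE.
by near: y; exact: (open_near (@overlap_open R X c d) cdx).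
Unshelve. all: by end_near. Qed.

(** Differentiating the congruence law of [g] produces second derivatives of the transition; the
    inhomogeneous term of the connection law produces the same ones, and they cancel. *)
Lemma nabla_congr c d x : overlap c d x ->
  nabla Gamma g c x = move3 (jac c d x)^T (nabla Gamma g d (transition c d x)).
Proof.
move=> cdx; apply: tensor3P => r m n; rewrite {1}/nabla (pd_sym2_congr _ _ _ cdx).
have [_ /(_ c d x cdx) tr] := Gamma_conn.
set J := jac c d x in tr *; set y := transition c d x in tr *.
rewrite -/y; pose gd := g d y; pose Gd := Gamma d y.
(* [K] collects the second derivatives of the transition. *)
pose K a m r := pd r (fun y => jac c d y a m) x.
pose dg s a b := pd s (fun y => g d y a b) y.
have gcE p q : g c x p q = \sum_a \sum_b J a p * gd a b * J b q.
  exact: sym2_congr.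
have Gl p q s : \sum_l Gamma c x l p q * g c x l s = \sum_a \sum_b
    ((\sum_i \sum_e J i p * J e q * Gd a i e) + K a q p) * gd a b * J b s.
  under eq_bigr do rewrite gcE mulr_sumr.
  rewrite exchange_big /=; apply: eq_bigr => a _.
  under eq_bigr do rewrite mulr_sumr.
  rewrite exchange_big /=; apply: eq_bigr => b _.
  rewrite -tr !mulr_suml; apply: eq_bigr => l _; ring.
have Gr p q s : \sum_l Gamma c x l p q * g c x s l = \sum_a \sum_b
    J a s * gd a b * ((\sum_i \sum_e J i p * J e q * Gd b i e) + K b q p).
  under eq_bigr do rewrite gcE mulr_sumr.
  rewrite exchange_big /=; apply: eq_bigr => a _.
  under eq_bigr do rewrite mulr_sumr.
  rewrite exchange_big /=; apply: eq_bigr => b _.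
  rewrite -tr !mulr_sumr; apply: eq_bigr => l _; ring.
rewrite big_split /= Gl Gr -big_split /= -sumrB.
transitivity (\sum_a \sum_b \sum_s J s r * J a m * J b n * dg s a b
   - (\sum_a \sum_b \sum_s \sum_e J s r * J e m * J b n * (Gd a s e * gd a b)
   + \sum_a \sum_b \sum_s \sum_e J s r * J a m * J e n * (Gd b s e * gd a b))).
  rewrite -big_split -sumrB /=; apply: eq_bigr => a _.
  rewrite -!big_split -!sumrB /=; apply: eq_bigr => b _.
  have -> : \sum_s \sum_e J s r * J e m * J b n * (Gd a s e * gd a b) =
      (\sum_i \sum_e J i r * J e m * Gd a i e) * gd a b * J b n.
    rewrite !mulr_suml; apply: eq_bigr => s _; rewrite !mulr_suml.
    by apply: eq_bigr => e _; ring.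
  have -> : \sum_s \sum_e J s r * J a m * J e n * (Gd b s e * gd a b) =
      J a m * gd a b * (\sum_i \sum_e J i r * J e n * Gd b i e).
    rewrite !mulr_sumr; apply: eq_bigr => s _; rewrite !mulr_sumr.
    by apply: eq_bigr => e _; ring.
  have -> : \sum_s J s r * J a m * J b n * dg s a b =
      J a m * (\sum_s dg s a b * J s r) * J b n.
    by rewrite mulr_sumr mulr_suml; apply: eq_bigr => s _; ring.
  (* The terms in [K] cancel between the partial derivative and the two connection terms. *)
  rewrite -/(K a m r) -/(K b n r) /dg -/gd; ring.
rewrite /move3 /nabla -/y.
(* Summation indices are renamed so that the contracted index is innermost, as in [nabla]. *)
have -> : \sum_a \sum_b \sum_s \sum_e J s r * J e m * J b n * (Gd a s e * gd a b) =
    \sum_s \sum_a \sum_b \sum_l J s r * J a m * J b n * (Gd l s a * gd l b).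
  under eq_bigr do rewrite exchange_big /=.
  rewrite exchange_big /=; apply: eq_bigr => s _.
  under eq_bigr do rewrite exchange_big /=.
  rewrite exchange_big /=; apply: eq_bigr => e _.
  by rewrite exchange_big /=.
have -> : \sum_a \sum_b \sum_s \sum_e J s r * J a m * J e n * (Gd b s e * gd a b) =
    \sum_s \sum_a \sum_b \sum_l J s r * J a m * J b n * (Gd l s b * gd a l).
  under eq_bigr do rewrite exchange_big /=.
  rewrite exchange_big /=; apply: eq_bigr => s _; apply: eq_bigr => a _.
  by rewrite exchange_big /=.
have -> : \sum_a \sum_b \sum_s J s r * J a m * J b n * dg s a b =
    \sum_s \sum_a \sum_b J s r * J a m * J b n * dg s a b.
  under eq_bigr do rewrite exchange_big /=.
  by rewrite exchange_big /=.
rewrite -big_split -sumrB /=; apply: eq_bigr => s _.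
rewrite -big_split -sumrB /=; apply: eq_bigr => a _.
rewrite -big_split -sumrB /=; apply: eq_bigr => b _.
rewrite !mxE mulrBr mulr_sumr -big_split /=; congr (_ - _).
by apply: eq_bigr => l _; rewrite -/gd -/Gd; ring.
Qed.

End Tensoriality.

(** * Smoothness of the inverse metric and of the volume factor *)

Section SmoothMetric.
Variable R : realType.
Implicit Types (U : set 'rV[R]_4).

Lemma invmxE n (A : 'M[R]_n) i j : A \in unitmx ->
  invmx A i j = (\det A)^-1 * (\adj A) i j.
Proof. by move=> Au; rewrite /invmx Au mxE. Qed.

Lemma smooth_on_det U n (A : 'rV[R]_4 -> 'M[R]_n) : open U ->
  (forall i j, smooth_on U (fun x => A x i j)) -> smooth_on U (fun x => \det (A x)).
Proof.
move=> oU; apply: closed_det => [a|f h|f h].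
- exact: smooth_on_cst.
- exact: smooth_on_add.
- exact: smooth_on_mul.
Qed.

Lemma smooth_on_invmx U n (A : 'rV[R]_4 -> 'M[R]_n) i j : open U ->
  (forall x, U x -> A x \in unitmx) ->
  (forall i j, smooth_on U (fun x => A x i j)) ->
  smooth_on U (fun x => invmx (A x) i j).
Proof.
move=> oU Au sA.
apply: (@smooth_on_eq _ _ (fun x => (\det (A x))^-1 * (\adj (A x)) i j)) => //.
  by move=> x Ux; rewrite invmxE// Au.
apply: smooth_on_mul => //; last first.
  apply: closed_adj sA => [a|f h|f h].
  - exact: smooth_on_cst.
  - exact: smooth_on_add.
  - exact: smooth_on_mul.
apply: smooth_on_inv => //; last exact: smooth_on_det.
by move=> x /Au; rewrite unitmxE unitfE.
Qed.

Lemma smooth_on_sqrtmdet U (A : 'rV[R]_4 -> 'M[R]_4) : open U ->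
  (forall x, U x -> 0 < - \det (A x)) ->
  (forall i j, smooth_on U (fun x => A x i j)) -> smooth_on U (fun x => sqrtmdet (A x)).
Proof.
move=> oU A0 sA; apply: smooth_on_sqrt => //.
under eq_fun do rewrite -mulN1r; apply: smooth_on_mul => //.
  exact: smooth_on_cst.
exact: smooth_on_det.
Qed.

Lemma sqrtmdet_gt0 (g : 'M[R]_4) : (0 < sqrtmdet g) = (0 < - \det g).
Proof. exact: sqrtr_gt0. Qed.

End SmoothMetric.

(** * The Legendre momentum as a smooth density *)

Section LegendreField.
Variables (R : realType) (kappa2 : R) (X : manifold4 R).
Variable Gamma : chart X -> 'rV[R]_4 -> tensor3 R.
Hypothesis Gamma_conn : affine_connection Gamma.

Lemma nabla_smooth g c r m n : sym2_field g ->
  smooth_on (cimg c) (fun x => nabla Gamma g c x r m n).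
Proof.
move=> [gs _ _ _]; have [Gs _] := Gamma_conn; have oU := @cimg_open R X c.
rewrite /nabla; apply: smooth_on_add => //; first exact: smooth_on_pd.
under eq_fun do rewrite -mulN1r; apply: smooth_on_mul => //; first exact: smooth_on_cst.
by apply: smooth_on_sum => // l; apply: smooth_on_add => //; apply: smooth_on_mul.
Qed.

Lemma nabla_sym3 g c x : sym2_field g -> sym3 (nabla Gamma g c x).
Proof.
move=> [_ _ gT _] r m n.
have gC y i j : g c y i j = g c y j i by rewrite -[in LHS](gT c y) mxE.
rewrite /nabla; congr (_ - _).
  by congr (pd r _ x); apply/funext => y.
by apply: eq_bigr => l _; rewrite addrC (gC x m l) (gC x l n).
Qed.

Lemma legendre_field_density g : lorentz_metric g ->
  density3_field (legendre_field kappa2 Gamma g).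
Proof.
move=> [gf gL]; have [gs g0 gT gJ] := gf.
have gu c x : cimg c x -> g c x \in unitmx by move=> /gL/lorentzian_unitmx.
have hY c x : sym3 (nabla Gamma g c x) by exact: nabla_sym3.
split.
- move=> c r m n; have oU := @cimg_open R X c.
  (* Smoothness is read off the closed formula, which agrees with the definition by [derive1] on the
     image of the chart. *)
  apply: (@smooth_on_eq _ _ (fun x => (- (2 / kappa2) * sqrtmdet (g c x)) *
     move3 (invmx (g c x)) (nonmet_op (g c x) (nabla Gamma g c x)) r m n)) => //.
    by move=> x cx; rewrite /legendre_field mem_set// legendreE// gu.
  apply: (@closed_legendre_formula _ _ (smooth_on (cimg c))).
  - by move=> a; exact: smooth_on_cst.
  - by move=> f h; exact: smooth_on_add.
  - by move=> f h; exact: smooth_on_mul.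
  - exact: gs.
  - by move=> i j; apply: smooth_on_invmx => // x; exact: gu.
  - apply: smooth_on_mul => //; first exact: smooth_on_cst.
    apply: smooth_on_sqrtmdet => // x /gL/lorentzian_sqrtmdet.
    by rewrite sqrtmdet_gt0.
  - by move=> a b e; exact: nabla_smooth.
- by move=> c x cx r m n; rewrite /legendre_field memNset.
- move=> c x; rewrite /legendre_field; case: ifP => // /set_mem cx.
  exact: legendre_sym3 (gT c x) (gu c x cx) _ _ (hY c x).
move=> c d x cdx a b e.
have cx := overlap_cimg cdx; have dy := transition_cimg cdx.
rewrite /legendre_field mem_set// mem_set//.
rewrite (legendre_congr (gT d _) (gu d _ dy) (jac_unitmx cdx) (gJ c d x cdx))//.
by rewrite (nabla_congr Gamma_conn gf cdx).
Qed.

End LegendreField.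

(** * Comparison of the two actions *)

Section Comparison.
Variables (R : realType) (kappa2 : R).
Hypothesis kappa2_gt0 : 0 < kappa2.
Variables (B C U : set 'rV[R]_4).
Hypothesis mB : measurable ((@vec4 R) @^-1` B).
Hypothesis cC : compact C.
Hypothesis BC : B `<=` C.
Hypothesis CU : C `<=` U.
Hypothesis oU : open U.
Variables (g h : 'rV[R]_4 -> 'M[R]_4) (Y Z P p : 'rV[R]_4 -> tensor3 R).
Hypothesis g_smooth : forall i j, smooth_on U (fun x => g x i j).
Hypothesis h_smooth : forall i j, smooth_on U (fun x => h x i j).
Hypothesis Y_smooth : forall a b e, smooth_on U (fun x => Y x a b e).
Hypothesis Z_smooth : forall a b e, smooth_on U (fun x => Z x a b e).
Hypothesis P_smooth : forall a b e, smooth_on U (fun x => P x a b e).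
Hypothesis p_smooth : forall a b e, smooth_on U (fun x => p x a b e).
Hypothesis g_sym : forall x, (g x)^T = g x.
Hypothesis h_sym : forall x, (h x)^T = h x.
Hypothesis Y_sym : forall x, sym3 (Y x).
Hypothesis Z_sym : forall x, sym3 (Z x).
Hypothesis P_sym : forall x, sym3 (P x).
Hypothesis p_sym : forall x, sym3 (p x).
Hypothesis g_vol : forall x, U x -> 0 < - \det (g x).
Hypothesis P_legendre : forall x, U x -> P x = legendre kappa2 (g x) (Y x).

Let gt (q : R * 'rV[R]_4) := g q.2 + q.1 *: h q.2.
Let Yt (q : R * 'rV[R]_4) := lin3 q.1 (Z q.2) (Y q.2).
Let Pt (q : R * 'rV[R]_4) := lin3 q.1 (p q.2) (P q.2).
Let BU : B `<=` U. Proof. exact: subset_trans CU. Qed.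

(** [Y] and [Z] stand for the covariant derivatives of [g] and [h]; taking them as given fields
    makes the comparison fibrewise over one chart image. *)
Definition lagrangian_path q := lagrangian kappa2 (gt q) (Yt q).
Definition hamiltonian_path q :=
  contract3 (Pt q) (Yt q) - hamiltonian kappa2 (gt q) (Pt q).

Let tame_smooth f : smooth_on U f -> tame B (fun q => f q.2).
Proof.
move=> sf; apply: tame_space mB cC BC CU oU _ => x Ux.
exact: smooth_on_continuous sf Ux.
Qed.

Let tame_path (f0 f1 : 'rV[R]_4 -> R) : smooth_on U f0 -> smooth_on U f1 ->
  tame B (fun q => f0 q.2 + q.1 * f1 q.2).
Proof.
move=> s0 s1; apply: tame_add; first exact: tame_smooth.
by apply: tame_mul; [exact: tame_time|exact: tame_smooth].
Qed.

Let tame_g i j : tame B (fun q => gt q i j).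
Proof.
have -> : (fun q => gt q i j) = (fun q => g q.2 i j + q.1 * h q.2 i j).
  by apply/funext => q; rewrite /gt !mxE.
exact: (tame_path (f0 := fun x => g x i j) (f1 := fun x => h x i j)).
Qed.

Let tame_lin (V W : 'rV[R]_4 -> tensor3 R) a b e :
  (forall a b e, smooth_on U (fun x => V x a b e)) ->
  (forall a b e, smooth_on U (fun x => W x a b e)) ->
  tame B (fun q => lin3 q.1 (W q.2) (V q.2) a b e).
Proof.
move=> sV sW.
have -> : (fun q => lin3 q.1 (W q.2) (V q.2) a b e) =
    (fun q => V q.2 a b e + q.1 * W q.2 a b e).
  by apply/funext => q; rewrite /lin3 addrC.
exact: (tame_path (f0 := fun x => V x a b e) (f1 := fun x => W x a b e)).
Qed.

Let tame_Y a b e : tame B (fun q => Yt q a b e). Proof. exact: tame_lin. Qed.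
Let tame_P a b e : tame B (fun q => Pt q a b e). Proof. exact: tame_lin. Qed.

Let vol (q : R * 'rV[R]_4) := - \det (gt q).

Let gt0 x : gt (0, x) = g x. Proof. by rewrite /gt scale0r addr0. Qed.

Let tame_vol : tame B vol.
Proof.
rewrite /vol; under eq_fun do rewrite -mulN1r.
apply: tame_mul; first exact: tame_cst.
by apply: closed_det tame_g => [a||]; [exact: tame_cst|exact: tame_add|exact: tame_mul].
Qed.

Let tame_vol0V : tame B (fun q => (vol (0, q.2))^-1).
Proof.
have -> : (fun q : R * 'rV[R]_4 => (vol (0, q.2))^-1) = (fun q => (- \det (g q.2))^-1).
  by apply/funext => q; rewrite /vol gt0.
apply: (tame_smooth (f := fun x => (- \det (g x))^-1)); apply: smooth_on_inv => //.
  by move=> x /g_vol/lt0r_neq0.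
under eq_fun do rewrite -mulN1r; apply: smooth_on_mul => //.
  exact: smooth_on_cst.
exact: smooth_on_det.
Qed.

Let vol0_gt0 x : B x -> 0 < vol (0, x).
Proof. by move=> /BU Ux; rewrite /vol gt0; exact: g_vol. Qed.

Let vol_gt0 : exists2 e : R, 0 < e & forall t x, `|t| < e -> B x -> 0 < vol (t, x).
Proof. exact: tame_gt0. Qed.

Let gt_unit q : 0 < vol q -> gt q \in unitmx.
Proof. by rewrite /vol oppr_gt0 unitmxE unitfE => /ltr0_neq0. Qed.

Let gt_sym q : (gt q)^T = gt q.
Proof. by rewrite /gt linearD linearZ /= g_sym h_sym. Qed.

Let tame_volV : tame B (fun q => (vol q)^-1).
Proof. by apply: tame_inv => // x /vol0_gt0/lt0r_neq0. Qed.

Let tame_s : tame B (fun q => sqrtmdet (gt q)).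
Proof. exact: (tame_sqrt tame_vol tame_vol0V vol0_gt0). Qed.

(** Written as sqrt(v) / v, which needs only the inverse of the polynomial [vol]. *)
Let tame_sV : tame B (fun q => (sqrtmdet (gt q))^-1).
Proof.
apply: (tame_eq (f := fun q => sqrtmdet (gt q) * (vol q)^-1)); last exact: tame_mul.
have [e e0 ve] := vol_gt0; exists e => // t x te Bx; have v0 := ve t x te Bx.
rewrite -[X in _ * X^-1](sqr_sqrtr (ltW v0)) -/(sqrtmdet _) expr2.
by field; rewrite gt_eqF// sqrtmdet_gt0.
Qed.

Let tame_G i j : tame B (fun q => invmx (gt q) i j).
Proof.
apply: (tame_eq (f := fun q => (-1 * (vol q)^-1) * (\adj (gt q)) i j)).
  have [e e0 ve] := vol_gt0; exists e => // t x te Bx.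
  by rewrite invmxE ?gt_unit ?ve// /vol mulN1r invrN opprK.
apply: tame_mul; first by apply: tame_mul => //; exact: tame_cst.
by apply: closed_adj tame_g => [a||]; [exact: tame_cst|exact: tame_add|exact: tame_mul].
Qed.

(** The defect of [Pt] from the Legendre momentum, in closed form. This expression is tame as it
    stands; it is identified with [legendre] only where [vol] is positive. *)
Let W q : tensor3 R := fun a b e => Pt q a b e +
  (- 1 * (- (2 / kappa2) * sqrtmdet (gt q))) *
    move3 (invmx (gt q)) (nonmet_op (gt q) (Yt q)) a b e.

Let tame_W a b e : tame B (fun q => W q a b e).
Proof.
apply: tame_add => //.
apply: (@closed_legendre_formula _ _ (tame B)) => //.
- exact: tame_cst.
- exact: tame_add.
- exact: tame_mul.
- by apply: tame_mul; [exact: tame_cst|apply: tame_mul => //; exact: tame_cst].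
Qed.

Let WE q : 0 < vol q -> W q = lin3 (-1) (legendre kappa2 (gt q) (Yt q)) (Pt q).
Proof.
move=> vq; have hY : sym3 (Yt q) by exact: lin3_sym3.
rewrite (legendreE (gt_sym q) (gt_unit vq))//.
by apply: tensor3P => a b e; rewrite /W /lin3; ring.
Qed.

Let W_sym q : 0 < vol q -> sym3 (W q).
Proof.
move=> vq; rewrite WE//; apply: lin3_sym3; last exact: lin3_sym3.
by apply: legendre_sym3; [exact: gt_sym|exact: gt_unit|exact: lin3_sym3].
Qed.

Let W0 x : B x -> W (0, x) = zero3 R.
Proof.
move=> Bx; rewrite WE ?vol0_gt0// gt0 /Pt /Yt /=.
have lin0 (V V' : tensor3 R) : lin3 0 V V' = V'.
  by apply: tensor3P => a b e; rewrite /lin3 mul0r add0r.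
rewrite !lin0 P_legendre; last exact: BU.
by apply: tensor3P => a b e; rewrite /lin3 /zero3 mulN1r addNr.
Qed.

Let hW q := ham_grad (gt q) kappa2 (W q).

Let tame_hW a b e : tame B (fun q => hW q a b e).
Proof.
apply: (@closed_ham_grad _ _ (tame B)) => //.
- exact: tame_cst.
- exact: tame_add.
- exact: tame_mul.
Qed.

Let hW0 x : B x -> hW (0, x) = zero3 R.
Proof.
move=> Bx; rewrite /hW W0//; apply: tensor3P => a b e.
by rewrite /ham_grad move3_zero3 /lin3 ham_opE /metric_first /metric_last
  !trace3_zero3 !trace3t_zero3 /cyc_sym /zero3; ring.
Qed.

(** Minus the Hamiltonian of the defect, written by Euler's identity as a contraction of [W] with
    [hW]: both vanish at t = 0, so it is of order t^2. *)
Let gap q := - 2^-1 * contract3 (W q) (hW q).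

Let pathE : exists2 e : R, 0 < e & forall t x, `|t| < e -> B x ->
  hamiltonian_path (t, x) = lagrangian_path (t, x) + gap (t, x).
Proof.
have [e e0 ve] := vol_gt0; exists e => // t x te Bx; have vq := ve t x te Bx.
have hY : sym3 (Yt (t, x)) by exact: lin3_sym3.
have hP : sym3 (Pt (t, x)) by exact: lin3_sym3.
have gsym := gt_sym (t, x); have gunit := gt_unit vq.
have gvol : 0 < sqrtmdet (gt (t, x)) by rewrite sqrtmdet_gt0.
rewrite /hamiltonian_path (hamiltonian_shift gsym gunit gvol kappa2_gt0)//.
rewrite -WE// hamiltonian_ham_grad//; last exact: W_sym.
by rewrite /gap mulNr.
Qed.

Lemma tame_lagrangian_path : tame B lagrangian_path.
Proof.
apply: tame_mul; first by apply: tame_mul => //; exact: tame_cst.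
apply: (@closed_nonmetricity_scalar _ _ (tame B)) => //.
- exact: tame_cst.
- exact: tame_add.
- exact: tame_mul.
Qed.

Lemma tame_hamiltonian_path : tame B hamiltonian_path.
Proof.
(* Going through the Lagrangian and the gap avoids expanding the Hamiltonian. *)
apply: (tame_eq (f := fun q => lagrangian_path q + gap q)).
  by have [e e0 E] := pathE; exists e => // t x te Bx; rewrite E.
apply: tame_add; first exact: tame_lagrangian_path.
apply: tame_mul; first exact: tame_cst.
apply: (@closed_contract3 _ _ (tame B)) => //.
- exact: tame_cst.
- exact: tame_add.
- exact: tame_mul.
Qed.

(** The factor [s] will be 1 or -1, to compare the actions in both directions. *)
Lemma quadratic_gap (s : R) :
  quadratic B (fun q => s * (hamiltonian_path q - lagrangian_path q)).
Proof.
apply: (quadratic_eq (f := fun q => \sum_a \sum_b \sum_e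
    (s * - 2^-1 * W q a b e) * hW q a b e)).
  have [e e0 E] := pathE; exists e => // t x te Bx; rewrite E// addrAC subrr add0r.
  rewrite /gap /contract3 mulrA mulr_sumr; apply: eq_bigr => a _.
  rewrite mulr_sumr; apply: eq_bigr => b _; rewrite mulr_sumr.
  by apply: eq_bigr => c _; rewrite mulrA.
do 3![apply: closed_sum => [||?]; [exact: quadratic_cst0|exact: quadratic_add|]].
apply: quadratic_mul => //.
- by apply: tame_mul => //; exact: tame_cst.
- by move=> x Bx; rewrite W0// mulr0.
- by move=> x Bx; rewrite hW0.
Qed.

End Comparison.

(** * Variation of the momentum *)

Section BumpDensity.
Variables (R : realType) (X : manifold4 R).

Definition cube (a : 'rV[R]_4) (r : R) : set 'rV[R]_4 :=
  [set x | forall i, `|x 0 i - a 0 i| <= r].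

Lemma cube_compact a r : compact (cube a r).
Proof.
have -> : cube a r =
    [set v : 'rV[R]_4 | forall i, v ord0 i \in `[a 0 i - r, a 0 i + r]].
  by apply/seteqP; split=> x h i; have := h i; rewrite in_itv /= ler_distl.
apply: (@rV_compact _ _ (fun i => `[a 0 i - r, a 0 i + r]%classic)) => i.
exact: segment_compact.
Qed.

Lemma cube_near a (P : 'rV[R]_4 -> Prop) : (\forall x \near a, P x) ->
  exists2 r : R, 0 < r & forall x, cube a r x -> P x.
Proof.
move=> /nbhs_ballP[e /= e0 eP]; exists (e / 2); first by rewrite divr_gt0.
move=> x xr; apply: eP; rewrite -ball_normE /ball_ /=.
apply: le_lt_trans (_ : e / 2 < e); last by rewrite ltr_pdivrMr// ltr_pMr// ltr1n.
apply: mx_norm_le => [|i]; first by rewrite divr_ge0// ltW.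
by rewrite !mxE distrC; exact: xr.
Qed.

(** The tensor [chi W] is carried to the other charts by the density law and extended by zero. Its
    support is contained in a compact set, closed since the manifold is Hausdorff, so the extension
    is smooth across the edge of the chart domain. *)
Lemma bump_density (c : chart X) (a : 'rV[R]_4) (r : R)
    (chi : 'rV[R]_4 -> R) (W : tensor3 R) :
  cube a r `<=` cimg c -> sym3 W ->
  (forall (U : set 'rV[R]_4) (T : 'rV[R]_4 -> 'rV[R]_4), open U ->
     (forall i, smooth_on U (fun x => T x 0 i)) -> smooth_on U (fun x => chi (T x))) ->
  (forall x, chi x != 0 -> cube a r x) ->
  exists2 p, density3_field p &
    forall x, cimg c x -> p c x = fun i j k => chi x * W i j k.
Proof.
move=> rc hW chi_smooth chi_supp.
pose S d x : tensor3 R := fun i j k => chi (transition d c x) * W i j k.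
(* This is the density law read from [c] back to [d], hence the inverse Jacobian and the determinant
   in the numerator. *)
pose q d x : tensor3 R := fun i j k =>
  `|\det (jac d c x)| * move3 (invmx (jac d c x)) (S d x) i j k.
pose p d x : tensor3 R := if x \in overlap d c then q d x else zero3 R.
have hS d x : sym3 (S d x) by move=> i j k; rewrite /S hW.
have hq d x : sym3 (q d x).
  by move=> i j k; rewrite /q; congr (_ * _); exact: move3_sym3.
pose K := chart_param c @` cube a r.
have cK : closed K.
  apply: compact_closed; first exact: manifold_hausdorff.
  apply: continuous_compact; last exact: cube_compact.
  apply: continuous_in_subspaceT => x; rewrite inE => /rc cx.
  by apply: (@chart_param_continuous R X c); rewrite inE.
exists p; last first.
  move=> x cx; apply: tensor3P => i j k; rewrite /p mem_set; last exact: overlapxx.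
  by rewrite /q jacxx// det1 normr1 mul1r invmx1 move3_1 /S transitionxx.
split.
- move=> d i j k; apply: smooth_on_local => x dx.
  have [cx|ncx] := pselect (chart_dom c (chart_param d x)).
    exists (overlap d c); split; [exact: overlap_open|exact/overlapP|].
    have oV := @overlap_open R X d c.
    apply: (@smooth_on_eq _ _ (fun x => q d x i j k)) => //.
      by move=> y dcy; rewrite /p mem_set.
    apply: smooth_on_mul => //.
      apply: smooth_on_norm => //.
        by move=> y /jac_unitmx; rewrite unitmxE unitfE.
      by apply: smooth_on_det => // m n; exact: jac_smooth.
    apply: closed_move3.
    + by move=> b; exact: smooth_on_cst.
    + by move=> f h; exact: smooth_on_add.
    + by move=> f h; exact: smooth_on_mul.
    + move=> m n; apply: smooth_on_invmx => //; first by move=> y /jac_unitmx.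
      by move=> m' n'; exact: jac_smooth.
    + move=> m n l; apply: smooth_on_mul => //; last exact: smooth_on_cst.
      by apply: chi_smooth => // b; exact: transition_coord_smooth.
  (* At a point outside the domain of [c], the complement of the closed set [K] gives a
     neighbourhood on which the density vanishes. *)
  pose V := cimg d `&` chart_param d @^-1` (~` K).
  have oV : open V by apply: preimage_param_open; exact: closed_openC.
  exists V; split=> //.
    split=> //= -[y ry yx]; apply: ncx; rewrite -yx.
    by have [] := cimg_param (rc _ ry).
  apply: (@smooth_on_eq _ _ (fun=> 0)) => //; last exact: smooth_on_cst.
  move=> y [dy nK]; rewrite /p; case: ifP => // /set_mem dcy.
  have chi0 : chi (transition d c y) = 0.
    apply/eqP/negP => /negP/chi_supp ry; apply: nK.
    by exists (transition d c y) => //; rewrite param_transition.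
  rewrite /q (_ : S d y = zero3 R) ?move3_zero3 ?mulr0//.
  by apply: tensor3P => m n l; rewrite /S chi0 mul0r.
- move=> d x ndx i j k; rewrite /p; case: ifP => // /set_mem/overlap_cimg.
  by move=> /ndx.
- by move=> d x; rewrite /p; case: ifP.
move=> d e x dex i j k; rewrite -/(move3 (jac d e x) (p d x) i j k).
have ux := jac_unitmx dex.
have J0 : `|\det (jac d e x)| != 0 by rewrite normr_eq0 -unitfE -unitmxE.
rewrite /p; have [dcx|ndcx] := pselect (overlap d c x); last first.
  rewrite (memNset ndcx) memNset ?move3_zero3 ?mulr0//.
  move=> /overlapP[_]; rewrite param_transition// => cx; apply: ndcx.
  by apply/overlapP; split=> //; exact: overlap_cimg dex.
have ecy := transition_overlap dex dcx.
rewrite (mem_set dcx) (mem_set ecy).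
have qE : q d x = lin3 (`|\det (jac d c x)|) (move3 (invmx (jac d c x)) (S d x)) (zero3 R).
  by apply: tensor3P => a' b' e'; rewrite /lin3 addr0.
rewrite qE move3_lin3 move3_zero3 move3_comp /lin3 addr0.
have uy := jac_unitmx ecy.
have JE := jac_comp dex dcx.
(* The cocycle identity turns the transport from [c] through [d] to [e] into the direct one. *)
have -> : jac d e x *m invmx (jac d c x) = invmx (jac e c (transition d e x)).
  apply: (can_inj (mulmxK (jac_unitmx dcx))).
  by rewrite -mulmxA mulVmx ?jac_unitmx// mulmx1 JE mulmxA mulVmx// mul1mx.
rewrite /q /S transition_comp// JE det_mulmx normrM.
by rewrite -mulrA (mulrCA `|\det (jac d e x)|^-1) mulKf.
Qed.

End BumpDensity.

(** * First variations of the two actions *)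

Section Variation.
Variables (R : realType) (kappa2 : R) (X : manifold4 R).
Hypothesis kappa2_gt0 : 0 < kappa2.
Variable Gamma : chart X -> 'rV[R]_4 -> tensor3 R.
Hypothesis Gamma_conn : affine_connection Gamma.

Lemma eq_integral4 (B : set 'rV[R]_4) (f h : 'rV[R]_4 -> R) :
  (forall x, B x -> f x = h x) -> integral4 B f = integral4 B h.
Proof.
by move=> fh; rewrite !integral4E; apply: eq_Rintegral => u; rewrite inE => /fh.
Qed.

Lemma nabla_path g h c x t : sym2_field g -> sym2_field h -> cimg c x ->
  nabla Gamma (fun c x => g c x + t *: h c x) c x =
  lin3 t (nabla Gamma h c x) (nabla Gamma g c x).
Proof.
move=> [gs _ _ _] [hs _ _ _] cx; apply: tensor3P => r m n.
have D : is_derive x (delta_mx 0 r) (fun y => (g c y + t *: h c y) m n)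
    (pd r (fun y => g c y m n) x + t * pd r (fun y => h c y m n) x).
  have -> : (fun y => (g c y + t *: h c y) m n) =
      (fun y => g c y m n) + t *: (fun y => h c y m n).
    by apply/funext => y; rewrite !mxE.
  apply: is_deriveD; first exact: smooth_on_derive (gs c m n) cx.
  by apply: is_deriveZ; exact: smooth_on_derive (hs c m n) cx.
case: D => _ D; rewrite /nabla {1}/pd D /lin3 mulrBr mulr_sumr addrACA -opprD.
rewrite [X in _ = _ - X]addrC -big_split /= addrC; congr (_ - _).
by apply: eq_bigr => l _; rewrite !mxE; ring.
Qed.

Lemma piece_gap (D : region X) (i : 'I_(npieces D)) g h p (s : R) :
  lorentz_metric g -> sym2_field h -> density3_field p ->
  let c := piece_chart i in
  let w1 t := lagrangian kappa2 (g c t.2 + t.1 *: h c t.2)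
    (nabla Gamma (fun c x => g c x + t.1 *: h c x) c t.2) in
  let w2 t := contract3
      (fun r m n => legendre_field kappa2 Gamma g c t.2 r m n + t.1 * p c t.2 r m n)
      (nabla Gamma (fun c x => g c x + t.1 *: h c x) c t.2)
    - hamiltonian kappa2 (g c t.2 + t.1 *: h c t.2)
      (fun r m n => legendre_field kappa2 Gamma g c t.2 r m n + t.1 * p c t.2 r m n) in
  [/\ tame (@piece R X D i) w1, tame (@piece R X D i) w2 &
      quadratic (@piece R X D i) (fun t => s * (w2 t - w1 t))].
Proof.
move=> gl hf [ps _ p_sym _] c w1 w2; have [gf gL] := gl.
have [gs _ gT _] := gf; have [hs _ hT _] := hf.
have [C cC [BC CU]] := piece_relcompact i.
have [Ls _ L_sym _] := legendre_field_density kappa2 Gamma_conn gl.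
have mB := @piece_measurable R X D i.
have oU := @cimg_open R X c.
have Ys a b e : smooth_on (cimg c) (fun x => nabla Gamma g c x a b e).
  exact: nabla_smooth.
have Zs a b e : smooth_on (cimg c) (fun x => nabla Gamma h c x a b e).
  exact: nabla_smooth.
have Ysym x : sym3 (nabla Gamma g c x) by exact: nabla_sym3.
have Zsym x : sym3 (nabla Gamma h c x) by exact: nabla_sym3.
have gv x : cimg c x -> 0 < - \det (g c x).
  by move=> /gL/lorentzian_sqrtmdet; rewrite sqrtmdet_gt0.
have PL x : cimg c x ->
    legendre_field kappa2 Gamma g c x = legendre kappa2 (g c x) (nabla Gamma g c x).
  by move=> cx; rewrite /legendre_field mem_set.
have E1 t x : piece i x -> lagrangian_path kappa2 (g c) (h c) (nabla Gamma g c)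
    (nabla Gamma h c) (t, x) = w1 (t, x).
  by move=> /BC/CU cx; rewrite /w1 /= nabla_path.
have E2 t x : piece i x -> hamiltonian_path kappa2 (g c) (h c) (nabla Gamma g c)
    (nabla Gamma h c) (legendre_field kappa2 Gamma g c) (p c) (t, x) = w2 (t, x).
  move=> /BC/CU cx; rewrite /w2 /= nabla_path// /hamiltonian_path /=.
  have -> // : lin3 t (p c x) (legendre_field kappa2 Gamma g c x) =
    (fun r m n => legendre_field kappa2 Gamma g c x r m n + t * p c x r m n).
  by apply: tensor3P => a b e; rewrite /lin3 addrC.
have T1 := tame_lagrangian_path kappa2 mB cC BC CU oU (gs c) (hs c) Ys Zs gv.
have T2 := tame_hamiltonian_path kappa2_gt0 mB cC BC CU oU (gs c) (hs c) Ys Zs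
  (Ls c) (ps c) (gT c) (hT c) Ysym Zsym (L_sym c) (p_sym c) gv.
have T3 := quadratic_gap kappa2_gt0 mB cC BC CU oU (gs c) (hs c) Ys Zs
  (Ls c) (ps c) (gT c) (hT c) Ysym Zsym (L_sym c) (p_sym c) gv PL s.
split.
- by apply: tame_eq T1; exists 1 => // t x _; exact: E1.
- by apply: tame_eq T2; exists 1 => // t x _; exact: E2.
- by apply: quadratic_eq T3; exists 1 => // t x _ Bx; rewrite E1// E2.
Qed.

(** The momentum variation [p] is arbitrary: around the Legendre momentum it changes the first-order
    action at order t^2 only. *)
Lemma stegr_action_derive (D : region X) g h p (l : R) :
  lorentz_metric g -> sym2_field h -> density3_field p ->
  is_derive (0 : R) (1 : R) (fun t : R => stegr_action kappa2 Gamma D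
    (fun c x => g c x + t *: h c x)) l <->
  is_derive (0 : R) (1 : R) (fun t : R => stegr_action_H kappa2 Gamma D
    (fun c x => g c x + t *: h c x)
    (fun c x r m n => legendre_field kappa2 Gamma g c x r m n + t * p c x r m n)) l.
Proof.
move=> gl hf pf; split; apply: integral_on_derive => i;
    have finB := piece_finite i; have mB := @piece_measurable R X D i.
  have [T1 T2] := piece_gap i 1 gl hf pf.
  move=> /(quadratic_eq (h := fun q => _ q - _ q)) Q.
  apply: (integral4_quadratic mB finB T2 T1); apply: Q.
  by exists 1 => // t x _ _; rewrite mul1r.
(* The sign -1 exchanges the roles of the two actions. *)
have [T1 T2] := piece_gap i (-1) gl hf pf.
move=> /(quadratic_eq (h := fun q => _ q - _ q)) Q.
apply: (integral4_quadratic mB finB T1 T2); apply: Q.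
by exists 1 => // t x _ _; rewrite mulN1r opprB.
Qed.

End Variation.

(** * The momentum equation *)

Section Momentum.
Variables (R : realType) (kappa2 : R) (X : manifold4 R).
Hypothesis kappa2_gt0 : 0 < kappa2.
Variable Gamma : chart X -> 'rV[R]_4 -> tensor3 R.
Hypothesis Gamma_conn : affine_connection Gamma.

Lemma measurable_cube (a : 'rV[R]_4) r : measurable ((@vec4 R) @^-1` cube a r).
Proof.
apply: measurable_vec4_closed; apply: compact_closed; last exact: cube_compact.
exact: norm_hausdorff.
Qed.

Lemma cube_relcompact (c : chart X) a r : cube a r `<=` cimg c ->
  exists2 C : set 'rV[R]_4, compact C & cube a r `<=` C /\ C `<=` cimg c.
Proof. by move=> rc; exists (cube a r); [exact: cube_compact|split]. Qed.

Lemma trivIset_ord1 (T : Type) (F : 'I_1 -> set T) : trivIset setT F.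
Proof. by move=> i j _ _ _; rewrite (ord1 i) (ord1 j). Qed.

Definition cube_region (c : chart X) a r (rc : cube a r `<=` cimg c) : region X :=
  @Region R X 1 (fun=> c) (fun=> cube a r) (fun=> measurable_cube a r)
    (fun=> cube_relcompact rc) (@trivIset_ord1 _ _).

Lemma zero_density3 : density3_field (fun (c : chart X) x => zero3 R).
Proof.
split=> //.
- by move=> c r m n; apply: smooth_on_cst; exact: cimg_open.
- move=> c d x cdx a b e; rewrite big1 ?mulr0// => r _; rewrite big1// => m _.
  by rewrite big1// => n _; rewrite mulr0.
Qed.

(** Supported in the empty set, hence allowed for every [bc]; it isolates the variation of the
    momentum. *)
Lemma zero_variation bc (D : region X) (P : chart X -> 'rV[R]_4 -> tensor3 R) :
  allowed_variation bc D P (fun c x => 0).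
Proof.
split; last first.
  by left; exists set0; [split=> //; exact: compact0|].
split=> //.
- move=> c m n; under eq_fun do rewrite mxE.
  by apply: smooth_on_cst; exact: cimg_open.
- by move=> c x; rewrite trmx0.
- by move=> c d x _; rewrite mulmx0 mul0mx.
Qed.

Lemma integral4_pos (a : 'rV[R]_4) (r m : R) (F : 'rV[R]_4 -> R) :
  0 < r -> 0 < m -> (forall x, cube a r x -> m <= F x) ->
  (@lebesgue4_measure R).-integrable ((@vec4 R) @^-1` cube a r)
    (EFin \o (fun u => F (vec4 u))) ->
  0 < integral4 (cube a r) F.
Proof.
move=> r0 m0 mF IF; have mB := measurable_cube a r.
have muB : @lebesgue4_measure R ((@vec4 R) @^-1` cube a r) = ((r *+ 2) ^+ 4)%:E.
  exact: (lebesgue4_box a (ltW r0)).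
have Im : (@lebesgue4_measure R).-integrable ((@vec4 R) @^-1` cube a r)
    (EFin \o (fun u => cst m (vec4 u))).
  have finB : (lebesgue4 ((@vec4 R) @^-1` cube a r) < +oo)%E.
    by have := ltry ((r *+ 2) ^+ 4); rewrite -muB.
  apply: (bounded_integrable mB finB (f := cst m) (K := `|m|)) => [|x _ /=]; last exact: lexx.
  exact: (@measurable_cst _ _ _ (measurableTypeR R)).
rewrite integral4E; apply: lt_le_trans (_ : \int[@lebesgue4_measure R]_(u in (@vec4 R) @^-1` cube a r) m <= _).
  by rewrite Rintegral_cst// muB mulr_gt0// exprn_gt0// pmulrn_lgt0.
by apply: le_Rintegral => // u Bu; exact: mF.
Qed.

(** The fundamental lemma of the calculus of variations, for the difference [w] between the
    nonmetricity and the velocity of [P]: were it nonzero at a point, a bump in its direction would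
    make the first variation strictly positive. *)
Lemma stationary_H_momentum bc g P : stationary_H kappa2 Gamma bc (g, P) ->
  P = legendre_field kappa2 Gamma g.
Proof.
move=> [/= gl Pf stat]; have [gf gL] := gl; have [gs _ gT _] := gf.
have [Ps P0 P_sym _] := Pf.
apply/funext => c; apply/funext => x0.
have [cx|ncx] := pselect (cimg c x0); last first.
  by rewrite /legendre_field memNset//; apply: tensor3P => r m n; exact: P0.
rewrite /legendre_field mem_set//.
have oU := @cimg_open R X c.
have gu x : cimg c x -> g c x \in unitmx by move=> /gL/lorentzian_unitmx.
have gv x : cimg c x -> 0 < sqrtmdet (g c x) by move=> /gL/lorentzian_sqrtmdet.
pose Q := nabla Gamma g c; pose hg x := ham_grad (g c x) kappa2 (P c x).
have Qs a b e : smooth_on (cimg c) (fun x => Q x a b e) by exact: nabla_smooth.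
have Qsym x : sym3 (Q x) by exact: nabla_sym3.
have hgsym x : sym3 (hg x) by exact: (ham_grad_sym3 (gT c x)).
have S_cst a : smooth_on (cimg c) (fun=> a : R) by exact: smooth_on_cst.
have S_add f h : smooth_on (cimg c) f -> smooth_on (cimg c) h ->
  smooth_on (cimg c) (fun x => f x + h x) by exact: smooth_on_add.
have S_mul f h : smooth_on (cimg c) f -> smooth_on (cimg c) h ->
  smooth_on (cimg c) (fun x => f x * h x) by exact: smooth_on_mul.
have Gs i j : smooth_on (cimg c) (fun x => invmx (g c x) i j) by exact: smooth_on_invmx.
have sVs : smooth_on (cimg c) (fun x => (sqrtmdet (g c x))^-1).
  apply: smooth_on_inv => //; first by move=> x /gv/lt0r_neq0.
  by apply: smooth_on_sqrtmdet => // x /gv; rewrite sqrtmdet_gt0.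
have ham_grad_s Z a b e : (forall a b e, smooth_on (cimg c) (fun x => Z x a b e)) ->
    smooth_on (cimg c) (fun x => ham_grad (g c x) kappa2 (Z x) a b e).
  by move=> Zs; exact: (closed_ham_grad S_cst S_add S_mul).
have ham_s Z : (forall x, sym3 (Z x)) ->
    (forall a b e, smooth_on (cimg c) (fun x => Z x a b e)) ->
    smooth_on (cimg c) (fun x => hamiltonian kappa2 (g c x) (Z x)).
  move=> Zsym Zs; apply: (@smooth_on_eq _ _
    (fun x => 2^-1 * contract3 (Z x) (ham_grad (g c x) kappa2 (Z x)))) => //.
    by move=> x cx'; rewrite (hamiltonian_ham_grad (gT c x))// gu.
  apply: (S_mul) => //; apply: (closed_contract3 S_cst S_add S_mul) => // a b e.
  exact: ham_grad_s.
pose w x := lin3 (-1) (hg x) (Q x).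
have ws a b e : smooth_on (cimg c) (fun x => w x a b e).
  by apply: (S_add) => //; apply: (S_mul) => //; exact: ham_grad_s.
have wsym x : sym3 (w x) by exact: lin3_sym3.
suff w0 : w x0 = zero3 R.
  rewrite -[LHS](legendre_ham_grad (gT c x0) (gu _ cx) (gv _ cx) kappa2_gt0 (P_sym c x0)).
  congr legendre; apply: tensor3P => a b e.
  have := congr1 (fun Z : tensor3 R => Z a b e) w0; rewrite /w /lin3 /zero3 /= mulN1r.
  by rewrite addrC => /subr0_eq/esym.
apply: contract3_self_eq0; apply/eqP/negP => /negP W_neq0.
(* The direction is frozen at [x0], so the variation is a bump times a constant tensor in this
   chart. *)
set W := w x0 in W_neq0.
have W_gt0 : 0 < contract3 W W.
  rewrite lt0r W_neq0 /contract3; do 3![apply: sumr_ge0 => ? _].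
  by rewrite -expr2 sqr_ge0.
have [r r0 rU] := cube_near (open_near oU cx).
have [chi [chi_s chi0 chi_supp]] := bump_function x0 r0.
have [p pf pE] := bump_density rU (wsym x0) chi_s chi_supp.
have chis : smooth_on (cimg c) chi.
  apply: (chi_s (cimg c) id) => // i.
  by apply: (@smooth_on_subset R setT); [exact: subsetT|exact: smooth_on_coord].
pose F x := chi x * contract3 W (w x).
have Fs : smooth_on (cimg c) F.
  apply: (S_mul) => //; exact: (closed_contract3 S_cst S_add S_mul).
have Fx0 : 0 < F x0 by rewrite mulr_gt0.
have nF : \forall x \near x0, F x0 / 2 < F x.
  have /cvgr_gt := smooth_on_continuous Fs cx; apply.
  by rewrite ltr_pdivrMr// ltr_pMr// ltr1n.
(* The integration region is a second cube, where the integrand exceeds half its value at [x0]. The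
   bump may spill over it, since only metric variations carry support or boundary conditions. *)
have [r' r'0 r'P] := cube_near (filterI (open_near oU cx) nF).
have r'U : cube x0 r' `<=` cimg c by move=> x /r'P[].
have mB := measurable_cube x0 r'.
have cB := @cube_compact R x0 r'.
have finB : (lebesgue4 ((@vec4 R) @^-1` cube x0 r') < +oo)%E.
  exact: lebesgue4_compact_lty mB cB (@subset_refl _ _).
have tame_s f : smooth_on (cimg c) f -> tame (cube x0 r') (fun q => f q.2).
  move=> sf; apply: tame_space mB cB (@subset_refl _ _) r'U oU _ => x Ux.
  exact: smooth_on_continuous sf Ux.
pose A x := contract3 (P c x) (Q x) - hamiltonian kappa2 (g c x) (P c x).
have As : smooth_on (cimg c) A.
  rewrite /A; apply: (S_add).
    exact: (closed_contract3 S_cst S_add S_mul).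
  under eq_fun do rewrite -mulN1r; apply: (S_mul) => //.
  by apply: ham_s => // x; exact: P_sym.
pose Hp x := hamiltonian kappa2 (g c x) (p c x).
have [ps _ p_sym _] := pf.
have Hps : smooth_on (cimg c) Hp by apply: ham_s => // x; exact: p_sym.
(* With [g] fixed the action along [P + t p] is exactly quadratic in [t]; [w1] drops the term in
   t^2, which leaves the derivative at 0 unchanged. *)
pose w2 (q : R * 'rV[R]_4) := A q.2 + q.1 * F q.2 + - 1 * q.1 * (q.1 * Hp q.2).
pose w1 (q : R * 'rV[R]_4) := A q.2 + q.1 * F q.2.
have tw1 : tame (cube x0 r') w1.
  apply: tame_add; first exact: tame_s.
  by apply: tame_mul; [exact: tame_time|exact: tame_s].
have ttHp : tame (cube x0 r') (fun q => q.1 * Hp q.2).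
  by apply: tame_mul; [exact: tame_time|exact: tame_s].
have tmt : tame (cube x0 r') (fun q => -1 * q.1).
  by apply: tame_mul; [exact: tame_cst|exact: tame_time].
have tw2 : tame (cube x0 r') w2 by apply: tame_add => //; exact: tame_mul.
have q12 : quadratic (cube x0 r') (fun q => w1 q - w2 q).
  apply: (quadratic_eq (f := fun q => q.1 * (q.1 * Hp q.2))).
    by exists 1 => // t x _ _; rewrite /w1 /w2 /=; ring.
  apply: quadratic_mul => //; first exact: tame_time.
  by move=> x _; rewrite mul0r.
have D2 : is_derive (0 : R) (1 : R) (fun t : R => integral4 (cube x0 r') (fun x => w2 (t, x))) 0.
  have := stat (cube_region r'U) _ p (zero_variation bc _ P) pf.
  have -> // : (fun t : R => stegr_action_H kappa2 Gamma (cube_region r'U)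
           (fun c x => g c x + t *: 0)
           (fun c x r m n => P c x r m n + t * p c x r m n)) =
     (fun t : R => integral4 (cube x0 r') (fun x => w2 (t, x))).
  apply/funext => t; rewrite /stegr_action_H /integral_on big_ord_recl big_ord0 addr0 /=.
  apply: eq_integral4 => x /r'U cx'.
  have -> : (fun c x => g c x + t *: 0) = g.
    by apply/funext => c'; apply/funext => x'; rewrite scaler0 addr0.
  rewrite scaler0 addr0.
  have -> : (fun r m n => P c x r m n + t * p c x r m n) = lin3 t (p c x) (P c x).
    by apply: tensor3P => a b e; rewrite /lin3 addrC.
  rewrite contract3_linl (hamiltonian_lin3 (gT c x) (gu _ cx') (gv _ cx') _ _ (P_sym c x))//.
  rewrite /w2 /A /F /Hp /=.
  have -> : chi x * contract3 W (w x) = contract3 (p c x) (w x).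
    rewrite pE// /contract3 mulr_sumr; apply: eq_bigr => a _.
    rewrite mulr_sumr; apply: eq_bigr => b _; rewrite mulr_sumr.
    by apply: eq_bigr => e _; rewrite mulrA.
  rewrite /w contract3_linr -/(hg x) -/(Q x); ring.
have D1 : is_derive (0 : R) (1 : R) (fun t : R => integral4 (cube x0 r') (fun x => w1 (t, x))) 0.
  exact: is_derive_quadratic (integral4_quadratic mB finB tw1 tw2 q12) D2.
have integ f : smooth_on (cimg c) f -> (@lebesgue4_measure R).-integrable
    ((@vec4 R) @^-1` cube x0 r') (EFin \o (fun u => f (vec4 u))).
  move=> /tame_s[e [K [e0 _ /(_ 0)]]]; rewrite normr0 => /(_ e0)[fb mf].
  by apply: (bounded_integrable mB finB (K := K) mf) => x Bx; have [] := fb x Bx.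
pose IA := integral4 (cube x0 r') A; pose IF := integral4 (cube x0 r') F.
(* The truncated action is affine in [t], so its derivative is the integral of [F] and no limit is
   exchanged with the integral. *)
have E1 : (fun t : R => integral4 (cube x0 r') (fun x => w1 (t, x))) =
    (fun t => IA + IF * t).
  apply/funext => t; rewrite /IA /IF !integral4E -RintegralZr//; last exact: integ.
  rewrite -RintegralD//; first last.
  - apply: (integ (fun x => F x * t)); exact: S_mul.
  - exact: integ.
  by apply: eq_Rintegral => u _; rewrite /w1 /= mulrC.
have D3 : is_derive (0 : R) (1 : R) (fun t : R => IA + IF * t) IF.
  by apply: is_derive_eq; rewrite /GRing.scale /=; ring.
rewrite E1 in D1.
have IF0 : IF = 0.
  by rewrite -(@derive_val _ _ _ _ _ _ _ D3) (@derive_val _ _ _ _ _ _ _ D1).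
have : 0 < IF.
  apply: (integral4_pos r'0 (divr_gt0 Fx0 (ltr0Sn R 1))); last exact: integ.
  by move=> x /r'P[_ /ltW].
by rewrite IF0 ltxx.
Qed.

End Momentum.

Theorem theorem2 (R : realType) (kappa2 : R) (X : manifold4 R)
    (Gamma : chart X -> 'rV[R]_4 -> tensor3 R)
    (bc : region X -> (chart X -> 'rV[R]_4 -> 'M[R]_4) -> Prop) :
  0 < kappa2 ->
  affine_connection Gamma -> torsionless Gamma -> flat Gamma ->
  [/\ forall g : 'M[R]_4, g^T = g -> lorentzian g ->
        set_bij (@sym3 R) (@sym3 R) (legendre kappa2 g),
      forall (g : 'M[R]_4) (Q : tensor3 R),
        g^T = g -> lorentzian g -> sym3 Q ->
        hamiltonian kappa2 g (legendre kappa2 g Q) =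
        contract3 (legendre kappa2 g Q) Q - lagrangian kappa2 g Q &
      set_bij (stationary kappa2 Gamma bc) (stationary_H kappa2 Gamma bc)
        (fun g => (g, legendre_field kappa2 Gamma g))].
Proof.
move=> kappa2_gt0 Gamma_conn _ _; split.
- move=> g gT gL; apply: legendre_set_bij => //; first exact: lorentzian_unitmx.
  exact: lorentzian_sqrtmdet.
- move=> g Q gT gL hQ; apply: hamiltonian_legendre => //; first exact: lorentzian_unitmx.
  exact: lorentzian_sqrtmdet.
split.
- move=> g [gl stat]; split; [exact: gl|exact: legendre_field_density|].
  move=> D h p [hf hbc] pf.
  (* The allowed metric variations agree because both surface terms use the Legendre field. *)
  exact: (stegr_action_derive kappa2_gt0 Gamma_conn D 0 gl hf pf).1
    (stat D h (conj hf hbc)).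
- by move=> g g' _ _ [].
move=> [g P] gP; have PE := stationary_H_momentum kappa2_gt0 Gamma_conn gP.
exists g; last by rewrite PE.
(* Once the momentum is the Legendre field, the metric equation follows by testing with the zero
   momentum variation. *)
subst P; have [gl _ stat] := gP; split; first exact: gl.
move=> D h hvar; have [hf _] := hvar.
have zero_density := @zero_density3 R X.
exact: (stegr_action_derive kappa2_gt0 Gamma_conn D 0 gl hf zero_density).2
  (stat D h _ hvar zero_density).
Qed.
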